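(* Let $n \ge 1$ be an integer, let $g_0(t) = 2^{1/4} e^{-\pi t^2}$ be the standard Gaussian on $\mathbb{R}$, and let $$\Lambda_h = S_h \mathbb{Z}^2, \qquad S_h = \frac{1}{\sqrt{2n}} \begin{pmatrix} \frac{\sqrt[4]{3}}{\sqrt{2}} & 0 \\ \frac{\sqrt{2}}{2\sqrt[4]{3}} & \frac{\sqrt{2}}{\sqrt[4]{3}} \end{pmatrix}$$ be the hexagonal lattice of density $2n$. For a lattice $\Lambda = S\mathbb{Z}^2 \subset \mathbb{R}^2$ ($S$ a real invertible $2\times 2$ matrix) of density $2n$, denote by $B_{g_0,2n}(\Lambda)$ the (sharp) upper frame bound of the Gabor system $\mathcal{G}(g_0,\Lambda)$. Then for every lattice $\Lambda = S\mathbb{Z}^2$ of density $2n$, $$B_{g_0,2n}(\Lambda_h) \le B_{g_0,2n}(\Lambda),$$ with equality only if $\Lambda = \widetilde{S}_h \mathbb{Z}^2$ with $\widetilde{S}_h = Q S_h \mathcal{B}$ for some orthogonal $2 \times 2$ matrix $Q$ and some $\mathcal{B} \in SL(2,\mathbb{Z})$.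
   Context: For $\lambda = (x,\omega) \in \mathbb{R}^2$, the time-frequency shift is $\pi(\lambda) g(t) = e^{2\pi i \omega t} g(t-x)$. For $g \in L^2(\mathbb{R})$ and a lattice $\Lambda \subset \mathbb{R}^2$, the Gabor system is $\mathcal{G}(g,\Lambda) = \{\pi(\lambda) g : \lambda \in \Lambda\}$. A lattice is a set $\Lambda = S\mathbb{Z}^2$ with $S$ a real invertible $2\times 2$ matrix; its volume is $\mathrm{vol}(\Lambda) = |\det S|$ and its density (or redundancy) is $1/\mathrm{vol}(\Lambda)$. The sharp frame bounds of $\mathcal{G}(g,\Lambda)$ are the optimal constants $A$ (largest possible) and $B$ (smallest possible) such that $$A \|f\|^2 \le \sum_{\lambda \in \Lambda} |\langle f, \pi(\lambda) g\rangle|^2 \le B\|f\|^2 \quad \text{for all } f \in L^2(\mathbb{R}).$$ ''Upper frame bound'' always means the sharp one; it equals the operator norm of the frame operator $f \mapsto \sum_{\lambda\in\Lambda} \langle f, \pi(\lambda) g\rangle \pi(\lambda) g$. *)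

(* Defs.v *)
From HB Require Import structures.
From mathcomp Require Import all_boot all_order all_algebra.
From mathcomp Require Import complex.
From mathcomp Require Import all_classical all_reals all_analysis.
Set Implicit Arguments.
Unset Strict Implicit.
Unset Printing Implicit Defensive.
Import Order.TTheory GRing.Theory Num.Theory.
Import numFieldNormedType.Exports.
Local Open Scope classical_set_scope.
Local Open Scope ring_scope.
Local Open Scope complex_scope.

(* Elements of L^2(R; C) are represented by functions, not by classes modulo
   almost-everywhere equality. Complex-valued functions are measured and
   integrated through their real and imaginary parts. *)
Definition abs2 (R : realType) (z : R[i]) : R :=
  ComplexField.Normc.normc z ^+ 2.

Definition sqnorm (R : realType) (f : R -> R[i]) : \bar R :=
  (\int[lebesgue_measure]_t (abs2 (f t))%:E)%E.

Definition L2 (R : realType) : set (R -> R[i]) :=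
  [set f | [/\ measurable_fun setT (fun t : R => complex.Re (f t)),
               measurable_fun setT (fun t : R => complex.Im (f t))
             & (sqnorm f < +oo)%E]].

Definition cintegral (R : realType) (f : R -> R[i]) : R[i] :=
  Rintegral lebesgue_measure setT (fun t : R => complex.Re (f t)) +i*
  Rintegral lebesgue_measure setT (fun t : R => complex.Im (f t)).

Definition inner (R : realType) (f g : R -> R[i]) : R[i] :=
  cintegral (fun t => f t * conjc (g t)).

Definition expi (R : realType) (theta : R) : R[i] :=
  cos theta +i* sin theta.

(* A point (x, omega) of the time-frequency plane is a column vector. *)
Definition tfshift (R : realType) (lambda : 'cV[R]_2) (g : R -> R[i]) :
    R -> R[i] :=
  let x := lambda 0 0 in let omega := lambda 1 0 in
  fun t => expi (2 * pi * omega * t) * g (t - x).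

Definition lattice (R : realType) (S : 'M[R]_2) : set 'cV[R]_2 :=
  [set S *m map_mx intr k | k in [set: 'cV[int]_2]].

Definition vol (R : realType) (S : 'M[R]_2) : R := `|\det S|.

Definition density (R : realType) (S : 'M[R]_2) : R := (vol S)^-1.

Definition is_upper_frame_bound (R : realType) (g : R -> R[i])
    (Lambda : set 'cV[R]_2) (B : R) : Prop :=
  forall f, L2 f ->
    (\esum_(lambda in Lambda) (abs2 (inner f (tfshift lambda g)))%:E
       <= B%:E * sqnorm f)%E.

(* The sharp upper frame bound; +oo when no finite bound exists. *)
Definition upper_frame_bound (R : realType) (g : R -> R[i])
    (Lambda : set 'cV[R]_2) : \bar R :=
  ereal_inf [set B%:E | B in is_upper_frame_bound g Lambda].

Definition gauss0 (R : realType) (t : R) : R[i] :=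
  (2 `^ 4^-1 * expR (- pi * t ^+ 2))%:C.

Definition mx2 (R : realType) (a b c d : R) : 'M[R]_2 :=
  \matrix_(i < 2, j < 2)
    if i == 0 then (if j == 0 then a else b) else (if j == 0 then c else d).

Definition hexmx (R : realType) (n : nat) : 'M[R]_2 :=
  let r3 : R := 3 `^ 4^-1 in let r2 : R := Num.sqrt 2 in
  (Num.sqrt (2 * n)%:R)^-1 *:
    mx2 (r3 / r2)         0
        (r2 / (2 * r3))   (r2 / r3).

(* Main.v *)
(* Write Theta(S) for the sum over k in Z^2 of exp(- 2 pi n^2 |S k|^2).
   Lower bound. Testing the frame inequality on the sum of the (symmetric)
   time-frequency shifts of g by 2 n S k, k in a large box, gives after expanding
   the squares and applying Poisson summation on Z^2 that every frame bound is at
   least 2 n Theta(S), since each box point contributes 2 n Theta(S)^2 on the left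
   and at most B Theta(S) on the right.
   Upper bound. For S_h the damped frame operator has, by Poisson summation in the
   frequency variable, a kernel which is dominated by a convolution kernel; the
   domination uses that the alternating theta series in the time variable are
   largest at the origin. Schur's test and removal of the damping give the bound
   2 n Theta(S_h).
   Comparison. 2 n |S k|^2 is a binary quadratic form of determinant one, so it
   remains to show that the hexagonal form minimises the theta series at the
   integers (Montgomery). For a reduced form, averaging exp over the orbits of the
   rotation of order three of the hexagonal form reduces this to an inequality
   between three exponentials; forms with a very short vector are treated apart. *)
Require Import Defs.
From HB Require Import structures.
From mathcomp Require Import all_boot all_order all_algebra.
From mathcomp Require Import complex finmap.
From mathcomp Require Import all_classical all_reals all_analysis measurable_realfun.
From mathcomp Require Import ring lra zify.
Set Implicit Arguments.
Unset Strict Implicit.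
Unset Printing Implicit Defensive.
Import Order.TTheory GRing.Theory Num.Theory.
Import numFieldNormedType.Exports.
Local Open Scope classical_set_scope.
Local Open Scope ring_scope.

(** * Absolutely summable families *)

(** The time-frequency shifts commuting with those of a lattice of volume 1/(2n) are the shifts by
    2n times that lattice. By duality the frame operator is 2n times a combination of them, whose
    coefficients, inner products of Gaussians, are positive with sum [Theta]; its norm reaches 2n
    [Theta] once some function is almost invariant under all of them. The test function is built for
    this. Evenness of the density is essential: the symmetric shifts by 2n S k then multiply without
    signs.

    A matching upper bound is proved for S_h alone. This is enough: the lower bound holds for every
    S, and equality of the frame bounds squeezes the two energies together, which identifies the
    quadratic form. The points of S_h lie on equally spaced time lines, with frequencies moved by
    half a step from one line to the next, so that the only phases left by Poisson summation are
    signs.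

    Phases are kept real, as cosines. Poisson summation itself is a limit of the binomial expansion
    of a power of the cosine, sampled at about sqrt N points, where 2N is the exponent. *)

Lemma addr_norm_ge0 (R : realDomainType) (x : R) : 0 <= x + `|x|.
Proof. by have := ler_norm (- x); rewrite normrN; lra. Qed.

(** Extended sums need nonnegative terms, so [f] is split as [(f + |f|) - |f|]. [fine] turns an
    infinite sum into 0, hence the value is meaningful under [absum f]. *)
HB.lock Definition psum (R : realType) (I : choiceType) (f : I -> R) : R :=
  fine (\esum_(i in [set: I]) (f i + `|f i|)%:E)
  - fine (\esum_(i in [set: I]) `|f i|%:E).

Section Psum.
Variables (R : realType) (I : choiceType).
Implicit Types (f g h : I -> R).

Definition absum f : Prop := (\esum_(i in [set: I]) `|f i|%:E < +oo)%E.

Let ge0EFin f : (forall i, 0 <= f i) ->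
  forall i, [set: I] i -> (0 <= (f i)%:E)%E.
Proof. by move=> f0 i _; rewrite lee_fin. Qed.

Lemma absum_le f g : (forall i, `|f i| <= `|g i|) -> absum g -> absum f.
Proof.
move=> fg; apply: le_lt_trans; apply: le_esum => i _.
by rewrite lee_fin.
Qed.

Lemma absum_norm f : absum f -> absum (fun i => `|f i|).
Proof. by apply: absum_le => i; rewrite normr_id. Qed.

Lemma absumD f g : absum f -> absum g -> absum (fun i => f i + g i).
Proof.
rewrite /absum => hf hg.
apply: (@le_lt_trans _ _ (\esum_(i in [set: I]) (`|f i|%:E + `|g i|%:E))%E).
  by apply: le_esum => i _; rewrite -EFinD lee_fin ler_normD.
by rewrite esumD ?lte_add_pinfty// => i _; rewrite lee_fin.
Qed.

Let fineK_ge0 f : (forall i, 0 <= f i) -> absum f ->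
  ((fine (\esum_(i in [set: I]) (f i)%:E))%:E = \esum_(i in [set: I]) (f i)%:E)%E.
Proof.
move=> f0 sf; apply: fineK; rewrite ge0_fin_numE; last exact/esum_ge0/ge0EFin.
rewrite (eq_esum (b := fun i => `|f i|%:E)) // => i _.
by rewrite ger0_norm.
Qed.

Lemma psum_ge0E f : (forall i, 0 <= f i) -> absum f ->
  (psum f)%:E = \esum_(i in [set: I]) (f i)%:E.
Proof.
move=> f0 sf; have e1 := fineK_ge0 f0 sf.
have sff := absumD sf sf.
have ff0 i : 0 <= f i + f i by apply: addr_ge0.
have e2 := fineK_ge0 ff0 sff.
rewrite psum.unlock.
have nf i : `|f i| = f i by rewrite ger0_norm.
have -> : \esum_(i in [set: I]) (f i + `|f i|)%:E =
    (\esum_(i in [set: I]) (f i)%:E + \esum_(i in [set: I]) (f i)%:E)%E.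
  rewrite -esumD; try exact: ge0EFin.
  by apply: eq_esum => i _; rewrite nf EFinD.
have -> : \esum_(i in [set: I]) `|f i|%:E = \esum_(i in [set: I]) (f i)%:E.
  by apply: eq_esum => i _; rewrite nf.
by rewrite -e1 -EFinD /= addrK.
Qed.

(** The value does not depend on the splitting: [(f + |f|) + h = |f| + g], and additivity on
    nonnegative families does the rest. Linearity of [psum] is obtained from this. *)
Lemma psumB_ge0 f g h : (forall i, 0 <= g i) -> (forall i, 0 <= h i) ->
  (forall i, f i = g i - h i) -> absum g -> absum h ->
  absum f /\ psum f = psum g - psum h.
Proof.
move=> g0 h0 fE sg sh.
have sf : absum f.
  apply: (absum_le _ (absumD sg sh)) => i; rewrite fE.
  by rewrite [leRHS]ger0_norm ?addr_ge0// (le_trans (ler_normB _ _))// !ger0_norm.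
split=> //.
have sf' := absum_norm sf.
have p0 i : 0 <= f i + `|f i| by exact: addr_norm_ge0.
have n0 i : 0 <= `|f i| by [].
have sp := absumD sf sf'.
have : psum (fun i => (f i + `|f i|) + h i) = psum (fun i => `|f i| + g i).
  by congr psum; apply/funext => i; rewrite fE; ring.
have D u v : (forall i, 0 <= u i) -> (forall i, 0 <= v i) -> absum u -> absum v ->
    psum (fun i => u i + v i) = psum u + psum v.
  move=> u0 v0 su sv; apply: EFin_inj; rewrite [RHS]EFinD !psum_ge0E//.
  - by under eq_esum do rewrite EFinD; rewrite esumD//; exact: ge0EFin.
  - by move=> i; apply: addr_ge0.
  - exact: absumD.
rewrite (D _ _ p0 h0 sp sh) (D _ _ n0 g0 sf' sg).
suff -> : psum f = psum (fun i => f i + `|f i|) - psum (fun i => `|f i|).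
  lra.
apply: EFin_inj; rewrite [RHS]EFinB (psum_ge0E p0 sp) (psum_ge0E n0 sf').
by rewrite psum.unlock [LHS]EFinB (fineK_ge0 p0 sp) (fineK_ge0 n0 sf').

Qed.

Lemma eq_psum f g : f =1 g -> psum f = psum g.
Proof. by move=> /funext ->. Qed.

Lemma psumE f : absum f ->
  psum f = psum (fun i => f i + `|f i|) - psum (fun i => `|f i|).
Proof.
move=> sf; have [|||||_ //] := @psumB_ge0 f (fun i => f i + `|f i|) (fun i => `|f i|).
- by move=> i; exact: addr_norm_ge0.
- by [].
- by move=> i; rewrite addrK.
- exact/absumD/absum_norm.
- exact: absum_norm.
Qed.

Let psumD_ge0 f g : (forall i, 0 <= f i) -> (forall i, 0 <= g i) ->
  absum f -> absum g -> psum (fun i => f i + g i) = psum f + psum g.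
Proof.
move=> u0 v0 su sv; apply: EFin_inj; rewrite [RHS]EFinD !psum_ge0E//.
- by under eq_esum do rewrite EFinD; rewrite esumD//; exact: ge0EFin.
- by move=> i; apply: addr_ge0.
- exact: absumD.
Qed.

Lemma psumD f g : absum f -> absum g ->
  psum (fun i => f i + g i) = psum f + psum g.
Proof.
move=> sf sg; have sf' := absum_norm sf; have sg' := absum_norm sg.
have p0 (u : I -> R) i : 0 <= u i + `|u i| by exact: addr_norm_ge0.
have spf := absumD sf sf'; have spg := absumD sg sg'.
rewrite (psumE sf) (psumE sg).
have [|||||_ ->] := @psumB_ge0 (fun i => f i + g i)
  (fun i => (f i + `|f i|) + (g i + `|g i|)) (fun i => `|f i| + `|g i|).
- by move=> i; apply: addr_ge0.
- by move=> i; apply: addr_ge0.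
- by move=> i; ring.
- exact: absumD.
- exact: absumD.
rewrite (psumD_ge0 (p0 f) (p0 g) spf spg).
rewrite (psumD_ge0 (fun=> normr_ge0 _) (fun=> normr_ge0 _) sf' sg'); ring.
Qed.

Lemma psum0 : psum (fun _ : I => 0 : R) = 0 /\ absum (fun _ : I => 0 : R).
Proof.
have a0 : absum (fun _ : I => 0 : R).
  by rewrite /absum esum1 ?ltry// => i _; rewrite normr0.
by split=> //; apply: EFin_inj; rewrite psum_ge0E// esum1.
Qed.

Lemma psumN f : absum f -> psum (fun i => - f i) = - psum f.
Proof.
move=> sf; have sN : absum (fun i => - f i).
  by apply: absum_le sf => i; rewrite normrN.
have := psumD sf sN.
under [X in psum X]eq_fun do rewrite subrr.
by rewrite psum0.1 => /eqP; rewrite eq_sym addrC addr_eq0 => /eqP.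
Qed.

Lemma absumN f : absum f -> absum (fun i => - f i).
Proof. by apply: absum_le => i; rewrite normrN. Qed.

Lemma absumB f g : absum f -> absum g -> absum (fun i => f i - g i).
Proof. by move=> sf sg; apply: absumD => //; apply: absumN. Qed.

Lemma psumB f g : absum f -> absum g ->
  psum (fun i => f i - g i) = psum f - psum g.
Proof. by move=> sf sg; rewrite psumD ?psumN//; apply: absumN. Qed.

Lemma psum_ge0 f : (forall i, 0 <= f i) -> 0 <= psum f.
Proof.
move=> f0; rewrite psum.unlock.
have E : \esum_(i in [set: I]) (f i + `|f i|)%:E =
  (\esum_(i in [set: I]) `|f i|%:E + \esum_(i in [set: I]) `|f i|%:E)%E.
  rewrite -esumD//=; try by move=> i _; rewrite lee_fin.
  by apply: eq_esum => i _; rewrite -EFinD ger0_norm.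
rewrite E; set e := esum _ _.
have : (0 <= e)%E by apply: esum_ge0 => i _; rewrite lee_fin.
by case: e => [r||]//=; rewrite ?lee_fin ?subrr//; lra.
Qed.

Lemma le_psum f g : absum f -> absum g -> (forall i, f i <= g i) ->
  psum f <= psum g.
Proof.
move=> sf sg fg; rewrite -subr_ge0 -psumB//.
by apply: psum_ge0 => i; rewrite subr_ge0.
Qed.

Lemma norm_psum f : absum f -> `|psum f| <= psum (fun i => `|f i|).
Proof.
move=> sf; have sf' := absum_norm sf.
rewrite ler_norml; apply/andP; split.
  by rewrite -psumN//; apply: le_psum => //; [exact: absumN|move=> i; rewrite lerNnormlW].
by apply: le_psum => // i; rewrite ler_norm.
Qed.

Lemma finsum_le_psum f (s : seq I) : (forall i, 0 <= f i) -> absum f -> uniq s ->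
  \sum_(i <- s) f i <= psum f.
Proof.
move=> f0 sf us; rewrite -lee_fin psum_ge0E// -sumEFin.
apply: ereal_sup_ubound; exists [set` s].
  by split => //; apply: finite_seq.
by rewrite fsbig_finite/=; [rewrite set_fsetK big_seq_fset| exact: finite_seq] || rewrite -fsbig_seq.
Qed.

Lemma psum_le f (M : R) : (forall i, 0 <= f i) ->
  (forall s : seq I, uniq s -> \sum_(i <- s) f i <= M) -> absum f /\ psum f <= M.
Proof.
move=> f0 H.
have le : (\esum_(i in [set: I]) (f i)%:E <= M%:E)%E.
  apply: ge_ereal_sup => _ [X [finX _] <-].
  rewrite fsbig_finite//= sumEFin lee_fin.
  by apply: H; apply: fset_uniq.
have sf : absum f.
  rewrite /absum; under eq_esum do rewrite ger0_norm//.
  exact: le_lt_trans le (ltry _).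
by split => //; rewrite -lee_fin psum_ge0E.
Qed.

Lemma absumZ c f : absum f -> absum (fun i => c * f i).
Proof.
move=> sf; have [//||+ _] := @psum_le (fun i => `|c * f i|) (`|c| * psum (fun i => `|f i|)).
  move=> s us; under eq_bigr do rewrite normrM.
  rewrite -mulr_sumr ler_wpM2l//; apply: finsum_le_psum => //.
  exact: absum_norm.
by apply: absum_le => i; rewrite normr_id.
Qed.

(** Partial sums give only [<=] for a positive factor [d]; the same inequality for [d^-1] is the
    reverse one. Signs are treated last. *)
Lemma psumZ c f : absum f -> psum (fun i => c * f i) = c * psum f.
Proof.
have P d g : 0 < d -> (forall i, 0 <= g i) -> absum g ->
    psum (fun i => d * g i) <= d * psum g.
  move=> d0 g0 sg; have [||_ //] := @psum_le (fun i => d * g i) (d * psum g).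
    by move=> i; apply: mulr_ge0 => //; apply: ltW.
  move=> s us; rewrite -mulr_sumr; apply: ler_wpM2l; first exact: ltW.
  exact: finsum_le_psum.
have PE d g : 0 < d -> (forall i, 0 <= g i) -> absum g ->
    psum (fun i => d * g i) = d * psum g.
  move=> d0 g0 sg; apply/eqP; rewrite eq_le P//=.
  have := @P d^-1 (fun i => d * g i); rewrite invr_gt0 d0 => /(_ isT).
  under [X in psum X <= _]eq_fun do rewrite mulKf ?gt_eqF//.
  rewrite -(ler_pM2l d0) mulVKf ?gt_eqF//; apply.
    by move=> i; rewrite mulr_ge0// ltW.
  exact: absumZ.
have PD d g : 0 < d -> absum g -> psum (fun i => d * g i) = d * psum g.
  move=> d0 sg; have sn := absum_norm sg; have sp := absumD sg sn.
  rewrite (psumE sg) mulrBr -(PE d _ d0 (fun i => addr_norm_ge0 (g i)) sp).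
  rewrite -(PE d _ d0 (fun i => normr_ge0 (g i)) sn).
  rewrite -(psumB (absumZ d sp) (absumZ d sn)).
  by apply: eq_psum => i; rewrite mulrDr addrK.
move=> sf; have [c0|c0|->] := ltgtP c 0.
- rewrite -[c]opprK mulNr -PD ?oppr_gt0// -psumN; last exact: absumZ.
  by congr psum; apply/funext => i; rewrite mulNr.
- exact: PD.
- by rewrite mul0r; under [X in psum X]eq_fun do rewrite mul0r; rewrite psum0.1.
Qed.

Lemma eq_absum f g : f =1 g -> absum f -> absum g.
Proof. by move=> /funext ->. Qed.

Lemma psum_sum (J : Type) (s : seq J) (F : J -> I -> R) :
  (forall j, absum (F j)) ->
  absum (fun i => \sum_(j <- s) F j i) /\
  psum (fun i => \sum_(j <- s) F j i) = \sum_(j <- s) psum (F j).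
Proof.
move=> sF; elim: s => [|j s [IH1 IH2]].
  under [X in absum X]eq_fun do rewrite big_nil.
  under [X in psum X]eq_fun do rewrite big_nil.
  by rewrite big_nil psum0.1; split => //; exact: psum0.2.
under [X in absum X]eq_fun do rewrite big_cons.
under [X in psum X]eq_fun do rewrite big_cons.
by rewrite big_cons psumD// IH2; split => //; exact: absumD.
Qed.

Lemma psum_finite f (s : seq I) : uniq s -> (forall i, i \notin s -> f i = 0) ->
  absum f /\ psum f = \sum_(i <- s) f i.
Proof.
move=> us f0.
have B g : (forall i, 0 <= g i) -> (forall i, i \notin s -> g i = 0) ->
    absum g /\ psum g = \sum_(i <- s) g i.
  move=> g0 gs; have [|sg le] := @psum_le g (\sum_(i <- s) g i) g0.
    move=> r ur; rewrite (bigID (mem s)) /= [X in _ + X]big1 ?addr0; last first.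
      by move=> i /gs.
    rewrite -big_filter [leRHS](bigID (mem r))/= -[X in _ <= X + _]big_filter.
    rewrite (perm_big [seq x <- s | x \in r])/=; last first.
      apply: uniq_perm; rewrite ?filter_uniq// => i.
      by rewrite !mem_filter andbC.
    by rewrite lerDl sumr_ge0.
  by split=> //; apply/eqP; rewrite eq_le le finsum_le_psum.
have fn0 i : i \notin s -> `|f i| = 0 by move=> /f0 ->; rewrite normr0.
have [sn en] := B (fun i => `|f i|) (fun=> normr_ge0 _) fn0.
have sf : absum f by apply: absum_le sn => i; rewrite normr_id.
split=> //; rewrite psumE// en.
have [||_ ->] := B (fun i => f i + `|f i|).
- by move=> i; exact: addr_norm_ge0.
- by move=> i hi; rewrite f0// normr0 addr0.
by rewrite big_split/= addrK.
Qed.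

Lemma psum_gt0 f i : (forall i, 0 <= f i) -> absum f -> 0 < f i -> 0 < psum f.
Proof.
move=> f0 sf fi; apply: lt_le_trans fi _.
by have := @finsum_le_psum f [:: i] f0 sf isT; rewrite big_seq1.
Qed.

Lemma psum_tail f (e : R) : (forall i, 0 <= f i) -> absum f -> 0 < e ->
  exists s : seq I, uniq s /\ psum f - e < \sum_(i <- s) f i.
Proof.
move=> f0 sf e0; apply: contrapT => /forallNP H.
have [] := @psum_le f (psum f - e) f0; last by rewrite leNgt ltrBlDl ltrDr e0.
by move=> s us; have := H s; move=> /not_andP[//|/negP]; rewrite -leNgt.
Qed.

(** Dominated convergence for series: a finite set [s] carrying all but [e / 4] of the sum of [g]
    also carries all but [e / 4] of those of [F N] and [f], and on [s] the convergence is that of a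
    finite sum. *)
Lemma tannery (F : nat -> I -> R) f g : absum g ->
  (\forall N \near \oo, forall i, `|F N i| <= g i) ->
  (forall i, F N i @[N --> \oo] --> f i) ->
  absum f /\ psum (F N) @[N --> \oo] --> psum f.
Proof.
move=> sg dom cv.
have fg i : `|f i| <= g i.
  have cn : `|F N i| @[N --> \oo] --> `|f i| by apply: cvg_norm; exact: cv.
  rewrite -(cvg_lim _ cn)//; apply: limr_le; first by apply/cvg_ex; exists `|f i|.
  by near=> N; move: i {cn}; near: N.
have g0 i : 0 <= g i by apply: le_trans (fg i).
have sf : absum f by apply: absum_le sg => i; rewrite (ger0_norm (g0 i)).
split=> //; apply/cvgrPdist_lt => e e0.
have [|s [us hs]] := @psum_tail g (e / 4) g0 sg; first by rewrite divr_gt0.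
have cs : (\sum_(i <- s) F N i) @[N --> \oo] --> \sum_(i <- s) f i.
  elim: s {us hs} => [|i s IHs].
    by under eq_cvg do rewrite big_nil; rewrite big_nil; exact: cvg_cst.
  under eq_cvg do rewrite big_cons; rewrite big_cons.
  by apply: cvgD => //; exact: cv.
have key h : absum h -> (forall i, `|h i| <= g i) ->
    `|psum h - \sum_(i <- s) h i| < e / 4.
  move=> sh hg.
  pose u i := if i \in s then h i else 0.
  have [|su eu] := @psum_finite u s us; first by move=> i /negbTE; rewrite /u => ->.
  have -> : \sum_(i <- s) h i = psum u.
    by rewrite eu big_seq [RHS]big_seq; apply: eq_bigr => i; rewrite /u => ->.
  pose v i := if i \in s then g i else 0.
  have [|sv ev] := @psum_finite v s us; first by move=> i /negbTE; rewrite /v => ->.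
  have gv : \sum_(i <- s) g i = psum v.
    by rewrite ev big_seq [RHS]big_seq; apply: eq_bigr => i; rewrite /v => ->.
  have shu := absumB sh su.
  rewrite -psumB//; apply: le_lt_trans (norm_psum shu) _.
  apply: (@le_lt_trans _ _ (psum (fun i => g i - v i))).
    apply: le_psum; [exact: absum_norm|exact: absumB|].
    by move=> i; rewrite /u /v; case: ifP; rewrite ?subrr ?normr0 ?subr0.
  by rewrite psumB// -gv; lra.
near=> N.
have dN : forall i, `|F N i| <= g i by near: N.
have sN : absum (F N) by apply: absum_le sg => i; rewrite (ger0_norm (g0 i)).
have kN := key _ sN dN.
have kf := key _ sf fg.
have : `|\sum_(i <- s) f i - \sum_(i <- s) F N i| < e / 4.
  by near: N; move/cvgrPdist_lt : cs; apply; rewrite divr_gt0.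
move: kN kf; rewrite !ltr_norml => /andP[? ?] /andP[? ?] /andP[? ?].
by apply/andP; split; lra.
Unshelve. all: by end_near. Qed.

End Psum.

Section Psum2.
Variables (R : realType) (I J : choiceType).

Lemma reindex_absum (e : I -> J) (f : J -> R) : bijective e ->
  absum f -> absum (fun i => f (e i)).
Proof.
move=> be; rewrite /absum (@reindex_esum R I J setT setT e)//.
by rewrite setTT_bijective.
Qed.

Lemma reindex_psum (e : I -> J) (f : J -> R) : bijective e ->
  psum f = psum (fun i => f (e i)).
Proof.
move=> be; rewrite psum.unlock !(@reindex_esum R I J setT setT e)//.
all: by rewrite setTT_bijective.
Qed.

Lemma psum_fubini_ge0 (F : I * J -> R) : (forall k, 0 <= F k) -> absum F ->
  [/\ forall i, absum (fun j => F (i, j)),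
      absum (fun i => psum (fun j => F (i, j))) &
      psum F = psum (fun i => psum (fun j => F (i, j)))].
Proof.
move=> F0 sF.
have E := @esum_esum R I J setT (fun=> setT) (fun i j => (F (i, j))%:E).
have {}E : \esum_(i in [set: I]) \esum_(j in [set: J]) (F (i, j))%:E = (psum F)%:E.
  rewrite E; last by move=> i j _ _; rewrite lee_fin.
  rewrite psum_ge0E//; congr esum; first by apply/seteqP; split.
  by apply/funext => -[].
have e0 i : (0 <= \esum_(j in [set: J]) (F (i, j))%:E)%E.
  by apply: esum_ge0 => j _; rewrite lee_fin.
have s1 i : absum (fun j => F (i, j)).
  rewrite /absum; under eq_esum do rewrite ger0_norm//.
  apply: (@le_lt_trans _ _ (psum F)%:E); last exact: ltry.
  rewrite -E.
  apply: esum_ge; exists [set i]; first by split => //.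
  by rewrite fsbig_set1.
have E2 : \esum_(i in [set: I]) (psum (fun j => F (i, j)))%:E = (psum F)%:E.
  by rewrite -E; apply: eq_esum => i _; rewrite psum_ge0E.
have p0 i : 0 <= psum (fun j => F (i, j)) by apply: psum_ge0.
have s2 : absum (fun i => psum (fun j => F (i, j))).
  by rewrite /absum; under eq_esum do rewrite ger0_norm//; rewrite E2 ltry.
by split=> //; apply: EFin_inj; rewrite [RHS]psum_ge0E// E2.
Qed.

Lemma psum_fubini (F : I * J -> R) : absum F ->
  [/\ forall i, absum (fun j => F (i, j)),
      absum (fun i => psum (fun j => F (i, j))) &
      psum F = psum (fun i => psum (fun j => F (i, j)))].
Proof.
move=> sF; have sn := absum_norm sF; have sp := absumD sF sn.
have [a1 a2 a3] := psum_fubini_ge0 (fun=> normr_ge0 _) sn.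
have [|b1 b2 b3] := psum_fubini_ge0 _ sp.
  by move=> k; exact: addr_norm_ge0.
have s1 i : absum (fun j => F (i, j)).
  by apply: absum_le (a1 i) => j; rewrite normr_id.
have e : (fun i => psum (fun j => F (i, j))) =
    (fun i => psum (fun j => F (i, j) + `|F (i, j)|) - psum (fun j => `|F (i, j)|)).
  by apply/funext => i; rewrite psumE.
split => //; rewrite e; first exact: absumB.
by rewrite psumB// -b3 -a3 -psumE.
Qed.

Lemma absum_prod (F : I * J -> R) : (forall k, 0 <= F k) ->
  (forall i, absum (fun j => F (i, j))) ->
  absum (fun i => psum (fun j => F (i, j))) -> absum F.
Proof.
move=> F0 s1 s2; rewrite /absum.
under eq_esum do rewrite ger0_norm//.
have E := @esum_esum R I J setT (fun=> setT) (fun i j => (F (i, j))%:E).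
rewrite [X in (X < _)%E](_ : _ = \esum_(i in [set: I]) \esum_(j in [set: J]) (F (i, j))%:E); last first.
  rewrite E; last by move=> i j _ _; rewrite lee_fin.
  congr esum; first by apply/seteqP; split.
  by apply/funext => -[].
have p0 i : 0 <= psum (fun j => F (i, j)) by apply: psum_ge0.
under eq_esum do rewrite -psum_ge0E//.
by rewrite -psum_ge0E// ltry.
Qed.

Lemma absum_mul (f : I -> R) (g : J -> R) : absum f -> absum g ->
  absum (fun k : I * J => f k.1 * g k.2).
Proof.
move=> sf sg; have := @absum_prod (fun k => `|f k.1 * g k.2|) (fun=> normr_ge0 _).
move=> H; apply: (@absum_le _ _ _ (fun k => `|f k.1 * g k.2|)).
  by move=> k; rewrite normr_id.
have e i : (fun j => `|f i * g j|) = (fun j => `|f i| * `|g j|).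
  by apply/funext => j; rewrite normrM.
apply: H => [i|]/=.
  by rewrite e; apply/absumZ/absum_norm.
rewrite [X in absum X](_ : _ = fun i => psum (fun j => `|g j|) * `|f i|).
  exact/absumZ/absum_norm.
by apply/funext => i; rewrite e psumZ 1?mulrC//; exact: absum_norm.
Qed.

Lemma psum_mul (f : I -> R) (g : J -> R) : absum f -> absum g ->
  psum (fun k : I * J => f k.1 * g k.2) = psum f * psum g.
Proof.
move=> sf sg; have [_ _ ->] := psum_fubini (absum_mul sf sg).
rewrite mulrC -psumZ//; apply: eq_psum => i /=.
by rewrite psumZ// mulrC.
Qed.

End Psum2.

(** * Elementary bounds for exp, sin, cos and pi *)

Section Elem.
Variable R : realType.
Implicit Types x y : R.

Lemma derive_ge0 (f f' : R -> R) : (forall x, is_derive x 1 f (f' x)) ->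
  f 0 = 0 -> (forall x, 0 <= x -> 0 <= f' x) -> forall x, 0 <= x -> 0 <= f x.
Proof.
move=> df f0 f'0 x x0.
have /(_ (fun y _ => df y))[|c] := @MVT_segment R f f' 0 x x0.
  apply: derivable_within_continuous => y _; exact: (@ex_derive _ _ _ _ _ _ _ (df y)).
rewrite in_itv/= => /andP[c0 _] e.
by rewrite f0 !subr0 in e; rewrite e mulr_ge0// f'0.
Qed.

(** With [derive_odd_ge0] this climbs Taylor's formula one degree at a time: the remainder of [expR]
    after an odd degree is nonnegative, after an even degree it has the sign of [x]. *)
Lemma derive_even_ge0 (f f' : R -> R) : (forall x, is_derive x 1 f (f' x)) ->
  f 0 = 0 -> (forall x, 0 <= x -> 0 <= f' x) -> (forall x, x <= 0 -> f' x <= 0) ->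
  forall x, 0 <= f x.
Proof.
move=> df f0 f'0 f'1 x; have [x0|x0] := leP 0 x; first exact: derive_ge0 df f0 f'0 x x0.
have /(_ (fun y _ => df y))[|c] := @MVT_segment R f f' x 0 (ltW x0).
  apply: derivable_within_continuous => y _; exact: (@ex_derive _ _ _ _ _ _ _ (df y)).
rewrite in_itv/= => /andP[_ c0] e.
rewrite f0 !sub0r in e; have := f'1 _ c0; nra.
Qed.

Lemma derive_odd_ge0 (f f' : R -> R) : (forall x, is_derive x 1 f (f' x)) ->
  f 0 = 0 -> (forall x, 0 <= f' x) ->
  (forall x, 0 <= x -> 0 <= f x) /\ (forall x, x <= 0 -> f x <= 0).
Proof.
move=> df f0 f'0; split; first exact: derive_ge0 df f0 (fun x _ => f'0 x).
move=> x x0.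
have /(_ (fun y _ => df y))[|c] := @MVT_segment R f f' x 0 x0.
  apply: derivable_within_continuous => y _; exact: (@ex_derive _ _ _ _ _ _ _ (df y)).
rewrite in_itv/= => /andP[_ c0] e.
rewrite f0 !sub0r in e; have := f'0 c; nra.
Qed.

Ltac deriv := apply: is_derive_eq; rewrite /GRing.scale /=; lra.

Lemma expR_ge_taylor2 : (forall x, 0 <= x -> 0 <= expR x - (1 + x + x ^+ 2 / 2)) /\
  (forall x, x <= 0 -> expR x - (1 + x + x ^+ 2 / 2) <= 0).
Proof.
apply: (@derive_odd_ge0 _ (fun x => expR x - (1 + x))) => [x||x].
- deriv.
- rewrite expR0; lra.
- by rewrite subr_ge0 expR_ge1Dx.
Qed.

Lemma expR_ge_taylor3 x : 1 + x + x ^+ 2 / 2 + x ^+ 3 / 6 <= expR x.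
Proof.
rewrite -subr_ge0; move: x; have [h1 h2] := expR_ge_taylor2.
apply: (@derive_even_ge0 _ (fun x => expR x - (1 + x + x ^+ 2 / 2))) => // [x|].
- deriv.
- rewrite expR0; lra.
Qed.

Lemma expR_ge_taylor5 x :
  1 + x + x ^+ 2 / 2 + x ^+ 3 / 6 + x ^+ 4 / 24 + x ^+ 5 / 120 <= expR x.
Proof.
rewrite -subr_ge0; move: x.
have [|||h1 h2] := @derive_odd_ge0
   (fun x => expR x - (1 + x + x ^+ 2 / 2 + x ^+ 3 / 6 + x ^+ 4 / 24))
   (fun x => expR x - (1 + x + x ^+ 2 / 2 + x ^+ 3 / 6)).
- move=> x; deriv.
- rewrite expR0; lra.
- by move=> x; rewrite subr_ge0 expR_ge_taylor3.
apply: (@derive_even_ge0 _ (fun x => expR x - (1 + x + x ^+ 2 / 2 + x ^+ 3 / 6 + x ^+ 4 / 24))) => // [x|].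
- deriv.
- rewrite expR0; lra.
Qed.

Lemma sin_le x : 0 <= x -> sin x <= x.
Proof.
move=> x0; rewrite -subr_ge0; move: x x0.
apply: (@derive_ge0 _ (fun x => 1 - cos x)) => [|x _].
- by rewrite sin0 subrr.
- by rewrite subr_ge0 cos_le1.
Qed.

Lemma cos_ge x : 1 - x ^+ 2 / 2 <= cos x.
Proof.
rewrite -subr_ge0; move: x.
have h x : 0 <= x -> 0 <= cos x - (1 - x ^+ 2 / 2).
  move: x; apply: (@derive_ge0 _ (fun x => x - sin x)) => [x||x x0].
  - deriv.
  - rewrite cos0; lra.
  - by rewrite subr_ge0 sin_le.
move=> x; have [/h//|x0] := leP 0 x.
by have := h (- x); rewrite cosN sqrrN; apply; lra.
Qed.

Lemma cos_le x : cos x <= 1 - x ^+ 2 / 2 + x ^+ 4 / 24.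
Proof.
rewrite -subr_ge0; move: x.
have h1 x : 0 <= x -> 0 <= sin x - (x - x ^+ 3 / 6).
  move: x; apply: (@derive_ge0 _ (fun x => cos x - (1 - x ^+ 2 / 2))) => [x||x x0].
  - deriv.
  - rewrite sin0; lra.
  - by rewrite subr_ge0 cos_ge.
have h x : 0 <= x -> 0 <= 1 - x ^+ 2 / 2 + x ^+ 4 / 24 - cos x.
  move: x; apply: (@derive_ge0 _ (fun x => sin x - (x - x ^+ 3 / 6))) => [x||x x0].
  - deriv.
  - rewrite cos0; lra.
  - exact: h1.
move=> x; have [/h//|x0] := leP 0 x.
by have := h (- x); rewrite cosN sqrrN exprNn -signr_odd /= mul1r; apply; lra.
Qed.

(** With [s = sin (pi / 6)], the triple angle formula gives [3 s - 4 s^3 = 1], that is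
    [(s + 1) (2 s - 1)^2 = 0]; so [s = 1/2], and [sin x <= x] concludes. *)
Lemma pi_ge3 : 3 <= pi :> R.
Proof.
have pi0 := pi_gt0 R.
pose s : R := sin (pi / 6).
have s3 : 3 * s - 4 * s ^+ 3 = 1.
  have h : sin (pi / 6 + (pi / 6) *+ 2) = 1 :> R.
    by rewrite (_ : _ + _ = pi / 2) ?sin_pihalf//; field.
  rewrite sinD sin_mulr2n cos_mulr2n in h.
  rewrite -/s in h.
  have := cos2Dsin2 (pi / 6 : R); rewrite -/s => h2.
  move: h h2; set c := cos _ => h h2.
  have c2 : c ^+ 2 = 1 - s ^+ 2 by lra.
  have : s * (c ^+ 2 *+ 2 - 1) + c ^+ 2 * s *+ 2 = 1.
    by rewrite -[RHS]h; ring.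
  by rewrite c2 => ?; lra.
have s0 : 0 < s by apply: sin_gt0_pi; lra.
have : (s + 1) * (2 * s - 1) ^+ 2 = 0 by lra.
move=> /eqP; rewrite mulf_eq0 sqrf_eq0 => /orP[/eqP|/eqP]; first by lra.
move=> e; have : s <= pi / 6 by apply: sin_le; lra.
by lra.
Qed.

End Elem.

(** * Poisson summation for Gaussians *)

Section Fin.
Variable R : realType.
Implicit Types x y a s : R.

Lemma cosD_int x (z : int) : cos (x + 2 * pi * z%:~R) = cos x.
Proof.
have h y n : cos (y + 2 * pi * n%:R) = cos y.
  rewrite (_ : 2 * pi * n%:R = (pi *+ 2) *+ n); last by rewrite -[RHS]mulr_natr -(mulr_natl pi).
  exact/periodicn/cosD2pi.
case: z => n; first exact: h.
by rewrite NegzE mulrNz mulrN -[LHS](h _ n.+1) subrK.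
Qed.

Lemma sinD_int x (z : int) : sin (x + 2 * pi * z%:~R) = sin x.
Proof.
rewrite -!cosBpihalf -(cosD_int (x - pi / 2) z); congr cos; ring.
Qed.

Lemma sin_pi_int (z : int) : sin (pi * z%:~R) = 0 :> R.
Proof.
have h n : sin (pi * n%:R) = 0 :> R.
  elim: n => [|n IH]; first by rewrite mulr0 sin0.
  by rewrite -natr1 mulrDr mulr1 sinDpi IH oppr0.
case: z => n; first exact: h.
by rewrite NegzE mulrNz mulrN sinN h oppr0.
Qed.

Lemma sin_frac_neq0 (l : nat) (q : int) : (0 < l)%N -> ~~ (l%:Z %| q)%Z ->
  sin (pi * q%:~R / l%:R : R) != 0.
Proof.
move=> l0 lq; rewrite (divz_eq q l%:Z); set d := (q %/ l)%Z.
have e0 : (q %% l)%Z != 0 by apply: contra lq => /eqP/dvdz_mod0P.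
have : (0 <= q %% l < l%:Z)%Z by rewrite modz_ge0 ?ltz_pmod//; lia.
case E : (q %% l)%Z e0 => [e|//] e0 /andP[_ el].
have lR : 0 < l%:R :> R by rewrite ltr0n.
rewrite (_ : _ / _ = pi * (e%:R / l%:R) + pi * d%:~R); last first.
  by rewrite intrD intrM; field; rewrite gt_eqF.
rewrite sinD sin_pi_int mulr0 addr0 mulf_neq0//.
  rewrite gt_eqF//; apply: sin_gt0_pi; rewrite mulr_gt0 ?pi_gt0 ?divr_gt0 ?ltr0n//=; last by lia.
  by rewrite gtr_pMr ?pi_gt0// ltr_pdivrMr// mul1r ltr_nat; lia.
by have /sin0cos1 h := sin_pi_int d; rewrite -normr_eq0 h oner_eq0.
Qed.

(** When [l] does not divide [q], multiplication by [2 sin (pi q / l)] makes the sum telescope, and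
    the two end points differ by a multiple of the period. *)
Lemma sum_cos_roots (l : nat) (q : int) a : (0 < l)%N ->
  \sum_(r < l) cos (a + 2 * pi * q%:~R * r%:R / l%:R) =
  if (l%:Z %| q)%Z then l%:R * cos a else 0.
Proof.
move=> l0; have lR : l%:R != 0 :> R by rewrite pnatr_eq0; lia.
case: ifPn => lq.
  case/dvdzP : lq => c ->.
  rewrite (eq_bigr (fun _ => cos a)); first by rewrite sumr_const card_ord mulr_natl.
  move=> r _; rewrite -(cosD_int a (c * r)); congr cos.
  by rewrite !intrM; field.
have s0 := sin_frac_neq0 l0 lq.
apply: (mulfI (mulf_neq0 (_ : 2 != 0 :> R) s0)); first by rewrite pnatr_eq0.
rewrite mulr0 mulr_sumr.
pose f (r : nat) := sin (a + 2 * pi * q%:~R * r%:R / l%:R - pi * q%:~R / l%:R).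
rewrite (eq_bigr (fun r : 'I_l => f r.+1 - f r)).
  rewrite -(big_mkord xpredT (fun r => f r.+1 - f r)) telescope_sumr// /f.
  rewrite mulr0 mul0r addr0 mulfK//.
  by rewrite addrAC sinD_int subrr.
move=> r _; rewrite /f.
rewrite (_ : a + _ * r.+1%:R / _ - _ = (a + 2 * pi * q%:~R * r%:R / l%:R) + pi * q%:~R / l%:R).
  by rewrite sinD sinB; ring.
by rewrite -natr1; field.
Qed.

(** The binomial expansion of [(e^(ix) + e^(-ix))^M] in real form; the induction is product-to-sum
    followed by Pascal's rule. *)
Lemma cos_exprn (M : nat) x :
  (2 * cos x) ^+ M = \sum_(i < M.+1) 'C(M, i)%:R * cos ((M%:R - 2 * i%:R) * x).
Proof.
elim: M => [|M IH]; first by rewrite big_ord1 expr0 bin0 mulr0 subrr mul0r cos0 mulr1.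
rewrite exprSr IH mulr_suml [RHS]big_ord_recl /= bin0 mulr0 subr0.
rewrite [X in _ = _ + X](eq_bigr (fun i : 'I_M.+1 =>
    'C(M, i.+1)%:R * cos ((M.+1%:R - 2 * i.+1%:R) * x) +
    'C(M, i)%:R * cos ((M.+1%:R - 2 * i.+1%:R) * x))); last first.
  by move=> i _; rewrite /bump leq0n add1n binS natrD mulrDl.
rewrite big_split /=.
transitivity (\sum_(i < M.+1) 'C(M, i)%:R * cos ((M.+1%:R - 2 * i%:R) * x) +
   \sum_(i < M.+1) 'C(M, i)%:R * cos ((M.+1%:R - 2 * i.+1%:R) * x)).
  rewrite -big_split /=; apply: eq_bigr => i _.
  rewrite (_ : (M.+1%:R - 2 * i%:R) * x = (M%:R - 2 * i%:R) * x + x); last first.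
    by rewrite -natr1; ring.
  rewrite (_ : (M.+1%:R - 2 * i.+1%:R) * x = (M%:R - 2 * i%:R) * x - x); last first.
    by rewrite -!natr1; ring.
  by rewrite cosD cosB; ring.
rewrite addrA; congr (_ + _).
have -> : 1%:R * cos (M.+1%:R * x) + \sum_(i < M.+1) 'C(M, i.+1)%:R * cos ((M.+1%:R - 2 * i.+1%:R) * x)
   = \sum_(i < M.+2) 'C(M, i)%:R * cos ((M.+1%:R - 2 * i%:R) * x).
  by rewrite [RHS]big_ord_recl /= bin0 mulr0 subr0.
by rewrite [RHS]big_ord_recr /= bin_small// mul0r addr0.
Qed.

(* The weight of the endpoint [2 q] of a simple random walk after [2 m] steps. *)
Definition walk (m : nat) (q : int) : R :=
  if (`|q| <= m)%N then 'C(2 * m, `|q + m%:Z|)%:R else 0.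

(* The binomial theorem on both sides: this finite Poisson formula tends to the
   one for theta series as [m] and [l ^ 2] grow proportionally. *)
Lemma sum_cos_expr (m l : nat) s : (0 < l)%N ->
  \sum_(r < l) (2 * cos (pi * (s + r%:R) / l%:R)) ^+ (2 * m) =
  l%:R * psum (fun j : int => walk m (l%:Z * j) * cos (2 * pi * j%:~R * s)).
Proof.
move=> l0; have lR : l%:R != 0 :> R by rewrite pnatr_eq0; lia.
under eq_bigr do rewrite cos_exprn.
rewrite exchange_big /=.
pose q (i : nat) : int := m%:Z - i%:Z.
transitivity (\sum_(i < (2 * m).+1 | (l%:Z %| q i)%Z) 'C(2 * m, i)%:R *
    (l%:R * cos (2 * pi * (q i)%:~R * s / l%:R))).
  rewrite [RHS]big_mkcond /=; apply: eq_bigr => i _.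
  rewrite -mulr_sumr.
  rewrite (eq_bigr (fun r : 'I_l =>
      cos (2 * pi * (q i)%:~R * s / l%:R + 2 * pi * (q i)%:~R * r%:R / l%:R))).
    by rewrite sum_cos_roots//; case: ifP => _; rewrite ?mulr0.
  move=> r _; congr cos; rewrite /q intrD mulrNz -!pmulrn natrM; field.
  exact: lR.
(* Only the frequencies [m - i] divisible by [l] survive the sum over [r]; [L] lists their quotients
   [j], the only indices at which the dual series can be nonzero. *)
pose L : seq int := [seq (q i %/ l)%Z | i <- [seq i <- iota 0 (2 * m).+1 | (l%:Z %| q i)%Z]].
have qK i : (l%:Z %| q i)%Z -> l%:Z * (q i %/ l)%Z = q i.
  by move=> h; rewrite mulrC divzK.
have uL : uniq L.
  rewrite map_inj_in_uniq ?filter_uniq ?iota_uniq// => i j.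
  rewrite !mem_filter => /andP[hi _] /andP[hj _] e.
  by have := qK _ hi; rewrite e qK// /q; lia.
have [|_ ->] := @psum_finite R _
    (fun j : int => walk m (l%:Z * j) * cos (2 * pi * j%:~R * s)) L uL.
  move=> j jL; rewrite /walk; case: ifPn => [jm|]; last by rewrite mul0r.
  case/negP : jL; apply/mapP; exists (absz (m%:Z - l%:Z * j)%R).
    rewrite mem_filter mem_iota /q; apply/andP; split; last by lia.
    by rewrite (_ : m%:Z - _ = l%:Z * j) ?dvdz_mulr//; lia.
  by rewrite /q (_ : m%:Z - _ = l%:Z * j) ?mulKz//; lia.
rewrite /L big_map big_filter mulr_sumr -(big_mkord (fun i => (l%:Z %| q i)%Z) (fun i =>
  'C(2 * m, i)%:R * (l%:R * cos (2 * pi * (q i)%:~R * s / l%:R)))).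
rewrite /index_iota subn0 big_seq_cond [RHS]big_seq_cond.
apply: eq_bigr => i /andP[]; rewrite mem_iota => im hi.
rewrite qK// /walk ifT; last by rewrite /q; lia.
rewrite (_ : 2 * pi * (q i)%:~R * s / l%:R = 2 * pi * (q i %/ l)%Z%:~R * s); last first.
  by rewrite -{1}(qK _ hi) intrM; field.
have -> : absz (q i + m%:Z)%R = (2 * m - i)%N by rewrite /q; lia.
rewrite bin_sub; last by lia.
by ring.
Qed.

End Fin.

(** * Summability of geometric and Gaussian families over the integers *)

Section GaussSum.
Variable R : realType.
Implicit Types c s t : R.

Lemma psum_geo (r : R) : 0 <= r < 1 ->
  absum (fun k : int => r ^+ `|k|%N) /\
  psum (fun k : int => r ^+ `|k|%N) <= (1 + r) / (1 - r).
Proof.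
move=> /andP[r0 r1].
have [||gN leN] := @psum_le R nat (fun n => r ^+ n) (1 - r)^-1.
- by move=> n; rewrite exprn_ge0.
- move=> u uu; have [M hM] : exists M, forall n, n \in u -> (n < M)%N.
    by exists (\max_(n <- u) n).+1 => n nu; rewrite ltnS; apply: leq_bigmax_seq.
  apply: (@le_trans _ _ (\sum_(0 <= n < M) r ^+ n)).
    rewrite /index_iota subn0 [leRHS](bigID (mem u)) /= -[leLHS]addr0 lerD//.
      rewrite -[leRHS]big_filter le_eqVlt; apply/orP; left; apply/eqP; apply: perm_big.
      apply: uniq_perm; rewrite ?filter_uniq ?iota_uniq// => n.
      rewrite mem_filter mem_iota /= add0n; case nu: (n \in u) => //=.
      by rewrite hM.
    by apply: sumr_ge0 => n _; rewrite exprn_ge0.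
  rewrite big_mkord -[leRHS]mul1r ler_pdivlMr ?subr_gt0//.
  by have e := subrX1 r M; have h := exprn_ge0 M r0; lra.
(* The integers are folded into two copies of [nat]; [Negz n] is [-(n + 1)], whence the extra factor
   [r]. *)
pose w (p : bool * nat) := (if p.1 then 1 else r) * r ^+ p.2.
have gB : absum w.
  apply: absum_prod => [p|b|].
  - by rewrite /w mulr_ge0 ?exprn_ge0//; case: ifP.
  - exact: absumZ.
  have [|//] := @psum_finite R bool (fun b => psum (fun n : nat => w (b, n))) [:: true; false] isT.
  by case.
pose e (z : int) : bool * nat := match z with Posz n => (true, n) | Negz n => (false, n) end.
have be : bijective e.
  by exists (fun p : bool * nat => if p.1 then Posz p.2 else Negz p.2) => [[]|[[] n]].
have E (k : int) : w (e k) = r ^+ `|k|%N.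
  by case: k => n; rewrite /w /= ?mul1r// -exprS.
split; first by apply: eq_absum (reindex_absum be gB).
rewrite -(eq_psum E) -(reindex_psum _ be); have [_ _ ->] := psum_fubini gB.
have [|_ ->] := @psum_finite R bool (fun b => psum (fun n : nat => w (b, n))) [:: true; false] isT.
  by case.
rewrite big_cons big_seq1 /w /= !psumZ// -mulrDl ler_wpM2l//; lra.
Qed.

Lemma absum_gauss0 c : 0 < c -> absum (fun k : int => expR (- c * k%:~R ^+ 2)).
Proof.
move=> c0; apply: absum_le (@psum_geo (expR (- c)) _).1 => [k|]; last first.
  by rewrite expR_ge0 expR_lt1 oppr_lt0.
rewrite !ger0_norm ?exprn_ge0 ?expR_ge0// -expRM_natr ler_expR !mulNr lerN2.
rewrite ler_pM2l// [leRHS](_ : _ = (`|k| ^ 2)%N%:R) ?ler_nat; first by nia.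
by rewrite natrX natr_absz intr_norm real_normK ?num_real.
Qed.

(** Reduction to the centred case by [(k + s)^2 >= k^2 / 2 - s^2]. *)
Lemma absum_gauss c s : 0 < c ->
  absum (fun k : int => expR (- c * (k%:~R + s) ^+ 2)).
Proof.
move=> c0; have c2 : 0 < c / 2 by rewrite divr_gt0.
apply: absum_le (absumZ (expR (c * s ^+ 2)) (absum_gauss0 c2)) => k.
rewrite !ger0_norm ?mulr_ge0 ?expR_ge0// -expRD ler_expR.
have := sqr_ge0 (k%:~R + 2 * s); set x := k%:~R; nra.
Qed.

End GaussSum.

(** * Gaussian bounds for binomial coefficients and powers of the cosine *)

Section Limits.
Variable R : realType.
Implicit Types c s t x : R.

Lemma walk_opp m (q : int) : walk R m (- q) = walk R m q.
Proof.
rewrite /walk abszN; case: ifPn => // h; congr (_%:R).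
rewrite (_ : absz (- q + m%:Z)%R = (2 * m - absz (q + m%:Z)%R)%N); last by lia.
by rewrite bin_sub//; lia.
Qed.

Lemma walk_ge0 m q : 0 <= walk R m q.
Proof. by rewrite /walk; case: ifP. Qed.

Lemma walk0_gt0 m : 0 < walk R m 0.
Proof. by rewrite /walk /= ltr0n bin_gt0; lia. Qed.

Lemma walkS (m q : nat) : (q < m)%N ->
  walk R m q.+1 = walk R m q * ((m%:R - q%:R) / (m%:R + q%:R + 1)).
Proof.
move=> qm; rewrite /walk !ifT; [|lia|lia].
have -> : `|q.+1 + m|%N = (m + q).+1 by lia.
have -> : `|q + m|%N = (m + q)%N by lia.
have e : ((m + q).+1 * 'C(2 * m, (m + q).+1) = (m - q) * 'C(2 * m, m + q))%N.
  by rewrite mul_bin_left; congr muln; lia.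
have d0 : m%:R + q%:R + 1 != 0 :> R by rewrite -natrD natr1 pnatr_eq0.
rewrite mulrA; apply/(canRL (mulfK d0)).
have := congr1 (fun n => n%:R : R) e; rewrite !natrM natrB; last by lia.
by rewrite -natr1 natrD mulrC => ->; rewrite mulrC.
Qed.

(** The ratio of consecutive weights is [1 - (2q + 1) / (m + q + 1)], and the odd numbers below [2Q]
    add up to [Q^2]. The induction keeps the final denominator [m + Q] throughout. *)
Lemma walk_le (m Q : nat) : (Q <= m)%N ->
  walk R m Q <= walk R m 0 * expR (- Q%:R ^+ 2 / (m%:R + Q%:R)).
Proof.
move=> Qm; have [->|Q0] := posnP Q; first by rewrite expr0n oppr0 mul0r expR0 mulr1.
suff H q : (q <= Q)%N ->
    walk R m q <= walk R m 0 * expR (- q%:R ^+ 2 / (m%:R + Q%:R)) by exact: H.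
have mQ : 0 < m%:R + Q%:R :> R by rewrite -natrD ltr0n; lia.
elim: q => [_|q IH qQ]; first by rewrite expr0n oppr0 mul0r expR0 mulr1.
rewrite walkS; last by lia.
have qR : q%:R + 1 <= Q%:R :> R by rewrite natr1 ler_nat.
have QR : Q%:R <= m%:R :> R by rewrite ler_nat.
have q0 : 0 <= q%:R :> R by [].
have -> : - q.+1%:R ^+ 2 / (m%:R + Q%:R) =
    - q%:R ^+ 2 / (m%:R + Q%:R) + - (2 * q%:R + 1) / (m%:R + Q%:R) :> R.
  by rewrite -natr1; field; rewrite gt_eqF.
rewrite expRD mulrA; apply: ler_pM.
- exact: walk_ge0.
- by rewrite divr_ge0//; lra.
- by apply: IH; lia.
apply: le_trans (expR_ge1Dx _).
rewrite -subr_ge0 (_ : _ - _ = (2 * q%:R + 1) * (Q%:R - q%:R - 1) / ((m%:R + Q%:R) * (m%:R + q%:R + 1))).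
  by rewrite divr_ge0// mulr_ge0//; lra.
by field; rewrite !gt_eqF//; lra.
Qed.

(** The inverse ratio is [1 + (2q + 1) / (m - q)], at most the exponential of [(2q + 1) / (m - Q)];
    the rest is as in [walk_le]. *)
Lemma walk_ge (m Q : nat) : (Q < m)%N ->
  walk R m 0 * expR (- Q%:R ^+ 2 / (m%:R - Q%:R)) <= walk R m Q.
Proof.
move=> Qm; suff H q : (q <= Q)%N ->
    walk R m 0 * expR (- q%:R ^+ 2 / (m%:R - Q%:R)) <= walk R m q by exact: H.
have QR : Q%:R + 1 <= m%:R :> R by rewrite natr1 ler_nat.
have mQ : 0 < m%:R - Q%:R :> R by lra.
elim: q => [_|q IH qQ]; first by rewrite expr0n oppr0 mul0r expR0 mulr1.
rewrite walkS; last by lia.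
have qR : q%:R + 1 <= Q%:R :> R by rewrite natr1 ler_nat.
have q0 : 0 <= q%:R :> R by [].
have -> : - q.+1%:R ^+ 2 / (m%:R - Q%:R) =
    - q%:R ^+ 2 / (m%:R - Q%:R) + - ((2 * q%:R + 1) / (m%:R - Q%:R)) :> R.
  by rewrite -natr1; field; rewrite gt_eqF.
rewrite expRD mulrA; apply: ler_pM.
- by rewrite mulr_ge0 ?walk_ge0 ?expR_ge0.
- exact: expR_ge0.
- by apply: IH; lia.
rewrite expRN -[leRHS]invrK lef_pV2 ?posrE ?expR_gt0//; last first.
  by rewrite invr_gt0 divr_gt0//; lra.
apply: le_trans (expR_ge1Dx _); rewrite invf_div.
rewrite -subr_ge0 (_ : _ - _ = (2 * q%:R + 1) * (Q%:R - q%:R) / ((m%:R - Q%:R) * (m%:R - q%:R))).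
  by rewrite divr_ge0// mulr_ge0//; lra.
by field; rewrite !gt_eqF//; lra.
Qed.

Lemma cosX_le (N : nat) x : - (pi / 2) <= x <= pi / 2 ->
  cos x ^+ (2 * N) <= expR (- (N%:R * x ^+ 2) + N%:R * x ^+ 2 * x ^+ 2 / 12).
Proof.
move=> xp; have c0 := cos_ge0_pihalf xp.
rewrite (_ : - _ + _ = (- x ^+ 2 / 2 + x ^+ 4 / 24) * (2 * N)%:R); last first.
  by rewrite natrM; field.
rewrite expRM_natr lerXn2r ?nnegrE ?expR_ge0//.
apply: le_trans (cos_le x) _; apply: le_trans (expR_ge1Dx _); lra.
Qed.

Lemma cosX_ge (N : nat) x : x ^+ 2 <= 1 ->
  expR (- (N%:R * x ^+ 2) / (1 - x ^+ 2 / 2)) <= cos x ^+ (2 * N).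
Proof.
move=> x1; have y0 : 0 <= x ^+ 2 by rewrite sqr_ge0.
rewrite (_ : - _ / _ = - (x ^+ 2 / 2 / (1 - x ^+ 2 / 2)) * (2 * N)%:R); last first.
  by rewrite natrM; field; rewrite gt_eqF//; lra.
have h : expR (- (x ^+ 2 / 2 / (1 - x ^+ 2 / 2))) <= cos x.
  apply: le_trans (cos_ge x).
  rewrite expRN -[leRHS]invrK lef_pV2 ?posrE ?expR_gt0 ?invr_gt0//; last by lra.
  apply: le_trans (expR_ge1Dx _); rewrite -subr_ge0.
  rewrite (_ : _ - _ = 0)//; field; rewrite !gt_eqF//; lra.
rewrite expRM_natr lerXn2r ?nnegrE ?expR_ge0//.
by apply: le_trans h; exact: expR_ge0.
Qed.

End Limits.

(** * The limit of the finite Poisson formula *)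

Section Poisson.
Variable R : realType.
Implicit Types c s t x : R.

Definition theta t s : R := psum (fun k : int => expR (- (pi * t) * (k%:~R + s) ^+ 2)).

Definition dual_theta t s : R :=
  psum (fun k : int => expR (- (pi / t) * k%:~R ^+ 2) * cos (2 * pi * k%:~R * s)).

(** The number of sample points: odd, so that the indices can be centred at 0, and close to
    [c sqrt N], the scale at which both sides of [sum_cos_expr] become theta series with parameter
    [pi / c^2]. *)
Definition period c (N : nat) : nat := (2 * Num.truncn (c * Num.sqrt N%:R / 2)).+1.

Lemma period_bounds c N : 0 < c ->
  (period c N)%:R <= c * Num.sqrt N%:R + 1 /\ c * Num.sqrt N%:R - 1 <= (period c N)%:R.
Proof.
move=> c0; rewrite /period.
have h : 0 <= c * Num.sqrt N%:R / 2 by rewrite divr_ge0// mulr_ge0// ltW.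
have := truncn_itv h; set n := Num.truncn _ => /andP[].
rewrite -[(2 * n).+1%:R]natr1 natrM -[n.+1%:R]natr1; lra.
Qed.

Lemma inv_sqrt_cvg0 : (Num.sqrt N%:R : R)^-1 @[N --> \oo] --> (0 : R).
Proof.
apply/cvgrPdist_lt => e e0; near=> N.
have N0 : e ^- 2 < N%:R.
  by near: N; exact: nbhs_infty_gtr.
rewrite sub0r normrN ger0_norm ?invr_ge0//.
have sN : e^-1 < Num.sqrt N%:R.
  have -> : e^-1 = Num.sqrt (e ^- 2).
    by rewrite -exprVn sqrtr_sqr ger0_norm// invr_ge0 ltW.
  rewrite ltr_sqrt//.
  by apply: lt_trans N0; rewrite invr_gt0 exprn_gt0.
by rewrite -[ltRHS]invrK ltf_pV2 ?posrE ?invr_gt0//; apply: lt_trans sN; rewrite invr_gt0.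
Unshelve. all: by end_near. Qed.

Lemma period_cvg c : 0 < c -> (period c N)%:R / Num.sqrt N%:R @[N --> \oo] --> c.
Proof.
move=> c0; have z := inv_sqrt_cvg0.
have u : c + (Num.sqrt N%:R)^-1 @[N --> \oo] --> c.
  by rewrite -[X in _ --> X]addr0; apply: cvgD => //; exact: cvg_cst.
have l : c - (Num.sqrt N%:R)^-1 @[N --> \oo] --> c.
  by rewrite -[X in _ --> X]subr0; apply: cvgB => //; exact: cvg_cst.
apply: squeeze_cvgr l u; near=> N.
have N0 : 0 < Num.sqrt N%:R :> R.
  by rewrite sqrtr_gt0 ltr0n; near: N; exact: nbhs_infty_gt.
have [h1 h2] := period_bounds N c0.
rewrite ler_pdivlMr// ler_pdivrMr// mulrBl mulrDl mulVf ?gt_eqF//.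
by apply/andP.
Unshelve. all: by end_near. Qed.

Lemma cosX_cvg (x : nat -> R) (A : R) :
  x N @[N --> \oo] --> (0 : R) -> N%:R * x N ^+ 2 @[N --> \oo] --> A ->
  cos (x N) ^+ (2 * N) @[N --> \oo] --> expR (- A).
Proof.
move=> x0 xA.
have x2 : x N ^+ 2 @[N --> \oo] --> (0 : R).
  under eq_cvg do rewrite expr2.
  by have := cvgM x0 x0; rewrite mulr0; apply.
have cE (u : nat -> R) (l : R) : u N @[N --> \oo] --> l -> expR (u N) @[N --> \oo] --> expR l.
  by move=> ul; apply: continuous_cvg ul; exact: continuous_expR.
have up : expR (- (N%:R * x N ^+ 2) + N%:R * x N ^+ 2 * x N ^+ 2 / 12) @[N --> \oo] --> expR (- A).
  apply: cE; rewrite (_ : - A = - A + A * 0 * 12^-1); last by rewrite mulr0 mul0r addr0.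
  apply: cvgD; first exact: cvgN.
  by apply: cvgM; [exact: cvgM|exact: cvg_cst].
have lo : expR (- (N%:R * x N ^+ 2) / (1 - x N ^+ 2 / 2)) @[N --> \oo] --> expR (- A).
  apply: cE; rewrite -[X in _ --> X]divr1; apply: cvgM; first exact: cvgN.
  apply: cvgV; first by rewrite oner_eq0.
  rewrite -[X in _ --> X]subr0 -[X in 1 - X](mul0r 2^-1).
  by apply: cvgB; [exact: cvg_cst|apply: cvgM => //; exact: cvg_cst].
apply: squeeze_cvgr lo up; near=> N.
have xN : `|x N| < 1.
  by near: N; move/cvgr0Pnorm_lt : x0; apply.
have [h1 h2] : - 1 < x N /\ x N < 1 by move: xN; rewrite ltr_norml => /andP.
have p3 := pi_ge3 R.
rewrite cosX_ge ?cosX_le//; last by nra.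
by apply/andP; split; lra.
Unshelve. all: by end_near. Qed.

Lemma walk_cvg (q : nat -> nat) (A : R) :
  (q N)%:R / N%:R @[N --> \oo] --> (0 : R) -> (q N)%:R ^+ 2 / N%:R @[N --> \oo] --> A ->
  walk R N (q N) / walk R N 0 @[N --> \oo] --> expR (- A).
Proof.
move=> q0 qA.
have cE (u : nat -> R) (l : R) : u N @[N --> \oo] --> l -> expR (u N) @[N --> \oo] --> expR l.
  by move=> ul; apply: continuous_cvg ul; exact: continuous_expR.
have up : expR (- ((q N)%:R ^+ 2 / N%:R) / (1 + (q N)%:R / N%:R)) @[N --> \oo] --> expR (- A).
  apply: cE; rewrite -[X in _ --> X]divr1; apply: cvgM; first exact: cvgN.
  apply: cvgV; first by rewrite oner_eq0.
  by rewrite -[X in _ --> X]addr0; apply: cvgD => //; exact: cvg_cst.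
have lo : expR (- ((q N)%:R ^+ 2 / N%:R) / (1 - (q N)%:R / N%:R)) @[N --> \oo] --> expR (- A).
  apply: cE; rewrite -[X in _ --> X]divr1; apply: cvgM; first exact: cvgN.
  apply: cvgV; first by rewrite oner_eq0.
  by rewrite -[X in _ --> X]subr0; apply: cvgB => //; exact: cvg_cst.
apply: squeeze_cvgr lo up; near=> N.
have N0 : 0 < N%:R :> R by rewrite ltr0n; near: N; exact: nbhs_infty_gt.
have qN : (q N < N)%N.
  rewrite -(ltr_nat R) -[ltRHS]mul1r -ltr_pdivrMr//.
  have : `|(q N)%:R / N%:R| < 1 :> R.
    by near: N; move/cvgr0Pnorm_lt : q0; apply.
  by apply: le_lt_trans; rewrite ler_norm.
have qNR : (q N)%:R < N%:R :> R by rewrite ltr_nat.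
have q00 : 0 <= (q N)%:R :> R by [].
have w0 := walk0_gt0 R N.
rewrite ler_pdivlMr// ler_pdivrMr// !(mulrC _ (walk R N 0)).
have -> : - ((q N)%:R ^+ 2 / N%:R) / (1 - (q N)%:R / N%:R) = - (q N)%:R ^+ 2 / (N%:R - (q N)%:R) :> R.
  by field; rewrite !gt_eqF//; lra.
have -> : - ((q N)%:R ^+ 2 / N%:R) / (1 + (q N)%:R / N%:R) = - (q N)%:R ^+ 2 / (N%:R + (q N)%:R) :> R.
  by field; rewrite !gt_eqF//; lra.
by rewrite walk_ge// walk_le// ltnW.
Unshelve. all: by end_near. Qed.

End Poisson.

Section Poisson2.
Variable R : realType.
Implicit Types c s t x : R.

Let half c (N : nat) : nat := Num.truncn (c * Num.sqrt N%:R / 2).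
(** The summands of the two sides of [sum_cos_expr], normalised to have termwise limits: [cosw]
    lacks the factor [4 ^ N] and is centred, [ratio] is divided by the central binomial
    coefficient. *)
Let cosw c s (N : nat) (k : int) : R := if (`|k| <= half c N)%N
  then cos (pi * (s + k%:~R) / (period c N)%:R) ^+ (2 * N) else 0.
Let ratio c s (N : nat) (j : int) : R :=
  walk R N ((period c N)%:Z * j) / walk R N 0 * cos (2 * pi * j%:~R * s).

Let absum_ratio c s N : absum (ratio c s N).
Proof.
have [||//] := @psum_finite R _ (ratio c s N)
    [seq i%:Z - N%:Z | i <- iota 0 (2 * N).+1].
  by rewrite map_inj_uniq ?iota_uniq// => i j; lia.
move=> j jL; rewrite /ratio /walk; case: ifPn => [jm|]; last by rewrite !mul0r.
case/negP : jL; apply/mapP; exists (absz (j + N%:Z)%R); last first.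
  by move: jm; rewrite /period; nia.
by rewrite mem_iota; move: jm; rewrite /period; nia.
Qed.

Let cosw_ratio c s N : 4 ^+ N * psum (cosw c s N) =
  (period c N)%:R * walk R N 0 * psum (ratio c s N).
Proof.
set p := half c N; have lE : period c N = (2 * p).+1 by [].
have w0 : walk R N 0 != 0 by rewrite gt_eqF ?walk0_gt0.
(* Replacing [s] by [s - p] centres the sample points; on the dual side it moves every phase by a
   multiple of [2 pi]. *)
have := @sum_cos_expr R N (period c N) (s - p%:R) isT.
have [||_ ->] := @psum_finite R _ (cosw c s N) [seq r%:Z - p%:Z | r <- iota 0 (period c N)].
- by rewrite map_inj_uniq ?iota_uniq// => i j; lia.
- move=> k kL; rewrite /cosw -/p ifF//; apply/negP => kp; case/negP : kL.
  by apply/mapP; exists (absz (k + p%:Z)%R); rewrite ?mem_iota; lia.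
rewrite -(big_mkord xpredT (fun r => (2 * cos (pi * (s - p%:R + r%:R) / (period c N)%:R)) ^+ (2 * N))).
rewrite /index_iota subn0 => h.
transitivity (\sum_(r <- iota 0 (period c N)) (2 * cos (pi * (s - p%:R + r%:R) / (period c N)%:R)) ^+ (2 * N)).
  rewrite big_map mulr_sumr big_seq [RHS]big_seq; apply: eq_bigr => r.
  rewrite mem_iota lE => rp.
  rewrite /cosw -/p ifT; last by lia.
  rewrite exprMn (exprM 2) (_ : 2 ^+ 2 = 4 :> R); last by ring.
  congr (_ * cos (_ * _ / _) ^+ _); rewrite intrD mulrNz -!pmulrn; ring.
rewrite h -mulrA; congr (_ * _).
rewrite -psumZ; last exact: absum_ratio.
apply: eq_psum => j; rewrite /ratio mulrCA mulrA divfK// -mulrA; congr (_ * _).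
rewrite -(cosD_int (2 * pi * j%:~R * s) (- (j * p%:Z))); congr cos.
by rewrite mulrNz intrM; ring.
Qed.

Let period_gt0 c N : 0 < (period c N)%:R :> R.
Proof. by rewrite ltr0n. Qed.

Let sqrtK_nat N : (Num.sqrt N%:R : R) ^+ 2 = N%:R.
Proof. by rewrite sqr_sqrtr. Qed.

Let inv_period_cvg c : 0 < c ->
  (Num.sqrt N%:R : R) / (period c N)%:R @[N --> \oo] --> c^-1.
Proof.
move=> c0; have : ((period c N)%:R / Num.sqrt N%:R : R)^-1 @[N --> \oo] --> c^-1.
  by apply: cvgV; [exact: lt0r_neq0|exact: period_cvg].
by apply: cvg_trans; apply: near_eq_cvg; near=> N; rewrite /= invf_div.
Unshelve. all: by end_near. Qed.

Lemma cosw_cvg c s : 0 < c -> `|s| <= 2^-1 ->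
  psum (cosw c s N) @[N --> \oo] --> theta (pi / c ^+ 2) s.
Proof.
move=> c0 s1; have p3 := pi_ge3 R.
have v := inv_period_cvg c0; have w := @inv_sqrt_cvg0 R.
(* Since [|x| <= pi / 2 < 2], [cosX_le] leaves the fraction [1 - 4 / 12 = 2 / 3] of the exponent,
   and [period <= (c + 1) sqrt N] gives the other factor. *)
pose C : R := 2 / 3 * (pi / (c + 1)) ^+ 2.
have C0 : 0 < C by rewrite mulr_gt0// exprn_gt0// divr_gt0//; lra.
have [//||//] := @tannery R _ (cosw c s) (fun k => expR (- (pi * (pi / c ^+ 2)) * (k%:~R + s) ^+ 2)) _ (absum_gauss s C0).
  near=> N => k.
  have N0 : 0 < N%:R :> R by rewrite ltr0n; near: N; exact: nbhs_infty_gt.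
  have N1 : 1 <= N%:R :> R by rewrite ler1n; near: N; exact: nbhs_infty_gt.
  rewrite /cosw; case: ifPn => kp; last by rewrite normr0 expR_ge0.
  rewrite ger0_norm; last by rewrite exprM exprn_ge0// sqr_ge0.
  have L0 := period_gt0 c N.
  set x := pi * _ / _.
  have kR : `|k%:~R| <= (half c N)%:R :> R.
    by rewrite -intr_norm -natr_absz ler_nat.
  have LE : (period c N)%:R = 2 * (half c N)%:R + 1 :> R by rewrite /period -[_.+1%:R]natr1 natrM.
  have xE : x * (period c N)%:R = pi * (s + k%:~R) by rewrite /x divfK ?gt_eqF.
  have sk : `|s + k%:~R| <= (period c N)%:R / 2.
    apply: le_trans (ler_normD _ _) _; rewrite LE; lra.
  have xb : - (pi / 2) <= x <= pi / 2.
    move: sk; rewrite ler_norml => /andP[h1 h2]; apply/andP; split.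
      rewrite /x ler_pdivlMr//; nra.
    by rewrite /x ler_pdivrMr//; nra.
  apply: le_trans (cosX_le N xb) _; rewrite ler_expR.
  have p2 := pihalf_lt2 R.
  have x4 : x ^+ 2 <= 4 by move/andP : xb => [? ?]; nra.
  have Nx : (pi / (c + 1)) ^+ 2 * (k%:~R + s) ^+ 2 <= N%:R * x ^+ 2.
    have sN1 : 1 <= Num.sqrt N%:R :> R by rewrite -[leLHS]sqrtr1 ler_wsqrtr.
    have [LN _] := period_bounds N c0.
    have LN2 : (period c N)%:R ^+ 2 <= N%:R * (c + 1) ^+ 2 :> R.
      have LN' : (period c N)%:R <= Num.sqrt N%:R * (c + 1) by lra.
      rewrite -(sqrtK_nat N) -exprMn lerXn2r ?nnegrE//.
      exact: le_trans (ltW L0) LN'.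
    rewrite (_ : _ * _ = (x * (period c N)%:R) ^+ 2 / (c + 1) ^+ 2); last first.
      by rewrite xE; field; rewrite gt_eqF//; lra.
    rewrite ler_pdivrMr ?exprn_gt0//; last by lra.
    by have h := ler_wpM2l (sqr_ge0 x) LN2; lra.
  have : 0 <= N%:R * x ^+ 2 by rewrite mulr_ge0// sqr_ge0.
  rewrite /C mulNr -(mulrA (2 / 3)); nra.
move=> k; rewrite (_ : - (pi * (pi / c ^+ 2)) * (k%:~R + s) ^+ 2 =
    - ((pi * (s + k%:~R)) ^+ 2 * (c^-1 * c^-1))); last first.
  by field; rewrite gt_eqF.
have : cos (pi * (s + k%:~R) / (period c N)%:R) ^+ (2 * N) @[N --> \oo] -->
    expR (- ((pi * (s + k%:~R)) ^+ 2 * (c^-1 * c^-1))).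
  apply: cosX_cvg.
    have : (pi * (s + k%:~R)) * (Num.sqrt N%:R / (period c N)%:R * (Num.sqrt N%:R)^-1) @[N --> \oo] --> (0 : R).
      rewrite [X in _ --> X](_ : 0 = (pi * (s + k%:~R)) * (c^-1 * 0)); last by rewrite !mulr0.
      by apply: cvgM; [exact: cvg_cst|exact: cvgM].
    apply: cvg_trans; apply: near_eq_cvg; near=> N.
    have N0 : 0 < Num.sqrt N%:R :> R.
      by rewrite sqrtr_gt0 ltr0n; near: N; exact: nbhs_infty_gt.
    by have L0 := period_gt0 c N; field; rewrite !gt_eqF.
  have : (pi * (s + k%:~R)) ^+ 2 * ((Num.sqrt N%:R / (period c N)%:R) * (Num.sqrt N%:R / (period c N)%:R)) @[N --> \oo] -->
    (pi * (s + k%:~R)) ^+ 2 * (c^-1 * c^-1).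
    by apply: cvgM; [exact: cvg_cst|exact: cvgM].
  apply: cvg_trans; apply: near_eq_cvg; near=> N.
  have L0 := period_gt0 c N.
  rewrite -[in RHS](sqrtK_nat N); field; rewrite gt_eqF//.
apply: cvg_trans; apply: near_eq_cvg; near=> N.
rewrite /cosw ifT//.
rewrite /half truncn_ge_nat; last by rewrite divr_ge0// mulr_ge0// ltW.
have kN : (2 * `|k|%N%:R / c) ^+ 2 < N%:R.
  by near: N; exact: nbhs_infty_gtr.
have : 2 * `|k|%N%:R / c <= Num.sqrt N%:R.
  apply: le_trans (_ : _ <= Num.sqrt ((2 * `|k|%N%:R / c) ^+ 2)) _.
    by rewrite sqrtr_sqr ler_norm.
  by rewrite ler_wsqrtr// ltW.
by rewrite ler_pdivrMr//; lra.
Unshelve. all: by end_near. Qed.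

Lemma ratio_cvg c s : 0 < c ->
  psum (ratio c s N) @[N --> \oo] --> dual_theta (pi / c ^+ 2) s.
Proof.
move=> c0; have p3 := pi_ge3 R.
have v := period_cvg c0; have w := @inv_sqrt_cvg0 R.
(* With [q = period * |k| <= N] the denominator [N + q] in [walk_le] is at most [2 N], while
   [period^2 >= c^2 N / 4]. *)
pose C : R := c ^+ 2 / 8.
have C0 : 0 < C by rewrite divr_gt0// exprn_gt0.
have [|k|//] := @tannery R _ (ratio c s)
    (fun k => expR (- (pi / (pi / c ^+ 2)) * k%:~R ^+ 2) * cos (2 * pi * k%:~R * s)) _ (absum_gauss0 C0).
  near=> N => k.
  have N0 : 0 < N%:R :> R by rewrite ltr0n; near: N; exact: nbhs_infty_gt.
  have L0 := period_gt0 c N.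
  have Lc : c / 2 * Num.sqrt N%:R <= (period c N)%:R.
    have [_ h] := period_bounds N c0.
    have [?|?] := leP (c * Num.sqrt N%:R) 2; last by lra.
    have : 1 <= (period c N)%:R :> R by rewrite ler1n.
    by lra.
  have L2 : c ^+ 2 / 4 * N%:R <= (period c N)%:R ^+ 2.
    rewrite -(sqrtK_nat N) (_ : c ^+ 2 / 4 * _ = (c / 2 * Num.sqrt N%:R) ^+ 2); last by field.
    by rewrite lerXn2r ?nnegrE// ?mulr_ge0// ?divr_ge0// ltW.
  rewrite /ratio normrM; apply: le_trans (_ : _ <= walk R N ((period c N)%:Z * k) / walk R N 0) _.
    rewrite ger0_norm ?divr_ge0 ?walk_ge0// ler_piMr ?cos_max// divr_ge0 ?walk_ge0//.
  have wE : walk R N ((period c N)%:Z * k) = walk R N (period c N * `|k|)%N.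
    case: k => n; first by rewrite -PoszM.
    by rewrite NegzE mulrN walk_opp -PoszM.
  rewrite wE; set q := (period c N * `|k|)%N.
  have [qN|qN] := leqP q N; last first.
    by rewrite /walk ifF ?mul0r ?expR_ge0//; lia.
  rewrite ler_pdivrMr ?walk0_gt0// mulrC.
  apply: le_trans (walk_le R qN) _; rewrite ler_wpM2l ?walk_ge0// ler_expR.
  have qR : q%:R <= N%:R :> R by rewrite ler_nat.
  have q0 : 0 <= q%:R :> R by [].
  rewrite !mulNr lerN2 ler_pdivlMr; last by lra.
  have -> : q%:R ^+ 2 = (period c N)%:R ^+ 2 * k%:~R ^+ 2 :> R.
    by rewrite /q natrM exprMn natr_absz intr_norm real_normK ?num_real.
  have k2 : 0 <= k%:~R ^+ 2 :> R by rewrite sqr_ge0.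
  rewrite mulrAC ler_wpM2r// /C.
  apply: le_trans L2; have : 0 < c ^+ 2 by rewrite exprn_gt0.
  by nra.
apply: cvgM; last exact: cvg_cst.
have -> : - (pi / (pi / c ^+ 2)) * k%:~R ^+ 2 = - (c * c * `|k|%N%:R ^+ 2) :> R.
  rewrite natr_absz intr_norm real_normK ?num_real//; field.
  by rewrite !gt_eqF//; lra.
have wE N : walk R N ((period c N)%:Z * k) = walk R N (period c N * `|k|)%N.
  case: k => n; first by rewrite -PoszM.
  by rewrite NegzE mulrN walk_opp -PoszM.
under eq_cvg do rewrite wE.
apply: walk_cvg.
  have : (period c N)%:R / Num.sqrt N%:R * (Num.sqrt N%:R)^-1 * `|k|%N%:R @[N --> \oo] --> (0 : R).
    rewrite [X in _ --> X](_ : 0 = c * 0 * `|k|%N%:R); last by rewrite mulr0 mul0r.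
    by apply: cvgM; [exact: cvgM|exact: cvg_cst].
  apply: cvg_trans; apply: near_eq_cvg; near=> N.
  have N0 : 0 < Num.sqrt N%:R :> R.
    by rewrite sqrtr_gt0 ltr0n; near: N; exact: nbhs_infty_gt.
  by rewrite -[in RHS](sqrtK_nat N) natrM; field; rewrite gt_eqF.
have : (period c N)%:R / Num.sqrt N%:R * ((period c N)%:R / Num.sqrt N%:R) * `|k|%N%:R ^+ 2 @[N --> \oo] -->
   (c * c * `|k|%N%:R ^+ 2).
  by apply: cvgM; [exact: cvgM|exact: cvg_cst].
apply: cvg_trans; apply: near_eq_cvg; near=> N.
have N0 : 0 < Num.sqrt N%:R :> R.
  by rewrite sqrtr_gt0 ltr0n; near: N; exact: nbhs_infty_gt.
by rewrite -[in RHS](sqrtK_nat N) natrM; field; rewrite gt_eqF.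
Unshelve. all: by end_near. Qed.

Lemma absum_theta t s : 0 < t ->
  absum (fun k : int => expR (- (pi * t) * (k%:~R + s) ^+ 2)).
Proof. by move=> t0; apply: absum_gauss; rewrite mulr_gt0 ?pi_gt0. Qed.

Lemma absum_theta0 t : 0 < t ->
  absum (fun k : int => expR (- (pi / t) * k%:~R ^+ 2)).
Proof. by move=> t0; apply: absum_gauss0; rewrite divr_gt0 ?pi_gt0. Qed.

Lemma absum_dual_theta t s : 0 < t ->
  absum (fun k : int => expR (- (pi / t) * k%:~R ^+ 2) * cos (2 * pi * k%:~R * s)).
Proof.
move=> /absum_theta0; apply: absum_le => k.
by rewrite normrM ler_piMr ?cos_max.
Qed.

Lemma dual_theta0_gt0 t : 0 < t -> 0 < dual_theta t 0.
Proof.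
move=> t0; have s := absum_dual_theta 0 t0.
apply: (@psum_gt0 _ _ _ 0 _ s) => [k|]; rewrite ?mulr0 cos0 mulr1 ?expR_ge0//.
exact: expR_gt0.
Qed.

(** The normalising factor does not involve [s]: its limit is read off at [s = 0], where the dual
    series is positive, and then used for the other [s]. *)
Let theta_dual c : 0 < c ->
  (period c N)%:R * walk R N 0 / 4 ^+ N @[N --> \oo] -->
    theta (pi / c ^+ 2) 0 / dual_theta (pi / c ^+ 2) 0 /\
  forall s, `|s| <= 2^-1 -> theta (pi / c ^+ 2) s =
    theta (pi / c ^+ 2) 0 / dual_theta (pi / c ^+ 2) 0 * dual_theta (pi / c ^+ 2) s.
Proof.
move=> c0; have t0 : 0 < pi / c ^+ 2 by rewrite divr_gt0 ?pi_gt0// exprn_gt0.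
have d0 := dual_theta0_gt0 t0.
have E N s : psum (cosw c s N) = (period c N)%:R * walk R N 0 / 4 ^+ N * psum (ratio c s N).
  have := cosw_ratio c s N.
  have f0 : 4 ^+ N != 0 :> R by rewrite expf_neq0// pnatr_eq0.
  by move=> /(canRL (mulKf f0)) ->; ring.
have K : (period c N)%:R * walk R N 0 / 4 ^+ N @[N --> \oo] -->
    theta (pi / c ^+ 2) 0 / dual_theta (pi / c ^+ 2) 0.
  have h0 : `|0 : R| <= 2^-1 by rewrite normr0 invr_ge0.
  have a := cosw_cvg c0 h0; have b := @ratio_cvg c 0 c0.
  have : psum (cosw c 0 N) / psum (ratio c 0 N) @[N --> \oo] -->
      theta (pi / c ^+ 2) 0 / dual_theta (pi / c ^+ 2) 0.
    by apply: cvgM => //; apply: cvgV => //; exact: lt0r_neq0.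
  apply: cvg_trans; apply: near_eq_cvg; near=> N.
  have r0 : 0 < psum (ratio c 0 N).
    by near: N; move/cvgr_gt : b; apply.
  by rewrite E mulfK// gt_eqF.
split=> // s hs.
have a := cosw_cvg c0 hs; have b := @ratio_cvg c s c0.
rewrite -(cvg_lim (@Rhausdorff R) a); apply/cvg_lim; first exact: Rhausdorff.
under eq_cvg do rewrite E.
exact: cvgM.
Unshelve. all: by end_near. Qed.

(** The constant is found without Stirling's formula. Dividing by the limit of [period / sqrt N]
    leaves a limit independent of [t], and at [t = 1], [s = 0] the two theta series coincide term by
    term. *)
Lemma poisson_small t s : 0 < t -> `|s| <= 2^-1 ->
  theta t s = (Num.sqrt t)^-1 * dual_theta t s.
Proof.
move=> t0 hs; have p0 := pi_gt0 R.
have cE u : 0 < u -> pi / (Num.sqrt (pi / u)) ^+ 2 = u :> R.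
  move=> u0; rewrite sqr_sqrtr; last by rewrite divr_ge0// ltW.
  by rewrite invf_div mulrC divfK ?gt_eqF.
have c0 u : 0 < u -> 0 < Num.sqrt (pi / u) :> R by move=> u0; rewrite sqrtr_gt0 divr_gt0.
have [K H] := theta_dual (c0 _ t0); have [K1 _] := theta_dual (c0 _ (@ltr01 R)).
rewrite cE// in K H; rewrite cE// in K1; rewrite H//; congr (_ * _).
have e1 : theta 1 0 = dual_theta 1 0 :> R.
  apply: eq_psum => k; rewrite mulr0 cos0 mulr1 mulr1 divr1 addr0//.
have d1 := dual_theta0_gt0 (@ltr01 R).
rewrite e1 divff ?gt_eqF// in K1.
have q u (l : R) : 0 < u -> (period (Num.sqrt (pi / u)) N)%:R * walk R N 0 / 4 ^+ N @[N --> \oo] --> l ->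
    Num.sqrt N%:R * walk R N 0 / 4 ^+ N @[N --> \oo] --> l / Num.sqrt (pi / u).
  move=> u0 hl; have hp := period_cvg (c0 _ u0).
  have : (period (Num.sqrt (pi / u)) N)%:R * walk R N 0 / 4 ^+ N /
     ((period (Num.sqrt (pi / u)) N)%:R / Num.sqrt N%:R) @[N --> \oo] --> l / Num.sqrt (pi / u).
    by apply: cvgM => //; apply: cvgV => //; exact/lt0r_neq0/c0.
  apply: cvg_trans; apply: near_eq_cvg; near=> N.
  have N0 : 0 < Num.sqrt N%:R :> R.
    by rewrite sqrtr_gt0 ltr0n; near: N; exact: nbhs_infty_gt.
  have f0 : 4 ^+ N != 0 :> R by rewrite expf_neq0// pnatr_eq0.
  have L0 := period_gt0 (Num.sqrt (pi / u)) N.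
  by field; rewrite f0 !gt_eqF.
have A := q _ _ t0 K; have B := q _ _ (@ltr01 R) K1.
have : theta t 0 / dual_theta t 0 / Num.sqrt (pi / t) = 1 / Num.sqrt (pi / 1).
  by apply: (@cvg_unique _ (@Rhausdorff R) _ _ _ _ A B).
move=> /(canRL (divfK (lt0r_neq0 (c0 _ t0)))) ->.
rewrite divr1 sqrtrM ?(ltW p0)// sqrtrV ?(ltW t0)//; field.
by rewrite !gt_eqF// sqrtr_gt0.
Unshelve. all: by end_near. Qed.

Lemma theta_int t s (z : int) : theta t (s + z%:~R) = theta t s.
Proof.
rewrite /theta (@reindex_psum _ _ _ (fun k : int => k - z)); last first.
  by exists (fun k => k + z) => k; rewrite ?subrK ?addrK.
by apply: eq_psum => k; rewrite intrD mulrNz addrACA addNr addr0.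
Qed.

Lemma dual_theta_int t s (z : int) : dual_theta t (s + z%:~R) = dual_theta t s.
Proof.
apply: eq_psum => k; congr (_ * _).
rewrite -(cosD_int (2 * pi * k%:~R * s) (k * z)); congr cos; rewrite intrM; ring.
Qed.

Lemma poisson t s : 0 < t -> theta t s = (Num.sqrt t)^-1 * dual_theta t s.
Proof.
move=> t0; set z := Num.floor (s + 2^-1).
have /andP[h1 h2] : z%:~R <= s + 2^-1 < (z + 1)%:~R by rewrite floor_itv.
rewrite intrD in h2.
rewrite -[s](subrK z%:~R) theta_int dual_theta_int; apply: poisson_small => //.
by rewrite ler_norml; apply/andP; split; lra.
Qed.

Lemma psum_parity (f : int -> R) : absum f ->
  psum f = psum (fun k => f (2 * k)) + psum (fun k => f (2 * k + 1)).
Proof.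
move=> sf; pose e (p : bool * int) : int := 2 * p.2 + p.1%:Z.
have be : bijective e.
  exists (fun z => ((z %% 2)%Z == 1, (z %/ 2)%Z)) => [[b k]|z]; rewrite /e /=.
    by congr pair; case: b; lia.
  by case: eqP; lia.
have se := reindex_absum be sf.
rewrite (reindex_psum _ be); have [_ _ ->] := psum_fubini se.
have [|_ ->] := @psum_finite R bool (fun b => psum (fun k => f (e (b, k)))) [:: false; true] isT.
  by case.
rewrite big_cons big_seq1; congr (_ + _).
by apply: eq_psum => k; rewrite /e addr0.
Qed.

Lemma absum_alt c s : 0 < c ->
  absum (fun k : int => cos (pi * k%:~R) * expR (- c * (k%:~R + s) ^+ 2)).
Proof.
move=> c0; apply: absum_le (absum_gauss s c0) => k.
by rewrite normrM ler_piMl ?cos_max.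
Qed.

(* The even terms of the theta series are counted twice and all terms
   subtracted once; on the dual side only the odd frequencies survive. *)
Lemma poisson_alt t s : 0 < t ->
  psum (fun k : int => cos (pi * k%:~R) * expR (- (pi * t) * (k%:~R + s) ^+ 2)) =
  (Num.sqrt t)^-1 * psum (fun k : int =>
    expR (- (pi / t) * (k%:~R + 2^-1) ^+ 2) * cos (2 * pi * (k%:~R + 2^-1) * s)).
Proof.
Proof.
move=> t0; have p0 := pi_gt0 R; have t4 : 0 < 4 * t by rewrite mulr_gt0.
have c0 : 0 < pi * t by rewrite mulr_gt0.
have cosE k : cos (pi * (2 * k)%:~R) = 1 :> R.
  by rewrite -[RHS](cos0 R) -[RHS](cosD_int 0 k); congr cos; rewrite intrM; ring.
have cosO k : cos (pi * (2 * k + 1)%:~R) = -1 :> R.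
  by rewrite -[RHS](cospi R) -[RHS](cosD_int pi k); congr cos; rewrite intrD intrM; ring.
rewrite psum_parity; last exact: absum_alt.
rewrite [X in X + _](_ : _ = theta (4 * t) (s / 2)); last first.
  by apply: eq_psum => k; rewrite cosE mul1r; congr expR; rewrite intrM; field.
rewrite [X in _ + X](_ : _ = - theta (4 * t) ((s + 1) / 2)); last first.
  rewrite /theta -psumN; last exact: absum_theta.
  apply: eq_psum => k; rewrite cosO mulN1r; congr (- expR _).
  by rewrite intrD intrM; field.
rewrite !poisson// -mulrBr -psumB; try exact: absum_dual_theta.
rewrite psum_parity; last by apply: absumB; exact: absum_dual_theta.
rewrite [X in X + _](_ : _ = 0) ?add0r; last first.
  rewrite -[RHS](psum0 R int).1; apply: eq_psum => k.
  rewrite -mulrBr (_ : cos (2 * pi * (2 * k)%:~R * ((s + 1) / 2)) = cos (2 * pi * (2 * k)%:~R * (s / 2))) ?subrr ?mulr0//.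
  rewrite -(cosD_int (2 * pi * (2 * k)%:~R * (s / 2)) k); congr cos.
  by rewrite intrM; field.
have S k : expR (- (pi / (4 * t)) * (2 * k + 1)%:~R ^+ 2) * cos (2 * pi * (2 * k + 1)%:~R * (s / 2)) -
    expR (- (pi / (4 * t)) * (2 * k + 1)%:~R ^+ 2) * cos (2 * pi * (2 * k + 1)%:~R * ((s + 1) / 2)) =
   2 * (expR (- (pi / t) * (k%:~R + 2^-1) ^+ 2) * cos (2 * pi * (k%:~R + 2^-1) * s)).
  rewrite (_ : - (pi / (4 * t)) * _ = - (pi / t) * (k%:~R + 2^-1) ^+ 2); last first.
    by rewrite intrD intrM; field; rewrite gt_eqF.
  rewrite (_ : 2 * pi * _ * ((s + 1) / 2) = 2 * pi * (k%:~R + 2^-1) * s + pi * (2 * k + 1)%:~R); last first.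
    by rewrite intrD intrM; field.
  rewrite (_ : 2 * pi * _ * (s / 2) = 2 * pi * (k%:~R + 2^-1) * s); last first.
    by rewrite intrD intrM; field.
  rewrite cosD cosO sin_pi_int; ring.
under eq_psum do rewrite S.
rewrite psumZ; last first.
  have := absum_gauss 2^-1 (divr_gt0 p0 t0); apply: absum_le => k.
  by rewrite normrM ler_piMr ?cos_max.
rewrite mulrA; congr (_ * _).
rewrite sqrtrM// (_ : 4 = 2 ^+ 2); last by ring.
by rewrite sqrtr_sqr ger0_norm// invfM mulrAC mulVf ?mul1r ?pnatr_eq0.
Qed.

End Poisson2.

(** * Minimality of the hexagonal form *)

Section Hex.
Variable R : realType.
Implicit Types a b c d w r x p u s : R.

(** Bernoulli's inequality for the real power [p] of [expR u]; it carries the orbit inequality from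
    the smallest exponent to all larger ones. *)
Lemma expR_bernoulli p u : 1 <= p -> 1 + p * (expR u - 1) <= expR (p * u).
Proof.
move=> p1; rewrite -subr_ge0; move: u.
apply: (@derive_even_ge0 _ _ (fun u => p * (expR (p * u) - expR u))) => [u||u u0|u u0].
- by apply: is_derive_eq; rewrite /GRing.scale /=; ring.
- by rewrite mulr0 expR0; ring.
- by rewrite mulr_ge0//; [lra|rewrite subr_ge0 ler_expR; nra].
- by rewrite mulr_ge0_le0//; [lra|rewrite subr_le0 ler_expR; nra].
Qed.

(* Taylor expansion to order five; the power sums of [a1, a2, a3] are expressed
   through the second one [6 s] and the third one, which is at most [6 s^(3/2)]. *)
Lemma sum3_expR_ge a1 a2 a3 s : a1 + a2 + a3 = 0 ->
  a1 ^+ 2 + a2 ^+ 2 + a3 ^+ 2 = 6 * s ->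
  3 * (1 + s + s ^+ 2 / 4 - s * (s + 1) * (4 + s) / 24) <=
  expR a1 + expR a2 + expR a3.
Proof.
move=> s0 s2; have h1 := expR_ge_taylor5 a1; have h2 := expR_ge_taylor5 a2.
have h3 := expR_ge_taylor5 a3.
have e3 : a3 = - a1 - a2 by lra.
have sE : s = (a1 ^+ 2 + a1 * a2 + a2 ^+ 2) / 3 by rewrite e3 in s2; lra.
have s_ge0 : 0 <= s by nra.
set p3 := a1 ^+ 3 + a2 ^+ 3 + a3 ^+ 3.
have p4 : a1 ^+ 4 + a2 ^+ 4 + a3 ^+ 4 = 18 * s ^+ 2 by rewrite sE e3; field.
have p5 : a1 ^+ 5 + a2 ^+ 5 + a3 ^+ 5 = 5 * s * p3 by rewrite /p3 sE e3; field.
(* The difference is a multiple of the discriminant of the cubic with roots [a1], [a2], [a3]. *)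
have p3s : p3 ^+ 2 <= 36 * s ^+ 3.
  rewrite -subr_ge0 (_ : _ - _ = 3^-1 * ((a1 - a2) * (a1 + 2 * a2) * (2 * a1 + a2)) ^+ 2); last first.
    by rewrite /p3 sE e3; field.
  by apply: mulr_ge0; [rewrite invr_ge0|exact: sqr_ge0].
(* Half powers are avoided through [6 s^(3/2) <= 3 s (s + 1)]. *)
have p3b : - (3 * s * (s + 1)) <= p3.
  rewrite lerNl; apply: contraT; rewrite -ltNge => h.
  have h0 : 0 <= 3 * s * (s + 1) by rewrite !mulr_ge0//; lra.
  have : (3 * s * (s + 1)) ^+ 2 < p3 ^+ 2 by rewrite -(sqrrN p3) ltrXn2r// nnegrE; lra.
  have : 36 * s ^+ 3 <= (3 * s * (s + 1)) ^+ 2.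
    rewrite -subr_ge0 (_ : _ - _ = (3 * s * (s - 1)) ^+ 2) ?sqr_ge0//; ring.
  lra.
have p3c : - (3 * s * (s + 1)) * (1 / 6 + s / 24) <= p3 * (1 / 6 + s / 24).
  by rewrite ler_wpM2r//; lra.
have p3E : a1 ^+ 3 + a2 ^+ 3 + a3 ^+ 3 = p3 by [].
move: p3 p3E p4 p5 p3c {p3s p3b sE e3 s_ge0} => p3 p3E p4 p5 p3c; lra.
Qed.

(** An upper bound drawn from a lower one: the quintic bound for [expR (- v)] times the cubic is at
    least 1 on this range. The coefficient [1/4] instead of [1/6] absorbs the higher terms. *)
Lemma expR_le_cubic (v : R) : 0 <= v -> v <= 77 / 100 ->
  expR v <= 1 + v + v ^+ 2 / 2 + v ^+ 3 / 4.
Proof.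
move=> v0 v1; have h := expR_ge_taylor5 (- v).
set P := 1 + - v + _ + _ + _ + _ in h.
have T0 : 0 < 1 + v + v ^+ 2 / 2 + v ^+ 3 / 4.
  have := exprn_ge0 2 v0; have := exprn_ge0 3 v0; lra.
have PT : 1 <= P * (1 + v + v ^+ 2 / 2 + v ^+ 3 / 4).
  have -> : P * (1 + v + v ^+ 2 / 2 + v ^+ 3 / 4) = 1 + v ^+ 3 *
    (1 / 12 - v / 8 + 3 / 40 * v ^+ 2 - 7 / 240 * v ^+ 3 + v ^+ 4 / 160 - v ^+ 5 / 480).
    by rewrite /P; field.
  rewrite lerDl; apply: mulr_ge0; first exact: exprn_ge0.
  have v2 : v ^+ 2 <= 77 / 100 * v by rewrite expr2 ler_wpM2r.
  have v3 : v ^+ 3 <= 77 / 100 * v ^+ 2 by rewrite exprS ler_wpM2r ?exprn_ge0.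
  have v5 : v ^+ 5 <= 77 / 100 * v ^+ 4 by rewrite exprS ler_wpM2r ?exprn_ge0.
  have v4 := exprn_ge0 4 v0.
  nra.
have E : expR v * expR (- v) = 1 by rewrite expRN mulfV// expR_eq0.
have e0 := expR_gt0 v.
have := ler_wpM2l (ltW e0) h; rewrite E => h2.
have := ler_wpM2r (ltW T0) h2; rewrite mul1r => h3.
have := ler_wpM2l (ltW e0) PT; rewrite mulr1 => h4.
by apply: le_trans h4 _; rewrite mulrA.
Qed.

(** [2 sqrt 3] is 3 times the minimum [hexa] of the hexagonal form, a lower bound for every exponent
    that occurs. To first order in [w] the right side grows at least like [15 w] and the left one
    below [10.5 w]; the slack [3 w / 100] is kept for strictness. *)
Lemma orbit_ineq0 w d1 d2 d3 (X : R) : X = 2 * Num.sqrt 3 -> 0 <= w -> w <= 221 / 1000 ->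
  d1 + d2 + d3 = 0 -> d1 ^+ 2 + d2 ^+ 2 + d3 ^+ 2 = 3 / 2 * (w * (2 + w)) ->
  3 * expR (X * w) + 3 * w * (1 / 100) <= expR (- X * d1) + expR (- X * d2) + expR (- X * d3).
Proof.
move=> XE w0 w1 d0 dd.
have q3 : (Num.sqrt 3 : R) ^+ 2 = 3 by rewrite sqr_sqrtr.
have qb : Num.sqrt 3 <= 26 / 15 :> R.
  have := sqrtr_ge0 (3 : R); move: q3; set q := Num.sqrt 3 => q3 q0; nra.
have q0 : 0 <= Num.sqrt 3 :> R by exact: sqrtr_ge0.
have X2 : X ^+ 2 = 12 by rewrite XE exprMn q3; ring.
have X0 : 0 <= X by rewrite XE mulr_ge0.
have Xb : X <= 52 / 15 by rewrite XE; lra.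
have := @sum3_expR_ge (- X * d1) (- X * d2) (- X * d3) (3 * (w * (2 + w))).
rewrite -!mulrDr d0 mulr0 => /(_ erefl).
rewrite [(- X * d1) ^+ 2]exprMn [(- X * d2) ^+ 2]exprMn [(- X * d3) ^+ 2]exprMn sqrrN X2 -!mulrDr dd => /(_ _) H.
apply: le_trans (H _); last by field.
rewrite -mulrA -mulrDr ler_pM2l//.
have v0 : 0 <= X * w by rewrite mulr_ge0.
have v1 : X * w <= 52 / 15 * w by rewrite ler_wpM2r.
have /(_ _ _) E := @expR_le_cubic (52 / 15 * w).
apply: (@le_trans _ _ (expR (52 / 15 * w) + w * (1 / 100))).
  by rewrite lerD2r ler_expR.
apply: le_trans (_ : _ <= (1 + 52 / 15 * w + (52 / 15 * w) ^+ 2 / 2 + (52 / 15 * w) ^+ 3 / 4) + w * (1 / 100)) _.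
  by rewrite lerD2r; apply: E; lra.
rewrite -subr_ge0; set s := 3 * (w * (2 + w)).
have -> : 1 + s + s ^+ 2 / 4 - s * (s + 1) * (4 + s) / 24 - (1 + 52 / 15 * w + (52 / 15 * w) ^+ 2 / 2 + (52 / 15 * w) ^+ 3 / 4 + w * (1 / 100)) =
  w * ((6 + 3 * w) * (5 / 6 + s * (1 - s) / 24) - (52 / 15 + (52 / 15) ^+ 2 / 2 * w + (52 / 15) ^+ 3 / 4 * w ^+ 2 + 1 / 100)).
  by rewrite /s; field.
rewrite mulr_ge0//.
have w2 : w ^+ 2 <= 221 / 1000 * w by rewrite expr2 ler_wpM2r.
have w20 : 0 <= w ^+ 2 by rewrite sqr_ge0.
have w3 : w ^+ 3 <= 221 / 1000 * w ^+ 2 by rewrite exprS ler_wpM2r.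
have sE : s = 6 * w + 3 * w ^+ 2 by rewrite /s; ring.
have s1 : s <= 3 / 2 by rewrite sE; lra.
have s0 : 0 <= s by rewrite sE; lra.
have hs : - (1 / 2) * s <= s * (1 - s).
  by rewrite [leLHS]mulrC ler_wpM2l//; lra.
have h : (6 + 3 * w) * (5 / 6 - (1 / 2) * s / 24) <= (6 + 3 * w) * (5 / 6 + s * (1 - s) / 24).
  by rewrite ler_wpM2l//; lra.
rewrite subr_ge0; apply: le_trans h; rewrite sE; lra.
Qed.

(** The numbers [1 + w + d_i] are the values of a form along an orbit, relative to the hexagonal
    value. [expR_bernoulli] with [p = X / X0] reduces the claim to [X0 = 2 sqrt 3]. *)
Lemma orbit_ineq w d1 d2 d3 (X : R) : 2 * Num.sqrt 3 <= X -> 0 <= w -> w <= 221 / 1000 ->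
  d1 + d2 + d3 = 0 -> d1 ^+ 2 + d2 ^+ 2 + d3 ^+ 2 = 3 / 2 * (w * (2 + w)) ->
  let S := expR (- (X * (1 + w + d1))) + expR (- (X * (1 + w + d2))) + expR (- (X * (1 + w + d3))) in
  3 * expR (- X) <= S /\ (0 < w -> 3 * expR (- X) < S).
Proof.
move=> X0X w0 w1 d0 dd /=.
set X0 := 2 * Num.sqrt 3 in X0X *.
have X00 : 0 < X0 by rewrite mulr_gt0// sqrtr_gt0.
have H := @orbit_ineq0 w d1 d2 d3 X0 erefl w0 w1 d0 dd.
pose p := X / X0.
have p1 : 1 <= p by rewrite ler_pdivlMr// mul1r.
have XE : X = p * X0 by rewrite divfK// gt_eqF.
have B d : expR (- X) * (1 + p * (expR (- X0 * d) * expR (- (X0 * w)) - 1)) <= expR (- (X * (1 + w + d))).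
  have -> : - (X * (1 + w + d)) = - X + p * (- X0 * d - X0 * w) by rewrite XE; ring.
  by rewrite expRD ler_wpM2l ?expR_ge0// -expRD; exact: expR_bernoulli.
have := B d1; have := B d2; have := B d3.
set e1 := expR (- X0 * d1) in H *; set e2 := expR (- X0 * d2) in H *.
set e3 := expR (- X0 * d3) in H *; set E := expR (- X).
have E0 : 0 < E by exact: expR_gt0.
set W := expR (- (X0 * w)); have W0 : 0 < W by exact: expR_gt0.
have WW : expR (X0 * w) * W = 1 by rewrite /W expRN mulfV// expR_eq0.
have K : 3 + 3 * w * (1 / 100) * W <= (e1 + e2 + e3) * W.
  by have h := ler_wpM2r (ltW W0) H; lra.
move=> h3 h2 h1.
have T : E * (3 + p * ((e1 + e2 + e3) * W - 3)) <=
  expR (- (X * (1 + w + d1))) + expR (- (X * (1 + w + d2))) + expR (- (X * (1 + w + d3))) by lra.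
have wW : 0 <= w * W by rewrite mulr_ge0// ltW.
split=> [|wp].
  apply: le_trans T; rewrite mulrC ler_pM2l// lerDl mulr_ge0//; first by lra.
  by rewrite subr_ge0; lra.
apply: lt_le_trans T; rewrite mulrC ltr_pM2l// ltrDl mulr_gt0//; first by lra.
have : 0 < w * W by rewrite mulr_gt0.
by rewrite subr_gt0; lra.
Qed.

Definition qf a b c (v : int * int) : R :=
  a * v.1%:~R ^+ 2 + 2 * b * (v.1%:~R * v.2%:~R) + c * v.2%:~R ^+ 2.

Definition energy (t a b c : R) : R := psum (fun v => expR (- t * qf a b c v)).

Lemma qf_ge a b c v : 0 < a -> 0 < a * c - b ^+ 2 ->
  (a * c - b ^+ 2) / (a + c) * (v.1%:~R ^+ 2 + v.2%:~R ^+ 2) <= qf a b c v.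
Proof.
move=> a0 D0; rewrite /qf; set m : R := v.1%:~R; set k : R := v.2%:~R.
have c0 : 0 < c by have := sqr_ge0 b; nra.
rewrite mulrAC ler_pdivrMr; last by lra.
rewrite -subr_ge0 (_ : _ - _ = (a * m + b * k) ^+ 2 + (b * m + c * k) ^+ 2); last by ring.
by rewrite addr_ge0 ?sqr_ge0.
Qed.

Lemma absum_energy t a b c : 0 < t -> 0 < a -> 0 < a * c - b ^+ 2 ->
  absum (fun v => expR (- t * qf a b c v)).
Proof.
move=> t0 a0 D0; set d := (a * c - b ^+ 2) / (a + c).
have c0 : 0 < c by have := sqr_ge0 b; nra.
have td : 0 < t * d by rewrite mulr_gt0// divr_gt0//; lra.
apply: absum_le (absum_mul (absum_gauss0 td) (absum_gauss0 td)) => v.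
rewrite !ger0_norm ?mulr_ge0 ?expR_ge0// -expRD ler_expR.
rewrite -mulrDr -mulNr -mulrA mulNr [leRHS]mulNr lerN2 ler_pM2l//.
exact: qf_ge.
Qed.

(** Rotation of the hexagonal lattice by 120 degrees in coordinates; it preserves
    [m^2 + m k + k^2]. *)
Definition rot (v : int * int) : int * int := (v.2, - v.1 - v.2).

Lemma rot_bij : bijective rot.
Proof.
by exists (fun v => (- v.1 - v.2, v.1)) => -[m k]; rewrite /rot /=; congr pair; ring.
Qed.

Definition hexa : R := 2 / Num.sqrt 3.
Definition hexb : R := 1 / Num.sqrt 3.

Lemma sqrt3 : 0 < (Num.sqrt 3 : R) /\ (Num.sqrt 3 : R) ^+ 2 = 3.
Proof. by rewrite sqrtr_gt0 sqr_sqrtr. Qed.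

Lemma hex_det : 0 < hexa /\ hexa * hexa - hexb ^+ 2 = 1.
Proof.
have [q0 q3] := sqrt3; rewrite divr_gt0//; split => //.
rewrite (_ : _ - _ = 3 / (Num.sqrt 3) ^+ 2); last by rewrite /hexa /hexb; field; rewrite gt_eqF.
by rewrite q3 divff.
Qed.

Lemma qf_hex v : qf hexa hexb hexa v =
  hexa * (v.1 ^+ 2 + v.1 * v.2 + v.2 ^+ 2)%:~R.
Proof.
have [q0 q3] := sqrt3.
by rewrite /qf /hexa /hexb !intrD !intrM; field; rewrite gt_eqF.
Qed.

Lemma hexN_ge1 (v : int * int) : v != (0, 0) -> 1 <= v.1 ^+ 2 + v.1 * v.2 + v.2 ^+ 2.
Proof.
case: v => m k /= h.
have : (m != 0) || (k != 0).
  by apply: contraNT h; rewrite negb_or !negbK => /andP[/eqP-> /eqP->].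
by move=> /orP[]; nia.
Qed.

(* The two energies are compared after summation over the orbits of [rot], which
   preserves the hexagonal form but not the other one. *)
Lemma energy_hex_small (n : nat) a b c : (0 < n)%N -> 0 < a -> a * c - b ^+ 2 = 1 ->
  a + c - b <= (1 + 221 / 1000) * Num.sqrt 3 ->
  energy (pi * n%:R) hexa hexb hexa <= energy (pi * n%:R) a b c /\
  (energy (pi * n%:R) hexa hexb hexa = energy (pi * n%:R) a b c -> a + c - b <= Num.sqrt 3).
Proof.
move=> n0 a0 D1 hb; have [q0 q3] := sqrt3; have [ha0 hD] := hex_det.
have p3 := pi_ge3 R.
set t := pi * n%:R.
have n1 : 1 <= n%:R :> R by rewrite ler1n.
have t3 : 3 <= t by rewrite /t; nra.
have t0 : 0 < t by lra.
have D0 : 0 < a * c - b ^+ 2 by rewrite D1.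
have hD0 : 0 < hexa * hexa - hexb ^+ 2 by rewrite hD.
have c0 : 0 < c by have := sqr_ge0 b; nra.
have sQ := absum_energy t0 a0 D0; have sH := absum_energy t0 ha0 hD0.
(* [C] is the mean, over any orbit of [rot], of the form divided by the hexagonal one. By [C2] it is
   at least 1, with equality only for the hexagonal form. *)
pose C := (a + c - b) / Num.sqrt 3; pose w := C - 1.
have C2 : C ^+ 2 - 1 = ((a - c) ^+ 2 + (a - 2 * b) ^+ 2 + (c - 2 * b) ^+ 2) / 6.
  have : (a + c - b) ^+ 2 - 3 * (a * c - b ^+ 2) =
    ((a - c) ^+ 2 + (a - 2 * b) ^+ 2 + (c - 2 * b) ^+ 2) / 2 by field.
  by rewrite D1 /C expr_div_n q3 => h; lra.
have CE : a + c - b = C * Num.sqrt 3 by rewrite divfK// gt_eqF.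
have C0 : 0 <= C.
  by rewrite divr_ge0 ?ltW//; nra.
have w0 : 0 <= w.
  have : 0 <= C ^+ 2 - 1 by rewrite C2 divr_ge0// !addr_ge0// sqr_ge0.
  rewrite /w; nra.
have w1 : w <= 221 / 1000.
  by rewrite /w lerBlDl ler_pdivrMr.
pose e v := expR (- t * qf a b c v); pose h v := expR (- t * qf hexa hexb hexa v).
have key v : 3 * h v <= e v + e (rot v) + e (rot (rot v)) /\
    (0 < w -> v != (0, 0) -> 3 * h v < e v + e (rot v) + e (rot (rot v))).
  have [->|v0] := eqVneq v (0, 0).
    split => //; rewrite /h /e /qf /rot /= oppr0 subr0 !expr0n !mulr0 !addr0 mulr0 expR0; lra.
  pose N := v.1 ^+ 2 + v.1 * v.2 + v.2 ^+ 2.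
  have N1 : 1 <= N%:~R :> R by rewrite (_ : 1 = 1%:~R)// ler_int hexN_ge1.
  have H0 : 0 < hexa * N%:~R by rewrite mulr_gt0//; lra.
  (* The deviation from the orbit mean. Determinant one makes the second moment independent of the
     orbit as well: the squares of [d] sum to [3/2 (C^2 - 1)], the quantity required by
     [orbit_ineq]. *)
  pose d (u : int * int) := qf a b c u / (hexa * N%:~R) - C.
  have E (u : int * int) : e u = expR (- (t * (hexa * N%:~R) * (1 + w + d u))).
    by congr expR; rewrite /d /w; field; rewrite !gt_eqF//; lra.
  have hE : h v = expR (- (t * (hexa * N%:~R))) by rewrite /h qf_hex mulNr.
  have S1 : (qf a b c v + qf a b c (rot v) + qf a b c (rot (rot v))) / (hexa * N%:~R) = 3 * C.
    rewrite (_ : qf a b c v + _ + _ = 2 * (a + c - b) * N%:~R); last first.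
      by rewrite /qf /rot /N /= !intrD !intrM !mulrNz !intrD !mulrNz; ring.
    rewrite CE (_ : 2 * _ * _ / _ = C * (Num.sqrt 3) ^+ 2); first by rewrite q3 mulrC.
    by rewrite /hexa; field; rewrite !gt_eqF//; lra.
  rewrite !E hE.
  have [] := @orbit_ineq w (d v) (d (rot v)) (d (rot (rot v))) (t * (hexa * N%:~R)).
  - have : hexa <= hexa * N%:~R by rewrite ler_peMr// ltW.
    have : 2 * Num.sqrt 3 = 3 * hexa.
      have hq : hexa * Num.sqrt 3 = 2 by rewrite divfK// gt_eqF.
      by rewrite -[X in X * _ = _]hq -mulrA -expr2 q3 mulrC.
    by move=> -> ?; apply: ler_pM => //; exact: ltW.
  - exact: w0.
  - exact: w1.
  - have -> : d v + d (rot v) + d (rot (rot v)) =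
       (qf a b c v + qf a b c (rot v) + qf a b c (rot (rot v))) / (hexa * N%:~R) - 3 * C.
      by rewrite /d; ring.
    by rewrite S1 subrr.
  - have C2' : (a + c - b) ^+ 2 = 3 * C ^+ 2 by rewrite CE exprMn q3 mulrC.
    have h2 : hexa ^+ 2 = 4 / 3 by rewrite /hexa expr_div_n q3; field.
    have S2 : 3 * (qf a b c v ^+ 2 + qf a b c (rot v) ^+ 2 + qf a b c (rot (rot v)) ^+ 2) =
        4 * N%:~R ^+ 2 * (a + c - b) ^+ 2 + 2 * N%:~R ^+ 2 * ((a + c - b) ^+ 2 - 3 * (a * c - b ^+ 2)).
      by rewrite /qf /rot /N /= !intrD !intrM !mulrNz !intrD !mulrNz; ring.
    have -> : d v ^+ 2 + d (rot v) ^+ 2 + d (rot (rot v)) ^+ 2 =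
       3 * (qf a b c v ^+ 2 + qf a b c (rot v) ^+ 2 + qf a b c (rot (rot v)) ^+ 2) / (3 * hexa ^+ 2 * N%:~R ^+ 2) -
       2 * C * ((qf a b c v + qf a b c (rot v) + qf a b c (rot (rot v))) / (hexa * N%:~R)) + 3 * C ^+ 2.
      by rewrite /d; field; rewrite !gt_eqF//; lra.
    rewrite S2 S1 D1 C2' h2 /w; field.
    by rewrite !gt_eqF//; lra.
  by move=> h1 h2; split => // w00 _; exact: h2.
have r1 : psum (fun v => e (rot v)) = psum e by rewrite -(reindex_psum e rot_bij).
have r2 : psum (fun v => e (rot (rot v))) = psum e.
  by rewrite -(reindex_psum (fun v => e (rot v)) rot_bij).
have s1 : absum (fun v => e (rot v)) by exact: (reindex_absum rot_bij sQ).
have s2 : absum (fun v => e (rot (rot v))) by exact: (reindex_absum rot_bij s1).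
have s12 := absumD sQ s1; have s123 := absumD s12 s2.
have s3h := absumZ 3 sH.
have sd := absumB s123 s3h.
have T : psum (fun v => e v + e (rot v) + e (rot (rot v)) - 3 * h v) = 3 * (psum e - psum h).
  by rewrite (psumB s123 s3h) (psumD s12 s2) (psumD sQ s1) r1 r2 (psumZ _ sH); ring.
have T0 : 0 <= psum (fun v => e v + e (rot v) + e (rot (rot v)) - 3 * h v).
  by apply: psum_ge0 => v; rewrite subr_ge0; exact: (key v).1.
split; first by rewrite T in T0; rewrite /energy -/e -/h; lra.
move=> eqE; rewrite leNgt; apply/negP => ltC.
have w00 : 0 < w by rewrite /w subr_gt0 ltr_pdivlMr// mul1r.
have : 0 < psum (fun v => e v + e (rot v) + e (rot (rot v)) - 3 * h v).
  apply: (@psum_gt0 _ _ _ (1, 0) _ sd) => [v|]; first by rewrite subr_ge0; exact: (key v).1.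
  by rewrite subr_gt0; apply: (key _).2.
by rewrite T (_ : psum e = psum h) ?subrr ?mulr0 ?ltxx//; symmetry.
Qed.

End Hex.

(** * Forms with a very short vector, and minimality over reduced forms *)

Section Hex2.
Variable R : realType.
Implicit Types a b c r x : R.
Local Notation hexa := (hexa R).
Local Notation hexb := (hexb R).

(** The term of a shortest hexagonal vector at [t = 3], a lower bound for every [pi * n]; the other
    terms are powers of it. *)
Let eps : R := expR (- (3 * hexa)).

Let eps_le : eps <= 17 / 500.
Proof.
have [q0 q3] := sqrt3 R.
have qb : 43 / 25 <= Num.sqrt 3 :> R by nra.
have hE : 3 * hexa = 2 * Num.sqrt 3.
  have hq : hexa * Num.sqrt 3 = 2 by rewrite divfK// gt_eqF.
  by rewrite -[X in _ = X * _]hq -mulrA -expr2 q3 mulrC.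
have : eps <= expR (- (43 / 50) * 4%:R) by rewrite ler_expR hE; lra.
rewrite expRM_natr => h; apply: le_trans h _.
have e1 : expR (- (43 / 50)) <= 7 / 16 * (49 / 50) :> R.
  have := expR_ge_taylor3 (43 / 50 : R); rewrite expRN => h.
  by rewrite -[leLHS]mul1r ler_pdivrMr ?expR_gt0; lra.
apply: le_trans (_ : _ <= (7 / 16 * (49 / 50)) ^+ 4) _; last by lra.
by rewrite lerXn2r// nnegrE ?expR_ge0//; lra.
Qed.

Let eps_gt0 : 0 < eps. Proof. exact: expR_gt0. Qed.

(** The vectors with coordinates in -1, 0, 1. Some of them violate the comparison with the product
    of two geometric series, so their terms are counted exactly. *)
Let box : seq (int * int) := [:: (0, 0); (1, 0); (-1, 0); (0, 1); (0, -1); (1, -1); (-1, 1); (1, 1); (-1, -1)].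

Let f (v : int * int) : R := if v == (0, 0) then 0 else expR (- 3 * qf hexa hexb hexa v).
Let g (v : int * int) : R := eps ^+ `|v.1|%N * eps ^+ `|v.2|%N.

Let fE (v : int * int) (N : nat) : v != (0, 0) -> v.1 ^+ 2 + v.1 * v.2 + v.2 ^+ 2 = N%:Z ->
  f v = eps ^+ N.
Proof.
move=> v0 vN; rewrite /f (negbTE v0) qf_hex vN /eps -expRM_natr; congr expR; rewrite -pmulrn; ring.
Qed.

Let fg v : v \notin box -> f v <= g v.
Proof.
move=> vB.
have v0 : v != (0, 0) by apply: contraNneq vB => ->.
pose N := absz (v.1 ^+ 2 + v.1 * v.2 + v.2 ^+ 2)%R.
have NE : v.1 ^+ 2 + v.1 * v.2 + v.2 ^+ 2 = N%:Z.
  by rewrite /N gez0_abs//; case: v {vB v0 N} => m k /=; nia.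
rewrite (fE v0 NE) /g -exprD.
have e1 : eps <= 1 by have := eps_le; lra.
rewrite ler_wiXn2l ?(ltW eps_gt0)//.
move: vB NE; rewrite /box; case: v {v0} N => m k N /=.
rewrite !inE !negb_or !xpair_eqE => /and5P[? ? ? ? /and5P[? ? ? ? ?]] NE.
have h : (2 <= `|m|)%N \/ (2 <= `|k|)%N by lia.
have mk : - (m * k) <= `|m|%N%:Z * `|k|%N%:Z by rewrite -PoszM -abszM abszE -normrN ler_norm.
have m2 : `|m|%N%:Z ^+ 2 = m ^+ 2 by rewrite abszE real_normK ?num_real.
have k2 : `|k|%N%:Z ^+ 2 = k ^+ 2 by rewrite abszE real_normK ?num_real.
(* The worst case is that of opposite signs, [x] and [y] being the absolute values; at [x = y = 1]
   the inequality fails. *)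
have A (x y : int) : 2 <= x -> 0 <= y -> x + y <= x ^+ 2 + y ^+ 2 - x * y.
  move=> x2 y0; have s1 := sqr_ge0 (x - y); have s2 := sqr_ge0 (y - 1).
  have [x3|x3] := leP 3 x.
    have : 0 <= (x - 3) * (x + 1) by rewrite mulr_ge0//; lia.
    by lra.
  have -> : x = 2 by lia.
  have : 0 <= (y - 1) * (y - 2).
    have [y1|y1] := leP y 1; first by rewrite mulr_le0//; lia.
    by rewrite mulr_ge0//; lia.
  by lra.
have T : `|m|%N%:Z + `|k|%N%:Z <= `|m|%N%:Z ^+ 2 + `|k|%N%:Z ^+ 2 - `|m|%N%:Z * `|k|%N%:Z.
  case: h => h; first exact: (A `|m|%N `|k|%N h isT).
  have := A `|k|%N `|m|%N h isT.
  by rewrite (mulrC `|k|%N%:Z) (addrC `|k|%N%:Z) (addrC (`|k|%N%:Z ^+ 2)).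
rewrite -lez_nat PoszD; apply: le_trans T _; rewrite m2 k2 -NE; lra.
Qed.

(** The bound is what the two vectors [(1, 0)] and [(-1, 0)] contribute at [t = 3] to a form with
    [a = 5 / 7]. *)
Let psum_f : absum f /\ psum f < 2 * expR (- (15 / 7)).
Proof.
have e0 := ltW eps_gt0; have e1 := eps_le.
have e01 : 0 <= eps < 1 by apply/andP; split=> //; lra.
have [sG lG] := psum_geo e01.
have sg : absum g by exact: (absum_mul sG sG).
have pg : psum g = psum (fun k : int => eps ^+ `|k|%N) ^+ 2 by rewrite expr2; exact: psum_mul.
pose d v := if v \in box then f v - g v else 0.
have [//||sd pd] := @psum_finite R _ d box.
  by move=> v; rewrite /d => /negbTE ->.
have fle v : f v <= g v + d v.
  by rewrite /d; case: ifPn => [_|/fg ?]; rewrite ?addr0// addrC subrK.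
have sgd := absumD sg sd.
have f0 v : 0 <= f v by rewrite /f; case: ifP => // _; exact: expR_ge0.
have sf : absum f.
  by apply: absum_le sgd => v; rewrite !ger0_norm// (le_trans (f0 v)).
split=> //; apply: le_lt_trans (le_psum sf sgd fle) _.
rewrite psumD// pg pd.
have -> : \sum_(i <- box) d i = 6 * eps + 2 * eps ^+ 3 - (1 + 4 * eps + 4 * eps ^+ 2).
  rewrite /box !big_cons big_nil /d /box !inE /= .
  rewrite (@fE (1, 0) 1) ?(@fE (-1, 0) 1) ?(@fE (0, 1) 1) ?(@fE (0, -1) 1)//.
  rewrite (@fE (1, -1) 1) ?(@fE (-1, 1) 1) ?(@fE (1, 1) 3) ?(@fE (-1, -1) 3)//.
  by rewrite /f /g /= !expr1 !expr0; ring.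
set G := psum _ in lG *.
have G0 : 0 <= G by apply: psum_ge0 => k; rewrite exprn_ge0.
have lG2 : G ^+ 2 <= ((1 + eps) / (1 - eps)) ^+ 2.
  by rewrite lerXn2r// nnegrE// divr_ge0//; lra.
(* [29 / 14] is admissible as soon as [eps <= 1 / 29]. *)
have E : (1 + eps) / (1 - eps) <= 1 + 29 / 14 * eps.
  by rewrite ler_pdivrMr; nra.
have E2 : ((1 + eps) / (1 - eps)) ^+ 2 <= (1 + 29 / 14 * eps) ^+ 2.
  by rewrite lerXn2r// nnegrE ?divr_ge0//; lra.
have low : 11 / 100 <= expR (- (15 / 7)) :> R.
  have -> : - (15 / 7) = - (15 / 28) * 4%:R :> R by field.
  rewrite expRM_natr.
  have h : 58 / 100 <= expR (- (15 / 28)) :> R.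
    by apply: le_trans (expR_ge_taylor3 _); lra.
  apply: le_trans (_ : (58 / 100) ^+ 4 <= _); last by rewrite lerXn2r// nnegrE ?expR_ge0//; lra.
  by lra.
have c2 : eps ^+ 2 <= 17 / 500 * eps by rewrite expr2 ler_wpM2r.
have c3 : eps ^+ 3 <= 17 / 500 * eps ^+ 2 by rewrite exprS ler_wpM2r ?exprn_ge0.
by lra.
Qed.

(* The three vectors [(0, 0)] and [(1, 0)], [(-1, 0)] alone have more energy than
   the whole hexagonal form. *)
Lemma energy_hex_large (n : nat) a b c : (0 < n)%N -> 0 < a -> a * c - b ^+ 2 = 1 ->
  a <= 5 / 7 ->
  energy (pi * n%:R) hexa hexb hexa < energy (pi * n%:R) a b c.
Proof.
move=> n0 a0 D1 a57; have [ha0 hD] := hex_det R.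
have p3 := pi_ge3 R; set t := pi * n%:R.
have n1 : 1 <= n%:R :> R by rewrite ler1n.
have t3 : 3 <= t by rewrite /t; nra.
have t0 : 0 < t by lra.
have D0 : 0 < a * c - b ^+ 2 by rewrite D1.
have hD0 : 0 < hexa * hexa - hexb ^+ 2 by rewrite hD.
have sQ := absum_energy t0 a0 D0; have sH := absum_energy t0 ha0 hD0.
have [sf pf] := psum_f.
have [q0 q3] := sqrt3 R.
have h1 : 1 <= hexa by rewrite ler_pdivlMr// mul1r; nra.
pose delta (v : int * int) : R := if v == (0, 0) then 1 else 0.
have [//||sdel pdel] := @psum_finite R _ delta [:: (0, 0)].
  by move=> v; rewrite inE /delta => /negbTE ->.
(* Passage from [t = 3] to larger [t]: off the origin the hexagonal form is at least [5 / 7], so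
   each of its terms shrinks at least by the factor [K], the shrinking of the value [5 / 7]
   itself. *)
pose K := expR (- t * (5 / 7) + 15 / 7).
have le1 v : expR (- t * qf hexa hexb hexa v) <= delta v + K * f v.
  rewrite /delta /f; case: eqVneq => [->|v0].
    by rewrite /qf /= !expr0n !mulr0 !addr0 mulr0 expR0.
  rewrite add0r -expRD ler_expR qf_hex.
  have N1 : 1 <= (v.1 ^+ 2 + v.1 * v.2 + v.2 ^+ 2)%:~R :> R.
    by rewrite (_ : 1 = 1%:~R)// ler_int hexN_ge1.
  move: N1; set N := _%:~R => N1.
  have : 0 <= (t - 3) * (hexa * N - 5 / 7).
    by rewrite mulr_ge0//; [lra|have := ler_pM _ _ h1 N1; lra].
  by lra.
have sK := absumZ K sf.
apply: le_lt_trans (le_psum sH (absumD sdel sK) le1) _.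
rewrite (psumD sdel sK) (psumZ _ sf) pdel big_seq1 /delta eqxx.
apply: (@lt_le_trans _ _ (1 + 2 * expR (- t * (5 / 7)))).
  have E : expR (- (15 / 7)) * expR (15 / 7) = 1 :> R by rewrite expRN mulVf// expR_eq0.
  have pf2 : expR (15 / 7) * psum f < 2.
    by rewrite -(ltr_pM2l (expR_gt0 (- (15 / 7)))) mulrA E mul1r mulrC.
  by rewrite ltrD2l /K expRD -mulrA mulrC ltr_pM2r ?expR_gt0.
apply: le_trans (_ : _ <= 1 + 2 * expR (- t * a)) _.
  by rewrite lerD2l ler_pM2l// ler_expR !mulNr lerN2 ler_pM2l.
have := @finsum_le_psum R _ _ [:: (0, 0); (1, 0); (-1, 0)] (fun v => expR_ge0 _) sQ isT.
rewrite !big_cons big_nil /qf /= !expr0n !mulr0 !addr0 !mulr0 expR0 sqrrN !expr1n !mulr1.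
by move=> h; rewrite /energy /qf; apply: le_trans h; lra.
Qed.

(** The threshold [5 / 7] makes the two regimes meet: above it, a reduced form has [a + c - b]
    within the range [221 / 1000] allowed by [energy_hex_small]. *)
Lemma energy_hex_min (n : nat) a b c : (0 < n)%N -> 0 < a -> a * c - b ^+ 2 = 1 ->
  0 <= b -> 2 * b <= a -> a <= c ->
  energy (pi * n%:R) hexa hexb hexa <= energy (pi * n%:R) a b c /\
  (energy (pi * n%:R) hexa hexb hexa = energy (pi * n%:R) a b c ->
   [/\ a = hexa, b = hexb & c = hexa]).
Proof.
move=> n0 a0 D1 b0 ba ac; have [q0 q3] := sqrt3 R.
have [a57|a57] := leP a (5 / 7).
  have h := energy_hex_large n0 a0 D1 a57.
  by split; [exact: ltW|move=> e; rewrite e ltxx in h].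
have a2 : a <= 7 / 5 by nra.
have hb : a + c - b <= (1 + 221 / 1000) * Num.sqrt 3.
  (* Since [a c = 1 + b^2] and [b <= a], [a + c - b] is at most [a + 1 / a], which on [[5/7, 7/5]]
     is largest at the ends, with value [74 / 35]. *)
  apply: le_trans (_ : 74 / 35 <= _); last by nra.
  rewrite -(ler_pM2l a0) (_ : a * (a + c - b) = a ^+ 2 + 1 + b ^+ 2 - a * b); last by rewrite -D1; ring.
  nra.
have [h1 h2] := energy_hex_small n0 a0 D1 hb.
split=> // /h2 hs.
(* [a + c - b <= sqrt 3] makes the right side nonpositive, so all three squares vanish. *)
have S : (a - c) ^+ 2 + (a - 2 * b) ^+ 2 + (c - 2 * b) ^+ 2 = 2 * ((a + c - b) ^+ 2 - 3 * (a * c - b ^+ 2)) by ring.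
have abc : 0 <= a + c - b by lra.
have s3 : (a + c - b) ^+ 2 <= 3 by rewrite -q3 lerXn2r// nnegrE ltW.
rewrite D1 in S.
have z1 := sqr_ge0 (a - c); have z2 := sqr_ge0 (a - 2 * b); have z3 := sqr_ge0 (c - 2 * b).
have ab : a = 2 * b.
  by apply/eqP; rewrite -subr_eq0 -sqrf_eq0; apply/eqP; lra.
have ca : c = a.
  by apply/esym/eqP; rewrite -subr_eq0 -sqrf_eq0; apply/eqP; lra.
have b3 : b * Num.sqrt 3 = 1.
  apply/eqP; rewrite -(eqrXn2 (ltn0Sn 1)) ?mulr_ge0 ?ltW//; last by lra.
  by rewrite exprMn q3 expr1n; apply/eqP; move: D1; rewrite ca ab => D1; lra.
have bE : b = hexb by apply: (canRL (mulfK (lt0r_neq0 q0))).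
have aE : a = hexa by apply: (canRL (mulfK (lt0r_neq0 q0))); rewrite ab -mulrA b3 mulr1.
by split; rewrite ?ca.
Qed.

End Hex2.

(** * Poisson summation with signs, in one and two variables *)

Section Pois3.
Variable R : realType.
Implicit Types a b c s t : R.

(** The sign character moves the frequencies by [p / 2]. Its values depend only on the parity of
    [p]: the cases are [poisson] and [poisson_alt], and the integer part of [p / 2] is absorbed by
    shifting the index. *)
Lemma poisson_char t s (p : int) : 0 < t ->
  psum (fun k : int => cos (pi * (k * p)%:~R) * expR (- (pi * t) * (k%:~R + s) ^+ 2)) =
  (Num.sqrt t)^-1 * psum (fun k : int =>
    expR (- (pi / t) * (k%:~R + p%:~R / 2) ^+ 2) * cos (2 * pi * (k%:~R + p%:~R / 2) * s)).
Proof.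
move=> t0; pose u := (p %/ 2)%Z.
have shift (f : R -> R) : psum (fun k : int => f (k%:~R + u%:~R)) = psum (fun k : int => f k%:~R).
  rewrite (@reindex_psum _ _ _ (fun k : int => k + u) (fun k => f k%:~R)); last first.
    by exists (fun k => k - u) => k; rewrite ?addrK ?subrK.
  by apply: eq_psum => k; rewrite intrD.
have [pE|pE] : p = 2 * u \/ p = 2 * u + 1 by rewrite /u; lia.
- rewrite (eq_psum (g := fun k : int => expR (- (pi * t) * (k%:~R + s) ^+ 2))); last first.
    move=> k; rewrite (_ : pi * _ = 0 + 2 * pi * (k * u)%:~R) ?cosD_int ?cos0 ?mul1r//.
    by rewrite pE !intrM; ring.
  rewrite -/(theta t s) poisson//; congr (_ * _).
  rewrite /dual_theta -(shift (fun x => expR (- (pi / t) * x ^+ 2) * cos (2 * pi * x * s))).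
  by apply: eq_psum => k; rewrite (_ : p%:~R / 2 = u%:~R)// pE intrM; field.
- rewrite (eq_psum (g := fun k : int => cos (pi * k%:~R) * expR (- (pi * t) * (k%:~R + s) ^+ 2))); last first.
    move=> k; congr (_ * _); rewrite -[RHS](cosD_int _ (k * u)); congr cos.
    by rewrite pE !intrM intrD intrM; ring.
  rewrite poisson_alt//; congr (_ * _).
  rewrite -(shift (fun x => expR (- (pi / t) * (x + 2^-1) ^+ 2) * cos (2 * pi * (x + 2^-1) * s))).
  apply: eq_psum => k; rewrite (_ : k%:~R + p%:~R / 2 = k%:~R + u%:~R + 2^-1)//.
  by rewrite pE intrD intrM; field.
Qed.

Definition rqf a b c (x y : R) : R := a * x ^+ 2 + 2 * b * (x * y) + c * y ^+ 2.

Lemma absum_rqf a b c (x y : R) t : 0 < t -> 0 < a -> 0 < a * c - b ^+ 2 ->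
  absum (fun v : int * int => expR (- t * rqf a b c (v.1%:~R + x) (v.2%:~R + y))).
Proof.
move=> t0 a0 D0; set d := (a * c - b ^+ 2) / (a + c).
have c0 : 0 < c by have := sqr_ge0 b; nra.
have td : 0 < t * d by rewrite mulr_gt0// divr_gt0//; lra.
apply: absum_le (absum_mul (absum_gauss x td) (absum_gauss y td)) => v.
rewrite !ger0_norm ?mulr_ge0 ?expR_ge0// -expRD ler_expR.
rewrite -mulrDr -mulNr -mulrA mulNr [leRHS]mulNr lerN2 ler_pM2l//.
rewrite /d mulrAC ler_pdivrMr; last by lra.
set X := _ + x; set Y := _ + y.
rewrite -subr_ge0 /rqf (_ : _ - _ = (a * X + b * Y) ^+ 2 + (b * X + c * Y) ^+ 2); last by ring.
by rewrite addr_ge0 ?sqr_ge0.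
Qed.

(** One variable at a time, after completing the square. The inverse form is the original one turned
    by a right angle, up to the determinant; this is why a sign given by the symplectic product with
    [p] becomes a translation by [p / 2] in the same form. *)
Lemma poisson_plane a b c (p : int * int) : 0 < a -> 0 < a * c - b ^+ 2 ->
  psum (fun j : int * int => cos (pi * (j.1 * p.2 - j.2 * p.1)%:~R) * expR (- pi * qf a b c j)) =
  (Num.sqrt (a * c - b ^+ 2))^-1 * psum (fun k : int * int =>
    expR (- (pi / (a * c - b ^+ 2)) * rqf a b c (k.1%:~R + p.1%:~R / 2) (k.2%:~R + p.2%:~R / 2))).
Proof.
move=> a0 D0; set D := a * c - b ^+ 2.
have p0 := pi_gt0 R.
have c0 : 0 < c by have := sqr_ge0 b; nra.
have cs (i j : int) : cos (pi * (i * p.2 - j * p.1)%:~R) = cos (pi * (i * p.2)%:~R) * cos (pi * (j * p.1)%:~R) :> R.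
  by rewrite intrD mulrNz mulrDr mulrN cosB !sin_pi_int mulr0 addr0.
have s0 : absum (fun j : int * int => cos (pi * (j.1 * p.2 - j.2 * p.1)%:~R) * expR (- pi * qf a b c j)).
  apply: absum_le (absum_energy p0 a0 D0) => j.
  by rewrite normrM ler_piMl ?cos_max.
have [_ _ ->] := psum_fubini s0.
pose x (m : int) : R := m%:~R + p.1%:~R / 2.
pose F (k : int * int) : R := expR (- (pi * (D / c)) * k.1%:~R ^+ 2) * expR (- (pi / c) * x k.2 ^+ 2) *
   (cos (pi * (k.1 * p.2)%:~R) * cos (2 * pi * x k.2 * (b / c * k.1%:~R))).
have Dc : 0 < D / c by rewrite divr_gt0.
have sF : absum F.
  have := absum_mul (absum_gauss0 (mulr_gt0 p0 Dc)) (absum_gauss (p.1%:~R / 2) (divr_gt0 p0 c0)).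
  apply: absum_le => k; rewrite /F normrM ler_piMr// normrM.
  by rewrite mulr_ile1 ?cos_max.
transitivity (psum (fun i => (Num.sqrt c)^-1 * psum (fun m => F (i, m)))).
  apply: eq_psum => i.
  rewrite (eq_psum (g := fun j : int => cos (pi * (i * p.2)%:~R) * expR (- (pi * (D / c)) * i%:~R ^+ 2) *
     (cos (pi * (j * p.1)%:~R) * expR (- (pi * c) * (j%:~R + b / c * i%:~R) ^+ 2)))); last first.
    move=> j /=; rewrite cs -!mulrA; congr (_ * _); rewrite mulrCA; congr (_ * _).
    rewrite -expRD; congr expR; rewrite /qf /D /=; field.
    by rewrite gt_eqF.
  rewrite psumZ; last first.
    apply: absum_le (absum_gauss (b / c * i%:~R) (mulr_gt0 p0 c0)) => j.
    by rewrite normrM ler_piMl ?cos_max.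
  rewrite poisson_char// mulrCA; congr (_ * _); rewrite -psumZ.
    by apply: eq_psum => m; rewrite /F /x /=; ring.
  have := absum_gauss (p.1%:~R / 2) (divr_gt0 p0 c0); apply: absum_le => m.
  by rewrite normrM ler_piMr ?cos_max.
have [_ s2 e2] := psum_fubini sF.
rewrite psumZ// -e2.
pose sw (k : int * int) : int * int := (k.2, k.1).
have bsw : bijective sw by exists sw => -[].
rewrite (reindex_psum F bsw).
have [_ _ ->] := psum_fubini (reindex_absum bsw sF).
have [_ _ ->] := psum_fubini (absum_rqf (p.1%:~R / 2) (p.2%:~R / 2) (divr_gt0 p0 D0) a0 D0).
rewrite -!psumZ; last first.
- have [_ + _] := psum_fubini (reindex_absum bsw sF); exact.
- have [_ + _] := psum_fubini (absum_rqf (p.1%:~R / 2) (p.2%:~R / 2) (divr_gt0 p0 D0) a0 D0); exact.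
apply: eq_psum => m /=; rewrite /sw /F /=.
pose w := x m * (b / c) + p.2%:~R / 2.
have t0 : 0 < c / D by rewrite divr_gt0.
transitivity ((Num.sqrt c)^-1 * (expR (- (pi / c) * x m ^+ 2) * dual_theta (c / D) w)).
  congr (_ * _); rewrite /dual_theta -psumZ; last exact: absum_dual_theta.
  apply: eq_psum => i; rewrite -mulrA mulrCA; congr (_ * _).
  rewrite (_ : pi / (c / D) = pi * (D / c)); last by field; rewrite !gt_eqF.
  congr (_ * _).
  rewrite (_ : 2 * pi * i%:~R * w = pi * (i * p.2)%:~R + 2 * pi * x m * (b / c * i%:~R)); last first.
    by rewrite /w intrM; field; rewrite gt_eqF.
  by rewrite cosD sin_pi_int mul0r subr0.
have q0 : 0 < Num.sqrt (c / D) by rewrite sqrtr_gt0.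
(* The second variable is transformed by reading [poisson] from right to left. *)
have -> : dual_theta (c / D) w = Num.sqrt (c / D) * theta (c / D) w.
  by rewrite poisson// mulVKf// gt_eqF.
have -> : Num.sqrt (c / D) = Num.sqrt c * (Num.sqrt D)^-1 by rewrite sqrtrM ?ltW// sqrtrV// ltW.
have -> : (Num.sqrt c)^-1 * (expR (- (pi / c) * x m ^+ 2) * (Num.sqrt c / Num.sqrt D * theta (c / D) w)) =
  (Num.sqrt D)^-1 * (expR (- (pi / c) * x m ^+ 2) * theta (c / D) w).
  by field; rewrite !gt_eqF// sqrtr_gt0.
congr (_ * _); rewrite /theta -psumZ; last exact: absum_theta.
apply: eq_psum => l; rewrite -expRD; congr expR; rewrite /rqf /w /x /D; field.
by rewrite !gt_eqF.
Qed.

End Pois3.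

(** * Gaussian integrals *)

Section Integ.
Variable R : realType.
Notation mu := (@lebesgue_measure R).
Implicit Types (f g : R -> R) (a c w x : R).

Definition rint f := mu.-integrable [set: R] (EFin \o f).

Lemma rint_meas f : rint f -> measurable_fun [set: R] f.
Proof. by move=> /measurable_int/measurable_EFinP. Qed.

Lemma rintD f g : rint f -> rint g -> rint (fun x => f x + g x).
Proof. by move=> rf rg; have := integrableD (@measurableT _ _) rf rg. Qed.

Lemma rintZ c f : rint f -> rint (fun x => c * f x).
Proof. by move=> rf; have := integrableZl (@measurableT _ _) c rf. Qed.

Lemma rint_le f g : measurable_fun [set: R] f -> rint g ->
  (forall x, `|f x| <= g x) -> rint f.
Proof.
move=> mf rg fg; apply: (le_integrable (@measurableT _ _)) rg.
  exact/measurable_EFinP.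
by move=> x _ /=; rewrite lee_fin (le_trans (fg x))// ler_norm.
Qed.

Lemma RintD f g : rint f -> rint g ->
  Rintegral mu [set: R] (fun x => f x + g x) = Rintegral mu [set: R] f + Rintegral mu [set: R] g.
Proof. by move=> rf rg; apply: RintegralD. Qed.

Lemma RintZ c f : rint f ->
  Rintegral mu [set: R] (fun x => c * f x) = c * Rintegral mu [set: R] f.
Proof. by move=> rf; apply: RintegralZl. Qed.

Lemma rint_sum (I : Type) (s : seq I) (F : I -> R -> R) : (forall i, rint (F i)) ->
  rint (fun x => \sum_(i <- s) F i x) /\
  Rintegral mu [set: R] (fun x => \sum_(i <- s) F i x) = \sum_(i <- s) Rintegral mu [set: R] (F i).
Proof.
move=> rF; elim: s => [|i s [IH1 IH2]].
  under eq_fun do rewrite big_nil.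
  rewrite big_nil; split; first exact: integrable0.
  by rewrite /Rintegral integral0_eq.
rewrite big_cons; under eq_fun do rewrite big_cons; split; first exact: rintD.
by rewrite RintD// IH2.
Qed.

Lemma gauss_integral a c : 0 < a ->
  rint (fun x => expR (- a * (x - c) ^+ 2)) /\
  Rintegral mu [set: R] (fun x => expR (- a * (x - c) ^+ 2)) = Num.sqrt (pi / a).
Proof.
move=> a0; pose s : R := Num.sqrt ((2 * a)^-1).
have s2 : s ^+ 2 = (2 * a)^-1 by rewrite sqr_sqrtr// invr_ge0 mulr_ge0// ltW.
have s0 : s != 0 by rewrite gt_eqF// sqrtr_gt0 invr_gt0 mulr_gt0.
have E : (fun x => expR (- a * (x - c) ^+ 2)) =
    (fun x => Num.sqrt (pi / a) * normal_pdf c s x).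
  apply/funext => x; rewrite /normal_pdf (negbTE s0) /= /normal_peak /normal_fun s2.
  have -> : (2 * a)^-1 * pi *+ 2 = pi / a by rewrite -mulr_natl; field; rewrite gt_eqF.
  rewrite mulVKf; last by rewrite gt_eqF// sqrtr_gt0 divr_gt0// pi_gt0.
  by congr expR; rewrite -[in RHS]mulr_natl; field; rewrite gt_eqF.
have rn : rint (normal_pdf c s) by exact: integrable_normal_pdf.
rewrite E; split; first exact: rintZ.
by rewrite RintZ// /Rintegral integral_normal_pdf /= mulr1.
Qed.

(** Integration by parts on the line: the fundamental theorem on growing intervals, with dominated
    convergence. *)
Lemma integral_deriv0 f f' : (forall x, is_derive x 1 f (f' x)) ->
  continuous f' -> rint f' ->
  f n.+1%:R @[n --> \oo] --> (0 : R) -> f (- n.+1%:R) @[n --> \oo] --> (0 : R) ->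
  Rintegral mu [set: R] f' = 0.
Proof.
move=> df cf' rf' fy fNy.
pose I n : set R := `[- n.+1%:R, n.+1%:R]%classic.
have mI n : measurable (I n) by exact: measurable_itv.
have mf' := rint_meas rf'.
have FTC n : (\int[mu]_x (((f' \_ (I n)) x)%:E) = (f n.+1%:R - f (- n.+1%:R))%:E)%E.
  have n0 : 0 < n.+1%:R :> R by rewrite ltr0n.
  have n1 : - n.+1%:R < n.+1%:R :> R by lra.
  rewrite EFinB -(@continuous_FTC2 _ f' f _ _ n1).
  - rewrite [RHS]integral_mkcond; apply: eq_integral => x _.
    by rewrite /patch; case: ifP.
  - exact: continuous_subspaceT.
  - have cf x : {for x, continuous f}.
      by apply: differentiable_continuous; apply/derivable1_diffP; exact: (@ex_derive _ _ _ _ _ _ _ (df x)).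
    split.
    + move=> x _; exact: (@ex_derive _ _ _ _ _ _ _ (df x)).
    + exact/cvg_at_right_filter/cf.
    + exact/cvg_at_left_filter/cf.
  - by move=> x _; rewrite derive1E; exact: (@derive_val _ _ _ _ _ _ _ (df x)).
have L : (\int[mu]_x (((f' \_ (I n)) x)%:E))%E @[n --> \oo] --> (\int[mu]_x (f' x)%:E)%E.
  have [|||||_ _ //] := @dominated_convergence _ _ R mu setT measurableT
    (fun n x => ((f' \_ (I n)) x)%:E) (EFin \o f') (fun x => `|f' x|%:E).
  - move=> n; apply/measurable_EFinP.
    have [h _] := measurable_restrictT f' (mI n).
    by apply: h; exact: measurable_funTS.
  - exact/measurable_EFinP.
  - apply: aeW => x _; apply: cvg_near_cst; near=> n.
    rewrite /= patchE ifT// inE /I /= in_itv /=.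
    have : `|x| < n%:R by near: n; exact: nbhs_infty_gtr.
    by rewrite ltr_norml -natr1 => /andP[? ?]; apply/andP; split; lra.
  - exact: integrable_norm.
  - apply: aeW => x n _ /=; rewrite lee_fin patchE; case: ifP => // _.
    by rewrite normr0.
have Z : (f n.+1%:R - f (- n.+1%:R))%:E @[n --> \oo] --> 0%E.
  apply: cvg_EFin; first by near=> n.
  by rewrite /= -[X in _ --> X](subr0 0); apply: cvgB.
rewrite /Rintegral; have -> // : (\int[mu]_x (f' x)%:E)%E = 0%E.
apply: (@cvg_unique _ (@ereal_hausdorff R) _ _ _ _ _ Z).
move: L; apply: cvg_trans; apply: near_eq_cvg; near=> n.
by rewrite FTC.
Unshelve. all: by end_near. Qed.

Lemma cont_meas f : continuous f -> measurable_fun [set: R] f.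
Proof. exact: continuous_measurable_fun. Qed.

Section GaussFourier.
Variables a c phi : R.
Hypothesis a0 : 0 < a.

Let e x := expR (- a * (x - c) ^+ 2).
Let F w x := e x * cos (w * (x - c) + phi).
Let G w x := e x * sin (w * (x - c) + phi).

Let de x : is_derive x 1 e (- (2 * a) * (x - c) * e x).
Proof. by apply: is_derive_eq; rewrite /GRing.scale /e /=; ring. Qed.

Let derivable_cts f f' : (forall x, is_derive x 1 f (f' x)) -> continuous f.
Proof.
move=> df x; apply: differentiable_continuous; apply/derivable1_diffP.
exact: (@ex_derive _ _ _ _ _ _ _ (df x)).
Qed.

Let dlin w x : is_derive x 1 (fun x => w * (x - c) + phi) w.
Proof. by apply: is_derive_eq; rewrite /GRing.scale /=; ring. Qed.

Let dF w x : is_derive x 1 (F w) (- (2 * a) * (x - c) * F w x - w * G w x).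
Proof. by have := de x; have := dlin w x => ? ?; apply: is_derive_eq; rewrite /GRing.scale /F /G /=; ring. Qed.

Let dG w x : is_derive x 1 (G w) (- (2 * a) * (x - c) * G w x + w * F w x).
Proof. by have := de x; have := dlin w x => ? ?; apply: is_derive_eq; rewrite /GRing.scale /F /G /=; ring. Qed.

Let cF w : continuous (F w). Proof. exact: derivable_cts (dF w). Qed.
Let cG w : continuous (G w). Proof. exact: derivable_cts (dG w). Qed.

Let Fe w x : `|F w x| <= e x.
Proof. by rewrite normrM ger0_norm ?expR_ge0// ler_piMr ?expR_ge0 ?cos_max. Qed.
Let Ge w x : `|G w x| <= e x.
Proof. by rewrite normrM ger0_norm ?expR_ge0// ler_piMr ?expR_ge0 ?sin_max. Qed.

Let ie : rint e. Proof. exact: (gauss_integral c a0).1. Qed.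
Let iF w : rint (F w). Proof. exact: rint_le (cont_meas (@cF w)) ie (Fe w). Qed.

Let K : R := 1 + a^-1.
Let dom x := K * expR (- (a / 2) * (x - c) ^+ 2).
Let idom : rint dom.
Proof. by apply/rintZ; apply: (gauss_integral c _).1; rewrite divr_gt0. Qed.

(** Half of the Gaussian decay pays for the linear factor:
    [|y| <= 1 + y^2 / 2 <= K (1 + a y^2 / 2)], because [K >= 1] and [K a >= 1]. The majorant is
    uniform in [w]. *)
Let dome x : `|x - c| * e x <= dom x.
Proof.
rewrite /dom /e; set y := x - c.
have -> : - a * y ^+ 2 = (- (a / 2) * y ^+ 2) + - (a / 2 * y ^+ 2) by field.
rewrite expRD expRN mulrCA mulrC ler_wpM2r ?expR_ge0// ler_pdivrMr ?expR_gt0//.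
have h1 : 1 + a / 2 * y ^+ 2 <= expR (a / 2 * y ^+ 2) by exact: expR_ge1Dx.
have K1 : 1 <= K by rewrite lerDl invr_ge0 ltW.
have K2 : 1 <= K * a by rewrite mulrDl mulVf ?gt_eqF// mul1r lerDr ltW.
have y2 : `|y| ^+ 2 = y ^+ 2 by rewrite real_normK ?num_real.
have y0 : 0 <= y ^+ 2 by rewrite sqr_ge0.
apply: le_trans (_ : 1 + y ^+ 2 / 2 <= _); first by rewrite -y2; nra.
apply: le_trans (_ : K * (1 + a / 2 * y ^+ 2) <= _); first by nra.
by rewrite ler_wpM2l//; lra.
Qed.

Let ixG w : rint (fun x => (x - c) * G w x).
Proof.
apply: (rint_le _ idom) => [|x].
  by apply: cont_meas => x; apply: cvgM; [apply: cvgB; [exact: cvg_id|exact: cvg_cst]|exact: cG].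
by rewrite normrM; apply: le_trans (dome x); rewrite ler_wpM2l.
Qed.

Let e_cvg0 (u : nat -> R) : (forall M, \forall n \near \oo, M < `|u n|) ->
  e (u n) @[n --> \oo] --> (0 : R).
Proof.
move=> uy; apply/cvgrPdist_lt => eps eps0.
near=> n; rewrite sub0r normrN ger0_norm ?expR_ge0//.
have : a^-1 * eps^-1 + 1 + `|c| < `|u n| by near: n; exact: uy.
move=> h; have h2 : a^-1 * eps^-1 + 1 < `|u n - c|.
  by have := lerB_dist (u n) c; lra.
have i0 : 0 < a^-1 by rewrite invr_gt0.
have j0 : 0 < eps^-1 by rewrite invr_gt0.
rewrite /e mulNr expRN -[ltRHS]invrK ltf_pV2 ?posrE ?expR_gt0//.
apply: lt_le_trans (expR_ge1Dx _).
have -> : (u n - c) ^+ 2 = `|u n - c| ^+ 2 by rewrite real_normK ?num_real.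
have h3 : `|u n - c| <= `|u n - c| ^+ 2 by have := mulr_gt0 i0 j0; nra.
have : a * (a^-1 * eps^-1 + 1) <= a * `|u n - c| ^+ 2 by rewrite ler_pM2l//; lra.
have -> : a * (a^-1 * eps^-1 + 1) = eps^-1 + a by field; rewrite !gt_eqF.
move=> h4; apply: (@lt_le_trans _ _ (eps^-1 + a)); first by rewrite ltrDl.
by apply: le_trans h4 _; rewrite lerDr.
Unshelve. all: by end_near. Qed.

Let G_cvg0 w (u : nat -> R) : (forall M, \forall n \near \oo, M < `|u n|) ->
  G w (u n) @[n --> \oo] --> (0 : R).
Proof.
move=> /e_cvg0 h; apply: norm_cvg0.
apply: squeeze_cvgr (cvg_cst 0) h; near=> n.
by rewrite normr_ge0 Ge.
Unshelve. all: by end_near. Qed.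

Let byparts w : Rintegral mu [set: R] (fun x => (x - c) * G w x) =
  w / (2 * a) * Rintegral mu [set: R] (F w).
Proof.
have H : Rintegral mu [set: R] (fun x => - (2 * a) * ((x - c) * G w x) + w * F w x) = 0.
  apply: (@integral_deriv0 (G w)) => [x||||].
  - by rewrite mulrA; exact: dG.
  - move=> x; apply: cvgD.
      apply: cvgM; first exact: cvg_cst.
      by apply: cvgM; [apply: cvgB; [exact: cvg_id|exact: cvg_cst]|exact: cG].
    by apply: cvgM; [exact: cvg_cst|exact: cF].
  - exact/rintD/rintZ/iF/rintZ/ixG.
  - apply: G_cvg0 => M; near=> n; rewrite ger0_norm// -natr1.
    by rewrite (@lt_le_trans _ _ n%:R) ?lerDl//; near: n; exact: nbhs_infty_gtr.
  - apply: G_cvg0 => M; near=> n; rewrite normrN ger0_norm// -natr1.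
    by rewrite (@lt_le_trans _ _ n%:R) ?lerDl//; near: n; exact: nbhs_infty_gtr.
rewrite RintD ?RintZ in H; [|exact: ixG|exact: iF|exact/rintZ/ixG|exact/rintZ/iF].
move/eqP : H; rewrite mulNr addrC subr_eq0 => /eqP H.
by rewrite mulrAC H; field; rewrite gt_eqF.
Unshelve. all: by end_near. Qed.

Let J w := Rintegral mu [set: R] (F w).

Let dJ w : is_derive w 1 J (- (w / (2 * a)) * J w).
Proof.
have dw x (w' : R) : is_derive w' 1 (F^~ x) (- ((x - c) * G w' x)).
  have d : is_derive w' 1 (fun w => w * (x - c) + phi) (x - c).
    by apply: is_derive_eq; rewrite /GRing.scale /=; ring.
  by apply: is_derive_eq; rewrite /GRing.scale /F /G /=; ring.
have p1 (w' x : R) : partial1of2 F w' x = - ((x - c) * G w' x).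
  by rewrite partial1of2E; exact: (@derive_val _ _ _ _ _ _ _ (dw x w')).
have Iw : `](w - 1), (w + 1)[%classic w by rewrite /= in_itv /=; apply/andP; split; lra.
have b (x y : R) : `](w - 1), (w + 1)[%classic x -> [set: R] y -> `|partial1of2 F x y| <= dom y.
  by move=> _ _; rewrite p1 normrN normrM; apply: le_trans (dome y); rewrite ler_wpM2l.
have dom0 y : 0 <= dom y by apply: le_trans (dome y); rewrite mulr_ge0 ?expR_ge0.
have ex (x y : R) : `](w - 1), (w + 1)[%classic x -> [set: R] y -> derivable (F^~ y) x 1.
  by move=> _ _; exact: (@ex_derive _ _ _ _ _ _ _ (dw y x)).
have d1 := @derivable_under_integral R _ _ mu F setT measurableT w (w - 1) (w + 1) Iw
  (fun x _ => iF x) ex dom dom0 idom b.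
have d2 := @differentiation_under_integral R _ _ mu F setT measurableT w (w - 1) (w + 1) Iw
  (fun x _ => iF x) ex dom dom0 idom b.
apply: DeriveDef => //.
rewrite -derive1E d2.
rewrite (@eq_Rintegral _ _ _ mu setT (fun x => -1 * ((x - c) * G w x))); last first.
  by move=> x _; rewrite p1 mulN1r.
by rewrite RintZ ?byparts; [rewrite mulN1r mulNr|exact: ixG].
Qed.

(** Differentiation under the integral followed by integration by parts gives [J' = - w / (2 a) J],
    so [J w * expR (w^2 / (4 a))] is constant. *)
Lemma gauss_fourier w : J w = Num.sqrt (pi / a) * cos phi * expR (- w ^+ 2 / (4 * a)).
Proof.
pose P w := J w * expR (w ^+ 2 / (4 * a)).
have dP (v : R) : is_derive v 1 P 0.
  have dj := dJ v.
  apply: is_derive_eq; rewrite /GRing.scale /=; field.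
  by rewrite gt_eqF.
have := is_derive_0_is_cst w 0 dP.
rewrite /P expr0n mul0r expR0 mulr1 => h.
have J0 : J 0 = Num.sqrt (pi / a) * cos phi.
  rewrite mulrC -(gauss_integral c a0).2 -RintZ; last exact: ie.
  by apply: eq_Rintegral => x _; rewrite /F mul0r add0r mulrC.
by rewrite -J0 -h mulNr expRN mulfK// gt_eqF// expR_gt0.
Qed.

Lemma rint_gauss_cos w : rint (F w).
Proof. exact: iF. Qed.

End GaussFourier.

End Integ.

(** * Lower bound for the frame bound *)

Section Density.
Variable R : realType.
Implicit Types (k l p : int * int).

Lemma le_sum_subset (I : eqType) (f : I -> R) (s t : seq I) : (forall i, 0 <= f i) -> uniq s -> uniq t ->
  {subset s <= t} -> \sum_(i <- s) f i <= \sum_(i <- t) f i.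
Proof.
move=> f0 us ut st; rewrite [leRHS](bigID (mem s)) /= -[X in _ <= X + _]big_filter.
rewrite [X in _ <= X + _](perm_big s) /= ?lerDl ?sumr_ge0//.
apply: uniq_perm; rewrite ?filter_uniq//.
by move=> i; rewrite mem_filter /=; case: (boolP (i \in s)) => //= /st ->.
Qed.

Definition shiftv k l : int * int := (k.1 - l.1, k.2 - l.2).
Definition addv k l : int * int := (k.1 + l.1, k.2 + l.2).

Lemma shiftvK k : involutive (shiftv k).
Proof. by case=> a b; rewrite /shiftv /=; congr (_, _); lia. Qed.

Lemma shiftv_bij k : bijective (shiftv k).
Proof. by exists (shiftv k); exact: shiftvK. Qed.

Definition interval1 (M : nat) : seq int := [seq (i%:Z - M%:Z) | i <- iota 0 (2 * M).+1].
Definition box (M : nat) : seq (int * int) := [seq (i, j) | i <- interval1 M, j <- interval1 M].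

Lemma interval1_uniq M : uniq (interval1 M).
Proof. by rewrite map_inj_uniq ?iota_uniq// => i j; lia. Qed.

Lemma box_uniq M : uniq (box M).
Proof. by apply: allpairs_uniq; rewrite ?interval1_uniq// => -[a b] [c d] _ _ [-> ->]. Qed.

Lemma mem_interval1 M (i : int) : (i \in interval1 M) = (`|i| <= M)%N.
Proof.
apply/mapP/idP => [[j]|h]; first by rewrite mem_iota => ? ->; lia.
by exists (absz (i + M%:Z)); rewrite ?mem_iota; lia.
Qed.

Lemma mem_box M k : (k \in box M) = (`|k.1| <= M)%N && (`|k.2| <= M)%N.
Proof.
case: k => a b /=; apply/allpairsP/idP => [[[i j]] /= [ia jb [-> ->]]|/andP[ha hb]].
  by rewrite -!mem_interval1 ia.
by exists (a, b); rewrite /= !mem_interval1.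
Qed.

Lemma shiftv_box L r k p : k \in box L -> p \in box r -> shiftv k p \in box (L + r).
Proof. by rewrite !mem_box /shiftv /=; lia. Qed.

Lemma box_sub L M : (L <= M)%N -> {subset box L <= box M}.
Proof. by move=> LM k; rewrite !mem_box; lia. Qed.

Lemma size_box M : size (box M) = ((2 * M).+1 ^ 2)%N.
Proof. by rewrite size_allpairs size_map size_iota. Qed.

Lemma seq_sub_box (F : seq (int * int)) : exists M, {subset F <= box M}.
Proof.
elim: F => [|p F [M IH]]; first by exists 0%N.
exists (M + `|p.1| + `|p.2|)%N => q; rewrite inE => /orP[/eqP ->|/IH]; rewrite !mem_box; lia.
Qed.

(** The boxes differ by a boundary layer of order [r L], negligible against [L^2]. *)
Lemma le_of_density (x y : R) (r : nat) : 0 <= y ->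
  (forall L : nat, ((2 * L).+1 ^ 2)%:R * x <= ((2 * (L + r)).+1 ^ 2)%:R * y) -> x <= y.
Proof.
move=> y0 H; rewrite leNgt; apply/negP => xy.
pose L := (Num.truncn ((8 * r%:R + 8 * r%:R ^+ 2) * y / (x - y))).+1.
have d0 : 0 < x - y by rewrite subr_gt0.
have hL : (8 * r%:R + 8 * r%:R ^+ 2) * y < L%:R * (x - y).
  by rewrite -ltr_pdivrMr// /L truncnS_gt.
have := H L; rewrite !natrX (_ : (2 * L).+1%:R = 2 * L%:R + 1 :> R); last by rewrite -natr1 natrM.
rewrite (_ : (2 * (L + r)).+1%:R = 2 * (L%:R + r%:R) + 1 :> R); last by rewrite -natr1 natrM natrD.
have L1 : 1 <= L%:R :> R by rewrite ler1n.
have r0 : 0 <= r%:R :> R by [].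
move: hL L1; move: (L%:R : R) => l; move: r0; move: (r%:R : R) => s s0 hL l1.
have : (8 * s + 8 * s ^+ 2) * y * l <= l * (x - y) * l by rewrite ler_wpM2r ?ltW//; lra.
have : 0 <= s * y by rewrite mulr_ge0.
have : 0 <= s ^+ 2 * y by rewrite mulr_ge0// sqr_ge0.
move=> sy ssy.
have : s * y <= l * (s * y) by rewrite ler_peMl.
have : s ^+ 2 * y <= l * (s ^+ 2 * y) by rewrite ler_peMl.
have ll : 0 < (4 * l + 1) * (x - y) by rewrite mulr_gt0//; lra.
nra.
Qed.

Section Corr.
Variable E : int * int -> R.
Hypothesis E0 : forall k, 0 <= E k.
Hypothesis sE : absum E.

Definition corr p : R := psum (fun i => E (addv i p) * E i).

Lemma corr_sum : [/\ (forall p, 0 <= corr p), absum corr & psum corr = psum E ^+ 2].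
Proof.
have E20 (k : (int * int) * (int * int)) : 0 <= E k.1 * E k.2 by rewrite mulr_ge0.
pose e (k : (int * int) * (int * int)) := (addv k.2 k.1, k.2).
have be : bijective e.
  exists (fun k : (int * int) * (int * int) => (shiftv k.1 k.2, k.2)) => -[[a b] [c d]]; rewrite /e /addv /shiftv /=.
    by congr (_, _); congr (_, _); lia.
  by congr (_, _); congr (_, _); lia.
have s2 := absum_mul sE sE.
have s2e := reindex_absum be s2.
have [_ ac ec] := psum_fubini s2e.
split => //; first by move=> p; apply: psum_ge0 => i; rewrite mulr_ge0.
rewrite (_ : psum corr = psum (fun k : (int * int) * (int * int) => E (e k).1 * E (e k).2)); last by rewrite ec.
by rewrite -(reindex_psum (fun k : (int * int) * (int * int) => E k.1 * E k.2) be) psum_mul// expr2.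
Qed.

(* Both sides are summed over a large box: the left one is at least [N * psum E ^+ 2]
   per point up to boundary effects, the right one at most [B * psum E]. *)
Lemma density_bound (N B : R) : 0 <= N -> 0 < E (0, 0) ->
  (forall K : seq (int * int), uniq K ->
     N * \sum_(k <- K) \sum_(l <- K) corr (shiftv k l) <=
     B * \sum_(k <- K) \sum_(l <- K) E (shiftv k l)) ->
  N * psum E <= B.
Proof.
move=> N0 E00 H; have T0 := psum_gt0 E0 sE E00; set T := psum E in T0 *.
have [C0 sC eC] := corr_sum.
have ub K : uniq K -> \sum_(k <- K) \sum_(l <- K) E (shiftv k l) <= (size K)%:R * T.
  move=> uK; rewrite -sum1_size natr_sum mulr_suml; apply: ler_sum => k _; rewrite mul1r.
  rewrite /T (reindex_psum E (shiftv_bij k)); apply: finsum_le_psum => //.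
  exact: reindex_absum (shiftv_bij k) _.
have B0 : 0 <= B.
  have := H [:: (0, 0)] isT; rewrite !big_seq1 => h.
  have h1 : 0 <= N * corr (shiftv (0, 0) (0, 0)) by rewrite mulr_ge0.
  have h2 : E (shiftv (0, 0) (0, 0)) = E (0, 0) by rewrite /shiftv /= subr0.
  by rewrite -(pmulr_lge0 _ E00) -h2 (le_trans h1).
rewrite -(ler_pM2r T0) -mulrA -expr2 -eC.
apply/ler_addgt0Pr => e e0.
have [->|NN] := eqVneq N 0; first by rewrite mul0r addr_ge0 ?mulr_ge0// ltW.
have Np : 0 < N by rewrite lt_def NN.
have [F [uF hF]] := psum_tail C0 sC (divr_gt0 e0 Np).
have {}hF : N * psum corr - e < N * \sum_(p <- F) corr p.
  by move: hF; rewrite -(ltr_pM2l Np) mulrBr mulrCA divff// mulr1.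
suff : N * \sum_(p <- F) corr p <= B * T by lra.
have [r hr] := seq_sub_box F.
apply: (@le_of_density _ _ r); first by rewrite mulr_ge0// ltW.
move=> L; set K := box (L + r); have uK : uniq K := box_uniq _.
have := H K uK.
have : B * \sum_(k <- K) \sum_(l <- K) E (shiftv k l) <= B * ((size K)%:R * T).
  by rewrite ler_wpM2l// ub.
suff : ((2 * L).+1 ^ 2)%:R * \sum_(p <- F) corr p <= \sum_(k <- K) \sum_(l <- K) corr (shiftv k l).
  move=> h; have := ler_wpM2l N0 h; rewrite size_box; lra.
(* Only the [k] of the inner box are kept: around each of them the whole window [F] fits into
   [K]. *)
apply: (@le_trans _ _ (\sum_(k <- box L) \sum_(l <- K) corr (shiftv k l))); last first.
  apply: le_sum_subset; rewrite ?box_uniq//; first by move=> k; apply: sumr_ge0.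
  exact: box_sub (leq_addr _ _).
rewrite -size_box -sum1_size natr_sum mulr_suml big_seq [leRHS]big_seq.
apply: ler_sum => k kL; rewrite mul1r.
have -> : \sum_(p <- F) corr p = \sum_(l <- [seq shiftv k p | p <- F]) corr (shiftv k l).
  by rewrite big_map; apply: eq_bigr => p _; rewrite shiftvK.
apply: le_sum_subset => //; first by rewrite map_inj_uniq//; exact: inv_inj (shiftvK k).
by move=> l /mapP[p /hr pr ->]; exact: shiftv_box.
Qed.
End Corr.
End Density.

(** * Test functions on the dilated lattice *)

Section Low.
Local Open Scope complex_scope.
Variable R : realType.
Notation mu := (@lebesgue_measure R).
Implicit Types x y w t c phi : R.

Lemma det2 (S : 'M[R]_2) : \det S = S 0 0 * S 1 1 - S 0 1 * S 1 0.
Proof.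
rewrite (expand_det_row _ 0) !big_ord_recl big_ord0 addr0 /cofactor !det_mx11 !mxE /=.
rewrite (_ : lift 0 0 = 1); last exact/val_inj.
rewrite (_ : lift 1 0 = 0); last exact/val_inj.
by rewrite /bump /= expr0 expr1 mul1r mulN1r mulrN.
Qed.

Lemma mul_conj_expi (a b x g : R) :
  (a +i* b) * conjc (expi x * g%:C) = ((a * cos x + b * sin x) * g) +i* ((b * cos x - a * sin x) * g).
Proof. by rewrite /expi /=; congr (_ +i* _); ring. Qed.

Definition gau t : R := 2 `^ 4^-1 * expR (- pi * t ^+ 2).

Lemma gau_mul s t : gau s * gau t = Num.sqrt 2 * expR (- pi * (s ^+ 2 + t ^+ 2)).
Proof.
rewrite /gau mulrACA -powRD ?pnatr_eq0 ?implybT// -expRD.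
rewrite (_ : 4^-1 + 4^-1 = 2^-1 :> R); last by field.
by rewrite powR12_sqrt// -mulrDr.
Qed.

(** The product of two shifted Gaussians is a Gaussian of rate [2 pi] about the midpoint, so
    [gauss_fourier] applies; the midpoint accounts for the phase. *)
Lemma gau_pair x y w phi :
  rint (fun t => gau (t - x) * gau (t - y) * cos (2 * pi * w * t + phi)) /\
  Rintegral mu [set: R] (fun t => gau (t - x) * gau (t - y) * cos (2 * pi * w * t + phi)) =
  expR (- (pi / 2) * ((x - y) ^+ 2 + w ^+ 2)) * cos (pi * w * (x + y) + phi).
Proof.
have p0 := pi_gt0 R; have a0 : 0 < 2 * pi :> R by rewrite mulr_gt0.
have pN : pi != 0 :> R by rewrite gt_eqF.
pose c := (x + y) / 2.
pose K := Num.sqrt 2 * expR (- (pi / 2) * (x - y) ^+ 2).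
have E : (fun t => gau (t - x) * gau (t - y) * cos (2 * pi * w * t + phi)) =
   (fun t => K * (expR (- (2 * pi) * (t - c) ^+ 2) * cos ((2 * pi * w) * (t - c) + (2 * pi * w * c + phi)))).
  apply/funext => t; rewrite gau_mul /K.
  rewrite (_ : - pi * _ = - (pi / 2) * (x - y) ^+ 2 + - (2 * pi) * (t - c) ^+ 2); last first.
    by rewrite /c; field.
  rewrite expRD -!mulrA; congr (_ * (_ * (_ * cos _))); ring.
have i := @rint_gauss_cos R _ c (2 * pi * w * c + phi) a0 (2 * pi * w).
rewrite E; split; first exact: rintZ.
rewrite RintZ// gauss_fourier// /K.
rewrite (_ : pi / (2 * pi) = 2^-1); last by rewrite invfM mulrCA divff ?mulr1// gt_eqF.
rewrite (_ : - (2 * pi * w) ^+ 2 / (4 * (2 * pi)) = - (pi / 2) * w ^+ 2); last first.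
  by move: pN; generalize (pi : R) => q qN; field.
rewrite (mulrDr (- (pi / 2))) expRD sqrtrV// (_ : 2 * pi * w * c = pi * w * (x + y)); last by rewrite /c; field.
have q0 : Num.sqrt 2 != 0 :> R by rewrite gt_eqF// sqrtr_gt0.
by field.
Qed.

Lemma measurable_gau : measurable_fun [set: R] gau.
Proof.
apply: continuous_measurable_fun => x; apply: differentiable_continuous; apply/derivable1_diffP.
have : is_derive x 1 gau (2 `^ 4^-1 * (- pi * (2 * x) * expR (- pi * x ^+ 2))).
  by apply: is_derive_eq; rewrite /GRing.scale /=; ring.
by move=> h; exact: (@ex_derive _ _ _ _ _ _ _ h).
Qed.

Section TestFunction.
Variables (n : nat) (S : 'M[R]_2).
Hypothesis n0 : (0 < n)%N.
Hypothesis hdens : density S = (2 * n)%:R.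

Let X (k : int * int) : R := S 0 0 * k.1%:~R + S 0 1 * k.2%:~R.
Let W (k : int * int) : R := S 1 0 * k.1%:~R + S 1 1 * k.2%:~R.
Let N : R := (2 * n)%:R.

(* [testf K] is the sum over [k] in [K] of the symmetric time-frequency shifts
   [expi (- pi x w) pi(x, w) g] with [(x, w) = 2 n S k]. *)
Let phase (k : int * int) t : R := 2 * pi * (N * W k) * t - pi * (N * X k) * (N * W k).
Let amp (k : int * int) t : R := gau (t - N * X k).
Definition testf (K : seq (int * int)) (t : R) : R[i] :=
  (\sum_(k <- K) amp k t * cos (phase k t)) +i* (\sum_(k <- K) amp k t * sin (phase k t)).

(** The sign [e] is retained because it enters the phases; [N * det S] being an integer is what
    makes them signs. *)
Lemma detS : exists e : int, `|e| = 1 /\ N * (S 0 0 * S 1 1 - S 0 1 * S 1 0) = e%:~R.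
Proof.
have : `|\det S|^-1 = N := hdens.
rewrite det2; set d := _ - _ => h.
have N0 : N != 0 by rewrite pnatr_eq0; lia.
have d1 : N * `|d| = 1.
  by rewrite -h mulVf//; apply: contraNneq N0 => d0; rewrite -h d0 invr0.
have [d0|d0] := leP 0 d.
  by exists 1; split => //; rewrite -[RHS]d1 ger0_norm.
by exists (-1); split => //; rewrite mulrNz -[1%:~R]d1 ltr0_norm// mulrN opprK.
Qed.

Let cross (j k : int * int) : int := j.1 * k.2 - j.2 * k.1.

Let lam (j : int * int) : 'cV[R]_2 := \col_i (if i == 0 then X j else W j).

Let ga (v : int * int) : R := X v ^+ 2 + W v ^+ 2.

(** The symplectic product of [S j] and [N S k] is an integer, so all terms share one phase up to
    sign and the modulus is that of a real sum. *)
Lemma inner_test (K : seq (int * int)) (j : int * int) :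
  abs2 (inner (testf K) (tfshift (lam j) (@gauss0 R))) =
  (\sum_(k <- K) cos (pi * (cross j k)%:~R) *
     expR (- (pi / 2) * ((N * X k - X j) ^+ 2 + (N * W k - W j) ^+ 2))) ^+ 2.
Proof.
have [e [e1 eD]] := detS.
pose w k := N * W k - W j.
pose ph k := - (pi * (N * X k) * (N * W k)).
pose T k t := amp k t * gau (t - X j) * cos (2 * pi * w k * t + ph k).
(* The imaginary part is again a cosine, delayed by [pi / 2], so that [gau_pair] covers both
   parts. *)
pose U k t := amp k t * gau (t - X j) * cos (2 * pi * w k * t + (ph k - pi / 2)).
have E t : testf K t * conjc (tfshift (lam j) (@gauss0 R) t) =
    (\sum_(k <- K) T k t) +i* (\sum_(k <- K) U k t).
  rewrite /testf /tfshift !mxE /= mul_conj_expi; congr (_ +i* _).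
    rewrite !mulr_suml -big_split /= mulr_suml; apply: eq_bigr => k _.
    rewrite /T (_ : 2 * pi * w k * t + ph k = phase k t - 2 * pi * W j * t); last first.
      by rewrite /phase /w /ph; ring.
    by rewrite cosB -/(gau (t - X j)); ring.
  rewrite !mulr_suml -sumrB /= mulr_suml; apply: eq_bigr => k _.
  rewrite /U (_ : 2 * pi * w k * t + (ph k - pi / 2) = phase k t - 2 * pi * W j * t - pi / 2); last first.
    by rewrite /phase /w /ph; ring.
  by rewrite cosBpihalf sinB -/(gau (t - X j)); ring.
have iT k := gau_pair (N * X k) (X j) (w k) (ph k).
have iU k := gau_pair (N * X k) (X j) (w k) (ph k - pi / 2).
have ET : Rintegral mu [set: R] (fun t => \sum_(k <- K) T k t) =
    \sum_(k <- K) Rintegral mu [set: R] (T k).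
  by apply: (rint_sum _ _).2 => k; exact: (iT k).1.
have EU : Rintegral mu [set: R] (fun t => \sum_(k <- K) U k t) =
    \sum_(k <- K) Rintegral mu [set: R] (U k).
  by apply: (rint_sum _ _).2 => k; exact: (iU k).1.
have -> : inner (testf K) (tfshift (lam j) (@gauss0 R)) =
   (\sum_(k <- K) Rintegral mu [set: R] (T k)) +i* (\sum_(k <- K) Rintegral mu [set: R] (U k)).
  rewrite /inner /cintegral; congr (_ +i* _).
    by rewrite -ET; apply: eq_Rintegral => t _; rewrite E.
  by rewrite -EU; apply: eq_Rintegral => t _; rewrite E.
pose a k := expR (- (pi / 2) * ((N * X k - X j) ^+ 2 + w k ^+ 2)).
pose z k : R := pi * (e * cross j k)%:~R.
have A k : pi * w k * (N * X k + X j) + ph k = z k - pi * X j * W j.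
  rewrite /z intrM -eD /w /ph /cross intrD mulrNz !intrM /X /W; ring.
have cz k : cos (z k) = cos (pi * (cross j k)%:~R).
  rewrite /z; have [->|->] : e = 1 \/ e = -1 by lia.
    by rewrite mul1r.
  by rewrite mulN1r mulrNz mulrN cosN.
have sz k : sin (z k) = 0 by exact: sin_pi_int.
have -> : \sum_(k <- K) Rintegral mu [set: R] (T k) =
   cos (pi * X j * W j) * \sum_(k <- K) cos (pi * (cross j k)%:~R) * a k.
  rewrite mulr_sumr; apply: eq_bigr => k _; rewrite (iT k).2 A cosB sz cz -/(a k); ring.
have -> : \sum_(k <- K) Rintegral mu [set: R] (U k) =
   - sin (pi * X j * W j) * \sum_(k <- K) cos (pi * (cross j k)%:~R) * a k.
  rewrite mulr_sumr; apply: eq_bigr => k _; rewrite (iU k).2 addrA A cosBpihalf sinB sz cz -/(a k); ring.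
set s := \sum_(k <- K) _; rewrite /abs2 /= sqr_sqrtr ?addr_ge0 ?sqr_ge0//.
by rewrite !exprMn sqrrN -mulrDl cos2Dsin2 mul1r.
Qed.

Lemma sqnorm_test (K : seq (int * int)) :
  L2 (testf K) /\ (sqnorm (testf K) =
  (\sum_(k <- K) \sum_(l <- K)
     expR (- (pi / 2) * ((N * X k - N * X l) ^+ 2 + (N * W k - N * W l) ^+ 2)))%:E)%E.
Proof.
have [e [e1 eD]] := detS.
pose w k l := N * W k - N * W l.
pose ph k l := - (pi * (N * X k) * (N * W k)) + pi * (N * X l) * (N * W l).
pose T k l t := amp k t * amp l t * cos (2 * pi * w k l * t + ph k l).
have E t : abs2 (testf K t) = \sum_(k <- K) \sum_(l <- K) T k l t.
  rewrite /abs2 /= sqr_sqrtr ?addr_ge0 ?sqr_ge0// !expr2 !mulr_suml -big_split /=.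
  apply: eq_bigr => k _; rewrite !mulr_sumr -big_split /=; apply: eq_bigr => l _.
  rewrite /T (_ : 2 * pi * w k l * t + ph k l = phase k t - phase l t); last first.
    by rewrite /phase /w /ph; ring.
  by rewrite cosB; ring.
have iT k l := gau_pair (N * X k) (N * X l) (w k l) (ph k l).
have iS k : rint (fun t => \sum_(l <- K) T k l t) /\ Rintegral mu [set: R] (fun t => \sum_(l <- K) T k l t) =
    \sum_(l <- K) Rintegral mu [set: R] (T k l).
  by apply: rint_sum => l; exact: (iT k l).1.
have [iSS eSS] := rint_sum K (fun k => (iS k).1).
have mg := measurable_gau.
have ma k : measurable_fun [set: R] (amp k).
  by apply: measurableT_comp => //; exact: measurable_funB.
have mp k : measurable_fun [set: R] (phase k).
  by apply: measurable_funB => //; apply: measurable_funM.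
have N2 : sqnorm (testf K) = (\sum_(k <- K) \sum_(l <- K)
     expR (- (pi / 2) * ((N * X k - N * X l) ^+ 2 + (N * W k - N * W l) ^+ 2)))%:E.
  rewrite /sqnorm; under eq_integral do rewrite E.
  rewrite -[LHS]fineK; last exact: integrable_fin_num.
  congr EFin; rewrite -/(Rintegral mu [set: R] (fun t => \sum_(k <- K) \sum_(l <- K) T k l t)) eSS.
  apply: eq_bigr => k _; rewrite (iS k).2; apply: eq_bigr => l _; rewrite (iT k l).2.
  (* Here the density must be even: the phase is [pi N e] times an integer, and [N = 2 n] makes it a
     multiple of [2 pi]. *)
  rewrite (_ : pi * w k l * _ + _ = 0 + 2 * pi * (e * n%:Z * cross l k)%:~R) ?cosD_int ?cos0 ?mulr1//.
  have NN : N = 2 * n%:R by rewrite /N natrM.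
  rewrite !intrM -eD /w /ph /cross intrD mulrNz !intrM /X /W -[(n%:Z)%:~R]pmulrn NN; ring.
split=> //; split.
- under eq_fun do rewrite /testf /=.
  apply: measurable_sum => k; apply: measurable_funM => //.
  apply: measurableT_comp (mp k).
  exact: (cont_meas (@continuous_cos R)).
- under eq_fun do rewrite /testf /=.
  apply: measurable_sum => k; apply: measurable_funM => //.
  apply: measurableT_comp (mp k).
  exact: (cont_meas (@continuous_sin R)).
- by rewrite N2 ltry.
Qed.

Let a := S 0 0 ^+ 2 + S 1 0 ^+ 2.
Let b := S 0 0 * S 0 1 + S 1 0 * S 1 1.
Let c := S 0 1 ^+ 2 + S 1 1 ^+ 2.

Lemma N_gt0 : 0 < N.
Proof. by rewrite ltr0n; lia. Qed.

Lemma gram_det : 0 < a /\ a * c - b ^+ 2 = (N ^+ 2)^-1.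
Proof.
have [e [e1 eD]] := detS; have N0 := N_gt0.
have D : a * c - b ^+ 2 = (S 0 0 * S 1 1 - S 0 1 * S 1 0) ^+ 2 by rewrite /a /b /c; ring.
have e2 : (e%:~R) ^+ 2 = 1 :> R.
  have [->|->] : e = 1 \/ e = -1 by lia.
    by rewrite expr1n.
  by rewrite mulrNz sqrrN expr1n.
have D2 : a * c - b ^+ 2 = (N ^+ 2)^-1.
  rewrite D; apply: (mulfI (lt0r_neq0 (exprn_gt0 2 N0))).
  by rewrite mulfV ?expf_neq0 ?gt_eqF// -exprMn eD.
split=> //; rewrite lt0r addr_ge0 ?sqr_ge0// andbT; apply/eqP => a0.
have : 0 < (N ^+ 2)^-1 by rewrite invr_gt0 exprn_gt0.
by rewrite -D2 a0 mul0r sub0r oppr_gt0 ltNge sqr_ge0.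
Qed.

Lemma gram_qf v : ga v = qf a b c v.
Proof. by rewrite /ga /qf /a /b /c /X /W; ring. Qed.

Lemma lattice_bij : set_bij [set: int * int] (lattice S) lam.
Proof.
have [e [e1 eD]] := detS.
have lamE j : lam j = S *m map_mx intr (\col_(i < 2) (if i == 0 then j.1 else j.2)).
  apply/matrixP => i l; rewrite !mxE !big_ord_recl big_ord0 addr0 !mxE /=.
  have -> : lift 0 0 = 1 :> 'I_2 by exact/val_inj.
  by case: i => -[|[|//]] hi /=; rewrite /X /W; congr (S _ _ * _ + S _ _ * _); exact/val_inj.
split.
- by move=> j _; rewrite lamE; eexists.
- move=> [p q] [p' q'] _ _ /matrixP h; move: (h 0 0) (h 1 0); rewrite !mxE /X /W /= => h0 h1.
  have e0 : (e%:~R : R) != 0 by rewrite intr_eq0; lia.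
  have solve (s t u v x y : R) : s * x + t * y = 0 -> u * x + v * y = 0 ->
      (s * v - t * u) * x = 0 /\ (s * v - t * u) * y = 0.
    move=> h1' h2'; rewrite (_ : (s * v - t * u) * x = v * (s * x + t * y) - t * (u * x + v * y)); last by ring.
    rewrite (_ : (s * v - t * u) * y = s * (u * x + v * y) - u * (s * x + t * y)); last by ring.
    by rewrite h1' h2' !mulr0 subrr.
  have [E1 E2] : e%:~R * (p%:~R - p'%:~R) = 0 :> R /\ e%:~R * (q%:~R - q'%:~R) = 0 :> R.
    rewrite -eD -!mulrA; have [|| -> ->] := solve (S 0 0) (S 0 1) (S 1 0) (S 1 1) (p%:~R - p'%:~R) (q%:~R - q'%:~R).
    - by rewrite !mulrBr addrACA -opprD h0 subrr.
    - by rewrite !mulrBr addrACA -opprD h1 subrr.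
    by rewrite mulr0.
  move/eqP: E1; move/eqP: E2; rewrite !mulf_eq0 (negPf e0) /= !subr_eq0 !eqr_int.
  by move=> /eqP -> /eqP ->.
- move=> l [k _ <-]; exists (k 0 0, k 1 0) => //; rewrite lamE; congr (S *m map_mx _ _).
  apply/matrixP => i r; rewrite !mxE (ord1 r) /=.
  by case: i => -[|[|//]] hi /=; congr (k _ _); exact/val_inj.
Qed.

(** Equal to [expR (- pi / 2 * |2 n S v|^2)], the inner product of the Gaussian with its symmetric
    shift by [2 n S v]. *)
Let Ea v := expR (- (2 * pi * n%:R ^+ 2) * qf a b c v).

(* Poisson summation turns the alternating sum into a manifestly positive one. *)
Lemma twisted_sum p :
  expR (- (pi * n%:R ^+ 2) * qf a b c p) *
    psum (fun j => cos (pi * (cross j p)%:~R) * expR (- pi * qf a b c j)) = N * corr Ea p.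
Proof.
have [a0 D] := gram_det; have N0 := N_gt0.
have D0 : 0 < a * c - b ^+ 2 by rewrite D invr_gt0 exprn_gt0.
rewrite poisson_plane// D sqrtrV ?exprn_ge0 ?ltW// sqrtr_sqr gtr0_norm// !invrK mulrCA; congr (_ * _).
have t0 : 0 < pi * N ^+ 2 by rewrite mulr_gt0 ?pi_gt0 ?exprn_gt0.
rewrite -psumZ; last exact: absum_rqf.
apply: eq_psum => k; rewrite -!expRD; congr expR.
have -> : N = 2 * n%:R by rewrite /N natrM.
by rewrite /qf /rqf /addv /= !intrD; field.
Qed.

(** After expanding the square, the parallelogram law about the midpoint of [2 n k] and [2 n l]
    separates a factor in [k - l] from a Gaussian in [j]; the remaining sum over [j] is that of
    [twisted_sum]. *)
Lemma frame_ineq B (K : seq (int * int)) : is_upper_frame_bound (@gauss0 R) (lattice S) B ->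
  N * \sum_(k <- K) \sum_(l <- K) corr Ea (shiftv k l) <=
  B * \sum_(k <- K) \sum_(l <- K) Ea (shiftv k l).
Proof.
move=> HB; have [a0 D] := gram_det; have N0 := N_gt0.
have D0 : 0 < a * c - b ^+ 2 by rewrite D invr_gt0 exprn_gt0.
have N2 : N = 2 * n%:R by rewrite /N natrM.
have [f2 fn] := sqnorm_test K.
have := HB _ f2; rewrite fn (reindex_esum [set: int * int] _ lam); last exact: lattice_bij.
under eq_esum do rewrite inner_test.
pose A k j := expR (- (pi / 2) * ((N * X k - X j) ^+ 2 + (N * W k - W j) ^+ 2)).
pose T k l j := cos (pi * (cross j k)%:~R) * A k j * (cos (pi * (cross j l)%:~R) * A l j).
pose U p i := cos (pi * (cross i p)%:~R) * expR (- pi * qf a b c i).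
(* The midpoint [n (k + l)] is an integer vector, so this translation permutes the lattice
   points. *)
pose sh k l (j : int * int) : int * int := (j.1 - n%:Z * (k.1 + l.1), j.2 - n%:Z * (k.2 + l.2)).
have bsh k l : bijective (sh k l).
  exists (fun j => (j.1 + n%:Z * (k.1 + l.1), j.2 + n%:Z * (k.2 + l.2))) => -[x y];
  by rewrite /sh /= ?addrK ?subrK.
have sU p : absum (U p).
  apply: absum_le (absum_energy (pi_gt0 R) a0 D0) => j.
  by rewrite normrM ler_piMl ?cos_max.
have TE k l j : T k l j = expR (- (pi * n%:R ^+ 2) * qf a b c (shiftv k l)) * U (shiftv k l) (sh k l j).
  rewrite /T /U mulrACA [RHS]mulrCA; congr (_ * _).
    transitivity (cos (pi * (cross j k)%:~R - pi * (cross j l)%:~R) : R).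
      by rewrite cosB !sin_pi_int mulr0 addr0.
    rewrite -mulrBr -(cosD_int _ (n%:Z * cross k l)); congr cos.
    rewrite /cross /sh /shiftv /= !(intrD, mulrNz, intrM); ring.
  rewrite -!expRD -!gram_qf; congr expR.
  rewrite /ga /X /W /sh /shiftv /= !(intrD, mulrNz, intrM) N2 -[(n%:Z)%:~R]pmulrn.
  by field.
have sT k l : absum (T k l).
  apply: (eq_absum (fun j => esym (TE k l j))); apply: absumZ.
  exact: reindex_absum (bsh k l) _.
have pT k l : psum (T k l) = N * corr Ea (shiftv k l).
  rewrite (eq_psum (TE k l)) psumZ; last exact: reindex_absum (bsh k l) _.
  by rewrite -(reindex_psum _ (bsh k l)) -twisted_sum.
have TS k := psum_sum K (sT k).
have [TS1 TS2] := psum_sum K (fun k => (TS k).1).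
have E j : (\sum_(k <- K) cos (pi * (cross j k)%:~R) * A k j) ^+ 2 = \sum_(k <- K) \sum_(l <- K) T k l j.
  by rewrite expr2 mulr_suml; apply: eq_bigr => k _; rewrite mulr_sumr.
under eq_esum do rewrite E.
rewrite -psum_ge0E//; last by move=> j; rewrite -E sqr_ge0.
rewrite TS2 -EFinM lee_fin.
move=> h; apply: le_trans (le_trans h _).
  rewrite mulr_sumr.
  apply: ler_sum => k _; rewrite (TS k).2 mulr_sumr; apply: ler_sum => l _; by rewrite pT.
rewrite le_eqVlt; apply/orP; left; apply/eqP; congr (_ * _).
apply: eq_bigr => k _; apply: eq_bigr => l _; rewrite /Ea -gram_qf; congr expR.
rewrite /ga /X /W /shiftv /= !(intrD, mulrNz) N2; by field.
Qed.

Lemma frame_lower_bound B : is_upper_frame_bound (@gauss0 R) (lattice S) B ->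
  (2 * n)%:R * energy (2 * pi * n%:R ^+ 2) a b c <= B.
Proof.
move=> HB; have [a0 D] := gram_det; have N0 := N_gt0.
have D0 : 0 < a * c - b ^+ 2 by rewrite D invr_gt0 exprn_gt0.
have t0 : 0 < 2 * pi * n%:R ^+ 2 :> R by rewrite !mulr_gt0 ?pi_gt0 ?exprn_gt0 ?ltr0n.
apply: (@density_bound _ Ea) => //.
- by move=> k; exact: expR_ge0.
- exact: absum_energy.
- exact: expR_gt0.
- by move=> K _; exact: frame_ineq.
Qed.

End TestFunction.
End Low.

(** * Reduction of binary quadratic forms *)

Section Reduction.
Variable R : realType.
Implicit Types (a b c : R) (u v : int * int).

Definition bf a b c u v : R :=
  a * (u.1%:~R * v.1%:~R) + b * (u.1%:~R * v.2%:~R + u.2%:~R * v.1%:~R) + c * (u.2%:~R * v.2%:~R).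

Definition basisv u v := (u.1 * v.2 - v.1 * u.2) ^+ 2 = 1.

Lemma seq_min (I : eqType) (f : I -> R) (P : I -> Prop) (s : seq I) x : x \in s -> P x ->
  exists y, [/\ y \in s, P y & forall z, z \in s -> P z -> f y <= f z].
Proof.
elim: s x => // i s IH x xs Px.
have [[y ys Py]|Hn] := pselect (exists2 y, y \in s & P y); last first.
  move: xs; rewrite inE => /orP[/eqP xi|xs]; last by case: Hn; exists x.
  exists i; split; rewrite ?mem_head -?xi//.
  by move=> z; rewrite inE => /orP[/eqP ->|zs] Pz; [rewrite xi|case: Hn; exists z].
have [m [ms Pm mm]] := IH y ys Py.
have [Pi|Pi] := pselect (P i); last first.
  exists m; split; rewrite ?inE ?ms ?orbT// => z.
  by rewrite inE => /orP[/eqP ->//|]; exact: mm.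
have [im|mi] := leP (f i) (f m).
  exists i; split; rewrite ?mem_head// => z.
  by rewrite inE => /orP[/eqP ->//|zs Pz]; exact: le_trans im (mm z zs Pz).
exists m; split; rewrite ?inE ?ms ?orbT// => z.
by rewrite inE => /orP[/eqP -> _|]; [exact: ltW|exact: mm].
Qed.

Lemma qf_box a b c (h : R) : 0 < a -> 0 < a * c - b ^+ 2 ->
  exists M : nat, forall v, qf a b c v <= h -> v \in box M.
Proof.
move=> a0 D0; set d := (a * c - b ^+ 2) / (a + c).
have c0 : 0 < c by have := sqr_ge0 b; nra.
have d0 : 0 < d by rewrite divr_gt0//; lra.
exists (Num.truncn (h / d)).+1 => v vh.
have := le_trans (qf_ge v a0 D0) vh; rewrite -/d mulrC -ler_pdivlMr// => le.
have bnd (m : int) : m%:~R ^+ 2 <= h / d -> (`|m| <= (Num.truncn (h / d)).+1)%N.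
  move=> hm; rewrite -(ler_nat R); apply: le_trans (ltW (truncnS_gt _)).
  apply: le_trans hm; rewrite -rmorphXn /= -[(`|m|%N)%:R]/((`|m|%N%:Z)%:~R) ler_int; nia.
by rewrite mem_box !bnd//; apply: le_trans le; rewrite ?lerDl ?lerDr sqr_ge0.
Qed.

(** Lagrange reduction by minimality: [u] is shortest among the vectors that extend to a basis. A
    complement [v] is corrected by the nearest multiple of [u], and its sign is chosen to make the
    mixed term nonnegative. *)
Lemma reduced_basis a b c : 0 < a -> 0 < a * c - b ^+ 2 ->
  exists u v, [/\ basisv u v, 0 <= 2 * bf a b c u v, 2 * bf a b c u v <= qf a b c u &
    qf a b c u <= qf a b c v].
Proof.
move=> a0 D0; have [M HM] := qf_box a a0 D0.
pose P u := exists v, basisv u v.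
have q10 : qf a b c (1, 0) = a by rewrite /qf /=; ring.
have P10 : P (1, 0) by exists (0, 1).
have b10 : (1, 0) \in box M by apply: HM; rewrite q10.
have [u [ub [v uv] um]] := seq_min (qf a b c) b10 P10.
have {}um w : P w -> qf a b c u <= qf a b c w.
  move=> Pw; have [wb|] := boolP (w \in box M); first exact: um.
  move=> wb; apply: le_trans (um _ b10 P10) _.
  by rewrite q10 leNgt; apply: contra wb => /ltW; exact: HM.
set A := qf a b c u in um *.
have A0 : 0 < A.
  have c0 : 0 < c by have := sqr_ge0 b; nra.
  apply: lt_le_trans (qf_ge u a0 D0); rewrite mulr_gt0 ?divr_gt0//; first lra.
  rewrite lt0r addr_ge0 ?sqr_ge0// andbT paddr_eq0 ?sqr_ge0// !sqrf_eq0 !intr_eq0.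
  apply/negP => /andP[/eqP u1 /eqP u2]; move: uv; rewrite /basisv u1 u2; lia.
pose z := - Num.floor (bf a b c u v / A + 2^-1).
pose v1 : int * int := (v.1 + z * u.1, v.2 + z * u.2).
have uv1 : basisv u v1 by move: uv; rewrite /basisv /v1 /= => <-; ring.
have bv1 : bf a b c u v1 = bf a b c u v + z%:~R * A.
  by rewrite /bf /v1 /A /qf /= !(intrD, intrM); ring.
have hb : `|2 * bf a b c u v1| <= A.
  have := floor_itv (bf a b c u v / A + 2^-1).
  move=> /andP[h1 h2]; rewrite bv1 /z mulrNz; move: h1 h2; rewrite intrD; set F := (_%:~R : R) => h1 h2.
  set B := bf _ _ _ _ _ in h1 h2 *.
  have e : B = B / A * A by rewrite divfK// gt_eqF.
  rewrite e ler_norml; move: (B / A) h1 h2 => x h1 h2; apply/andP; split; nra.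
pose v2 : int * int := if 0 <= bf a b c u v1 then v1 else (- v1.1, - v1.2).
have uv2 : basisv u v2.
  by rewrite /v2; case: ifP => // _; move: uv1; rewrite /basisv /= => <-; ring.
have bv2 : bf a b c u v2 = `|bf a b c u v1|.
  rewrite /v2; case: (leP 0 (bf a b c u v1)) => h; first by rewrite ger0_norm.
  rewrite ltr0_norm//; by rewrite /bf /= !mulrNz; ring.
exists u, v2; split => //.
- by rewrite bv2 mulr_ge0.
- by rewrite bv2; move: hb; rewrite normrM ger0_norm.
- apply: um; exists u; move: uv2; rewrite /basisv => <-; ring.
Qed.

Lemma qf_basis a b c u v w :
  qf (qf a b c u) (bf a b c u v) (qf a b c v) w =
  qf a b c (u.1 * w.1 + v.1 * w.2, u.2 * w.1 + v.2 * w.2).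
Proof. by rewrite /qf /bf /= !(intrD, intrM); ring. Qed.

Lemma disc_basis a b c u v : basisv u v ->
  qf a b c u * qf a b c v - bf a b c u v ^+ 2 = a * c - b ^+ 2.
Proof.
move=> uv; have /(congr1 (fun z : int => z%:~R : R)) : basisv u v by [].
rewrite rmorphXn /= !(intrD, mulrNz, intrM) => e.
rewrite -[RHS]mulr1 -[1]/(1%:~R) -e /qf /bf; ring.
Qed.

Lemma basis_bij u v : basisv u v ->
  bijective (fun w : int * int => (u.1 * w.1 + v.1 * w.2, u.2 * w.1 + v.2 * w.2)).
Proof.
rewrite /basisv => uv; set e := _ - _ in uv.
exists (fun w : int * int => (e * (v.2 * w.1 - v.1 * w.2), e * (u.1 * w.2 - u.2 * w.1))) => -[x y] /=.
  by congr (_, _); [rewrite -[RHS]mul1r -uv /e|rewrite -[RHS]mul1r -uv /e]; ring.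
by congr (_, _); [rewrite -[RHS]mul1r -uv /e|rewrite -[RHS]mul1r -uv /e]; ring.
Qed.

Lemma energy_basis t a b c u v : basisv u v ->
  energy t (qf a b c u) (bf a b c u v) (qf a b c v) = energy t a b c.
Proof.
move=> uv; rewrite /energy [RHS](reindex_psum _ (basis_bij uv)).
by apply: eq_psum => w; rewrite qf_basis.
Qed.

End Reduction.

(** * Upper bound for the hexagonal lattice *)

Section Plane.
Variable R : realType.
Notation mu := (@lebesgue_measure R).
Notation mu2 := (mu \x mu)%E.
Implicit Types (f h V : R -> R) (C : R).

Definition rint2 (F : R * R -> R) := mu2.-integrable [set: R * R] (EFin \o F).

Lemma rint2D (F G : R * R -> R) : rint2 F -> rint2 G -> rint2 (fun z => F z + G z) /\
  (\int[mu2]_z (F z + G z)%:E = \int[mu2]_z (F z)%:E + \int[mu2]_z (G z)%:E)%E.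
Proof.
by move=> rF rG; split; [exact: (integrableD (@measurableT _ _) rF rG)|exact: (integralD (@measurableT _ _) rF rG)].
Qed.

Lemma rint2Z c (F : R * R -> R) : rint2 F -> rint2 (fun z => c * F z) /\
  (\int[mu2]_z (c * F z)%:E = c%:E * \int[mu2]_z (F z)%:E)%E.
Proof.
by move=> rF; split; [exact: (integrableZl (@measurableT _ _) c rF)|exact: (integralZl (@measurableT _ _) rF c)].
Qed.

Lemma meas_fst h : measurable_fun [set: R] h -> measurable_fun [set: R * R] (fun z => h z.1).
Proof. by move=> mh; exact: measurableT_comp mh measurable_fst. Qed.

Lemma meas_snd h : measurable_fun [set: R] h -> measurable_fun [set: R * R] (fun z => h z.2).
Proof. by move=> mh; exact: measurableT_comp mh measurable_snd. Qed.

Lemma meas_sub h : measurable_fun [set: R] h -> measurable_fun [set: R * R] (fun z => h (z.1 - z.2)).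
Proof.
by move=> mh; apply: measurableT_comp mh _; apply: measurable_funB; [exact: measurable_fst|exact: measurable_snd].
Qed.

Lemma rint_E h : rint h -> (\int[mu]_x (h x)%:E = (Rintegral mu [set: R] h)%:E)%E.
Proof. by move=> rh; rewrite -[LHS]fineK//; exact: integrable_fin_num. Qed.

Lemma prod_integral h : rint h ->
  rint2 (fun z => h z.1 * h z.2) /\
  (\int[mu2]_z (h z.1 * h z.2)%:E = (Rintegral mu [set: R] h ^+ 2)%:E)%E.
Proof.
move=> rh; have mh := rint_meas rh.
have pr : rint2 (fun z => h z.1 * h z.2).
  apply/integrable12ltyP => /=.
    by apply/measurable_EFinP; apply: measurable_funM; [exact: meas_fst|exact: meas_snd].
  have rn : rint (fun x => `|h x|) by exact: (integrable_abse rh).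
  rewrite [X in (X < _)%E](_ : _ = \int[mu]_x ((Rintegral mu [set: R] (fun x => `|h x|)) * `|h x|)%:E)%E.
    by rewrite rint_E ?ltry//; exact: rintZ.
  apply: eq_integral => x _.
  under eq_integral do rewrite normrM.
  by rewrite rint_E; [rewrite RintZ// mulrC|exact: rintZ].
split => //; rewrite -(integral12_prod_meas1 pr) /fubini_F /=.
rewrite [LHS](_ : _ = \int[mu]_x ((Rintegral mu [set: R] h) * h x)%:E)%E.
  by rewrite rint_E; [rewrite RintZ// expr2|exact: rintZ].
apply: eq_integral => x _.
by rewrite rint_E; [rewrite RintZ// mulrC|exact: rintZ].
Qed.

(** By [2 |f(t) f(s)| <= f(t)^2 + f(s)^2] and Tonelli, each half is integrated first in the variable
    absent from the square. *)
Lemma schur V C f : (forall u, 0 <= V u) -> measurable_fun [set: R] V ->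
  (forall u, V (- u) = V u) ->
  (forall t, rint (fun s => V (t - s)) /\ Rintegral mu [set: R] (fun s => V (t - s)) <= C) ->
  measurable_fun [set: R] f -> rint (fun t => f t ^+ 2) ->
  rint2 (fun z => `|f z.1 * f z.2| * V (z.1 - z.2)) /\
  (\int[mu2]_z (`|f z.1 * f z.2| * V (z.1 - z.2))%:E <=
     (C * Rintegral mu [set: R] (fun t => f t ^+ 2))%:E)%E.
Proof.
move=> V0 mV Vev HV mf f2.
have mf2 : measurable_fun [set: R] (fun t => f t ^+ 2) := rint_meas f2.
have mVs := meas_sub mV.
pose G1 (z : R * R) := (f z.1 ^+ 2 * V (z.1 - z.2))%:E.
pose G2 (z : R * R) := (f z.2 ^+ 2 * V (z.1 - z.2))%:E.
have mG1 : measurable_fun [set: R * R] G1.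
  by apply/measurable_EFinP; apply: measurable_funM => //; exact: (meas_fst mf2).
have mG2 : measurable_fun [set: R * R] G2.
  by apply/measurable_EFinP; apply: measurable_funM => //; exact: (meas_snd mf2).
have G10 z : (0 <= G1 z)%E by rewrite lee_fin mulr_ge0// sqr_ge0.
have G20 z : (0 <= G2 z)%E by rewrite lee_fin mulr_ge0// sqr_ge0.
have bound (H : R -> \bar R) : measurable_fun [set: R] H -> (forall t, 0 <= H t)%E ->
    (forall t, H t <= (C * f t ^+ 2)%:E)%E ->
    (\int[mu]_t H t <= (C * Rintegral mu [set: R] (fun t => f t ^+ 2))%:E)%E.
  move=> mH H0 HC; rewrite -RintZ// -rint_E; last exact: rintZ.
  by apply: ge0_le_integral => //; apply/measurable_EFinP; apply: measurable_funM.
have I1 : (\int[mu2]_z G1 z <= (C * Rintegral mu [set: R] (fun t => f t ^+ 2))%:E)%E.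
  rewrite fubini_tonelli1//; apply: bound.
  - exact: measurable_fun_fubini_tonelli_F.
  - by move=> t; apply: integral_ge0.
  - move=> t; rewrite /fubini_F /G1 /=; have [rV leV] := HV t.
    rewrite rint_E; last exact: rintZ.
    by rewrite RintZ// lee_fin mulrC ler_wpM2r// sqr_ge0.
have I2 : (\int[mu2]_z G2 z <= (C * Rintegral mu [set: R] (fun t => f t ^+ 2))%:E)%E.
  rewrite fubini_tonelli2//; apply: bound.
  - exact: measurable_fun_fubini_tonelli_G.
  - by move=> t; apply: integral_ge0.
  - move=> t; rewrite /fubini_G /G2 /=; have [rV leV] := HV t.
    under eq_integral do rewrite -Vev opprB.
    rewrite rint_E; last exact: rintZ.
    by rewrite RintZ// lee_fin mulrC ler_wpM2r// sqr_ge0.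
have mF : measurable_fun [set: R * R] (fun z => `|f z.1 * f z.2| * V (z.1 - z.2)).
  apply: measurable_funM => //; apply: measurableT_comp => //.
  by apply: measurable_funM; [exact: (meas_fst mf)|exact: (meas_snd mf)].
have le : (\int[mu2]_z (`|f z.1 * f z.2| * V (z.1 - z.2))%:E <=
     (C * Rintegral mu [set: R] (fun t => f t ^+ 2))%:E)%E.
  apply: (@le_trans _ _ (\int[mu2]_z (2^-1%:E * (G1 z + G2 z)))%E).
    apply: ge0_le_integral => //.
    - by move=> z _; rewrite lee_fin mulr_ge0.
    - exact/measurable_EFinP.
    - by apply: measurable_funeM; exact: emeasurable_funD.
    - move=> z _; rewrite /G1 /G2 -EFinD -EFinM lee_fin -mulrDl mulrA ler_wpM2r//.
      rewrite normrM; have := sqr_ge0 (`|f z.1| - `|f z.2|).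
      by rewrite sqrrB !real_normK ?num_real//; lra.
  rewrite ge0_integralZl//; last 2 first.
  - exact: emeasurable_funD.
  - by move=> z _; rewrite adde_ge0.
  rewrite ge0_integralD//.
  apply: (@le_trans _ _ (2^-1%:E * ((C * Rintegral mu [set: R] (fun t => f t ^+ 2))%:E + (C * Rintegral mu [set: R] (fun t => f t ^+ 2))%:E))%E).
    by apply: lee_wpmul2l; rewrite ?lee_fin//; exact: leeD.
  by rewrite -EFinD -EFinM lee_fin; lra.
split=> //; apply/integrableP; split; first exact/measurable_EFinP.
rewrite (_ : (\int[mu2]_z _)%E = (\int[mu2]_z (`|f z.1 * f z.2| * V (z.1 - z.2))%:E)%E).
  by apply: le_lt_trans le _; rewrite ltry.
by apply: eq_integral => z _ /=; rewrite ger0_norm// mulr_ge0.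
Qed.

End Plane.

(** * The damped kernel of the frame operator *)

Section Kernel.
Variable R : realType.
Notation mu := (@lebesgue_measure R).

Lemma psum_cvg (I : choiceType) (D : nat -> seq I) (f : I -> R) : (forall n, uniq (D n)) ->
  (forall i, \forall n \near \oo, i \in D n) -> absum f ->
  \sum_(i <- D n) f i @[n --> \oo] --> psum f.
Proof.
move=> uD hD sf; pose F n i := if i \in D n then f i else 0.
have E n : psum (F n) = \sum_(i <- D n) f i.
  rewrite (psum_finite (uD n) _).2; last by move=> i /negPf h; rewrite /F h.
  by apply: eq_big_seq => i h; rewrite /F h.
under eq_fun do rewrite -E.
apply: (tannery (g := fun i => `|f i|) _ _ _).2; first exact: absum_norm.
  by apply: nearW => n i; rewrite /F; case: ifP => // _; rewrite normr0.
move=> i; apply: cvg_near_cst; have := hD i; apply: filterS => n h; by rewrite /F h.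
Qed.

Lemma interval1_near (i : int) : \forall n \near \oo, i \in interval1 n.
Proof. by exists `|i|%N => // n /= h; rewrite mem_interval1. Qed.

Lemma box_near (v : int * int) : \forall n \near \oo, v \in box n.
Proof. by exists (`|v.1| + `|v.2|)%N => // n /= h; rewrite mem_box; lia. Qed.

Lemma psum_swap (I J : choiceType) (F : I -> J -> R) : absum (fun k : I * J => F k.1 k.2) ->
  psum (fun i => psum (F i)) = psum (fun j => psum (F^~ j)).
Proof.
move=> sF; pose e (k : J * I) := (k.2, k.1).
have be : bijective e by exists (fun k : I * J => (k.2, k.1)) => -[].
have [_ _ e1] := psum_fubini sF; rewrite -e1 (reindex_psum _ be).
by have [_ _ ->] := psum_fubini (reindex_absum be sF).
Qed.

Lemma rint_psum (F : int -> R -> R) C : (forall i x, 0 <= F i x) -> (forall i, rint (F i)) ->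
  (forall x, absum (F^~ x)) ->
  (forall s : seq int, uniq s -> \sum_(i <- s) Rintegral mu [set: R] (F i) <= C) ->
  rint (fun x => psum (F^~ x)) /\ Rintegral mu [set: R] (fun x => psum (F^~ x)) <= C.
Proof.
move=> F0 rF sF HC; pose g n x := (\sum_(i <- interval1 n) F i x)%:E.
have rg n := rint_sum (interval1 n) rF.
have mg n : measurable_fun [set: R] (g n) by exact: measurable_int (rg n).1.
have cg x : g n x @[n --> \oo] --> (psum (F^~ x))%:E.
  apply: cvg_EFin; first by apply: nearW.
  exact: (psum_cvg interval1_uniq interval1_near (sF x)).
have mP : measurable_fun [set: R] (fun x => (psum (F^~ x))%:E).
  by apply: (emeasurable_fun_cvg g) => // x _; exact: cg.
have le : (\int[mu]_x (psum (F^~ x))%:E <= C%:E)%E.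
  have g0 n x : [set: R] x -> (0 <= g n x)%E by rewrite lee_fin sumr_ge0.
  have nd x : [set: R] x -> {homo g^~ x : m k / (m <= k)%N >-> (m <= k)%E}.
    move=> _ m k mk; rewrite lee_fin; apply: le_sum_subset; rewrite ?interval1_uniq// => i.
    by rewrite !mem_interval1; lia.
  have := cvg_monotone_convergence (mu := mu) measurableT mg g0 nd.
  rewrite (_ : (\int[mu]_x limn (g^~ x))%E = \int[mu]_x (psum (F^~ x))%:E)%E; last first.
    by apply: eq_integral => x _; apply/cvg_lim => //; exact: cg.
  move=> h; rewrite -(cvg_lim _ h)//; apply: lime_le; first by apply/cvg_ex; eexists; exact: h.
  by apply: nearW => n; rewrite rint_E ?lee_fin ?(rg n).2 ?HC ?interval1_uniq//; exact: (rg n).1.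
have r : rint (fun x => psum (F^~ x)).
  apply/integrableP; split => //.
  rewrite (_ : (\int[mu]_x _)%E = \int[mu]_x (psum (F^~ x))%:E)%E.
    by apply: le_lt_trans le _; rewrite ltry.
  by apply: eq_integral => x _ /=; rewrite ger0_norm// psum_ge0.
by split => //; move: le; rewrite rint_E// lee_fin.
Qed.

Section Params.
Variables (al ga tt : R).
Hypotheses (al0 : 0 < al) (ga0 : 0 < ga) (tt0 : 0 < tt).
Implicit Types (u x t s : R) (j k l : int) (v : int * int).

(** What the window product at [t] and [s] leaves at the midpoint [x], see [gau_bump]; [phi l] sums
    it over the time lines with the signs created by the half-step shifts. *)
Let bump x j : R := expR (- (2 * pi) * (x - al * j%:~R) ^+ 2).
Let phi l x : R := psum (fun j => cos (pi * (j * l)%:~R) * bump x j).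

Let q : R := 2 * al ^+ 2.
Let q0 : 0 < q. Proof. by rewrite mulr_gt0 ?exprn_gt0. Qed.

Lemma bumpE x j : bump x j = expR (- (pi * q) * (j%:~R + - x / al) ^+ 2).
Proof. rewrite /bump /q; congr expR; field; by rewrite gt_eqF. Qed.

Lemma absum_bump x : absum (bump x).
Proof.
apply: (eq_absum (fun j => esym (bumpE x j))); apply: absum_gauss.
by rewrite mulr_gt0 ?pi_gt0.
Qed.

Lemma absum_phi l x : absum (fun j => cos (pi * (j * l)%:~R) * bump x j).
Proof. by apply: absum_le (absum_bump x) => j; rewrite normrM ler_piMl ?cos_max. Qed.

Lemma phi_dual l x : phi l x = (Num.sqrt q)^-1 * psum (fun k =>
  expR (- (pi / q) * (k%:~R + l%:~R / 2) ^+ 2) * cos (2 * pi * (k%:~R + l%:~R / 2) * (- x / al))).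
Proof. by rewrite -poisson_char//; apply: eq_psum => j; rewrite bumpE. Qed.

Lemma phi_dual0 l : phi l 0 = (Num.sqrt q)^-1 * psum (fun k =>
  expR (- (pi / q) * (k%:~R + l%:~R / 2) ^+ 2)).
Proof.
by rewrite phi_dual; congr (_ * _); apply: eq_psum => k; rewrite oppr0 mul0r mulr0 cos0 mulr1.
Qed.

(** On the dual side the coefficients are positive and [x] occurs only in cosines, all equal to 1 at
    the origin. *)
Lemma phi_le l x : `|phi l x| <= phi l 0.
Proof.
have pq : 0 < pi / q by rewrite divr_gt0 ?pi_gt0.
have sG : absum (fun k : int => expR (- (pi / q) * (k%:~R + l%:~R / 2) ^+ 2)) by exact: absum_gauss.
have sC : absum (fun k : int => expR (- (pi / q) * (k%:~R + l%:~R / 2) ^+ 2) * cos (2 * pi * (k%:~R + l%:~R / 2) * (- x / al))).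
  by apply: absum_le sG => k; rewrite normrM ler_piMr ?cos_max.
rewrite phi_dual phi_dual0 normrM ger0_norm ?invr_ge0 ?sqrtr_ge0//.
rewrite ler_wpM2l ?invr_ge0 ?sqrtr_ge0//; apply: le_trans (norm_psum sC) _.
apply: le_psum => //; first exact: absum_norm.
by move=> k; rewrite normrM [ `|expR _|]ger0_norm ?expR_ge0// ler_piMr ?expR_ge0// cos_max.
Qed.

Lemma phi_ge0 l : 0 <= phi l 0.
Proof. exact: le_trans (normr_ge0 _) (phi_le l 0). Qed.

Lemma phi_max l : phi l 0 <= phi 0 0.
Proof.
apply: le_psum; [exact: absum_phi|exact: absum_phi|move=> j].
by rewrite mulr0 mulr0 cos0 mul1r ler_piMl ?expR_ge0// cos_le1.
Qed.

Lemma phiN l : phi (- l) 0 = phi l 0.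
Proof. by apply: eq_psum => j; rewrite mulrN mulrNz mulrN cosN. Qed.

(** Gaussian damping in the frequency direction; it tends to 1 as [tt] grows. *)
Let wt v : R := expR (- (pi / tt) * (v.2%:~R + v.1%:~R / 2) ^+ 2).
Definition freq v : R := ga * (v.2%:~R + v.1%:~R / 2).
Let env u : R := Num.sqrt 2 * expR (- (pi / 2) * u ^+ 2).

Lemma gau_bump t s j : gau (t - al * j%:~R) * gau (s - al * j%:~R) = env (t - s) * bump ((t + s) / 2) j.
Proof.
rewrite gau_mul /env /bump -mulrA -expRD; congr (_ * expR _); by field.
Qed.

(* The kernel of the frame operator, each lattice point being damped by the
   weight [wt], which makes the sum over frequencies absolutely convergent. *)
Let kap (z : R * R) v : R := wt v * cos (2 * pi * freq v * (z.1 - z.2)) *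
  (gau (z.1 - al * v.1%:~R) * gau (z.2 - al * v.1%:~R)).

Let M : R := Num.sqrt tt * psum (fun l => expR (- (pi * tt) * (l%:~R + 0) ^+ 2)).

(** Poisson summation in frequency concentrates the kernel of each time line, as a function of
    [u = t - s], near the multiples of [1 / ga]. *)
Lemma wt_char j u : absum (fun k => wt (j, k) * cos (2 * pi * freq (j, k) * u)) /\
  psum (fun k => wt (j, k) * cos (2 * pi * freq (j, k) * u)) =
  Num.sqrt tt * psum (fun l => cos (pi * (l * j)%:~R) * expR (- (pi * tt) * (l%:~R + ga * u) ^+ 2)).
Proof.
have ptt : 0 < pi / tt by rewrite divr_gt0 ?pi_gt0.
split.
  by apply: absum_le (absum_gauss (j%:~R / 2) ptt) => k; rewrite normrM ler_piMr ?cos_max.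
rewrite poisson_char// mulVKf ?gt_eqF ?sqrtr_gt0//; apply: eq_psum => k.
by rewrite /wt /freq; congr (_ * cos _); ring.
Qed.

Lemma wt_sum j : absum (fun k => wt (j, k)) /\ psum (fun k => wt (j, k)) <= M.
Proof.
have ptt : 0 < pi / tt by rewrite divr_gt0 ?pi_gt0.
split; first exact: (absum_gauss (j%:~R / 2) ptt).
have [_] := wt_char j 0; rewrite (eq_psum (g := fun k => wt (j, k))); last first.
  by move=> k; rewrite mulr0 cos0 mulr1.
have sA : absum (fun l => expR (- (pi * tt) * (l%:~R + 0) ^+ 2)).
  by apply: absum_gauss; rewrite mulr_gt0 ?pi_gt0.
move=> ->; rewrite ler_wpM2l ?sqrtr_ge0//; apply: le_psum => //.
  by apply: absum_le sA => l; rewrite mulr0 normrM ler_piMl ?cos_max.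
move=> l; by rewrite mulr0 ler_piMl ?expR_ge0// cos_le1.
Qed.

Lemma env_ge0 u : 0 <= env u.
Proof. by rewrite mulr_ge0 ?sqrtr_ge0 ?expR_ge0. Qed.

Lemma wt_bump_sum x : absum (fun v => bump x v.1 * wt v) /\
  psum (fun v => bump x v.1 * wt v) <= M * phi 0 0.
Proof.
have b0 j : 0 <= bump x j by exact: expR_ge0.
have w0 v : 0 <= wt v by exact: expR_ge0.
have s1 j : absum (fun k => bump x j * wt (j, k)) by apply: absumZ; exact: (wt_sum j).1.
have e1 j : psum (fun k => bump x j * wt (j, k)) <= M * bump x j.
  by rewrite psumZ; [rewrite mulrC ler_wpM2r// (wt_sum j).2|exact: (wt_sum j).1].
have s2 : absum (fun j => M * bump x j) by apply: absumZ; exact: absum_bump.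
have s3 : absum (fun j => psum (fun k => bump x j * wt (j, k))).
  apply: absum_le s2 => j; rewrite ger0_norm; last by apply: psum_ge0 => k; rewrite mulr_ge0.
  by apply: le_trans (e1 j) (ler_norm _).
have sA : absum (fun v => bump x v.1 * wt v).
  by apply: absum_prod => //= v; rewrite mulr_ge0.
split=> //; have [_ _ ->] := psum_fubini sA.
apply: le_trans (le_psum s3 s2 e1) _; rewrite psumZ; last exact: absum_bump.
rewrite ler_wpM2l//; first by rewrite mulr_ge0 ?sqrtr_ge0// psum_ge0// => l; exact: expR_ge0.
apply: le_trans (phi_le 0 x); apply: le_trans (ler_norm _).
rewrite le_eqVlt; apply/orP; left; apply/eqP/eq_psum => j.
by rewrite mulr0 mulr0 cos0 mul1r.
Qed.

Lemma kap_norm z v : `|kap z v| <= env (z.1 - z.2) * (bump ((z.1 + z.2) / 2) v.1 * wt v).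
Proof.
rewrite /kap gau_bump normrM normrM [ `|_ * bump _ _|]ger0_norm ?mulr_ge0 ?env_ge0 ?expR_ge0//.
rewrite [leRHS]mulrA [leRHS]mulrC ler_wpM2r ?mulr_ge0 ?env_ge0 ?expR_ge0//.
by rewrite [ `|wt v|]ger0_norm ?expR_ge0// ler_piMr ?expR_ge0// cos_max.
Qed.

Lemma absum_kap z : absum (kap z).
Proof.
apply: absum_le (absumZ (env (z.1 - z.2)) (wt_bump_sum ((z.1 + z.2) / 2)).1) => v.
by apply: le_trans (kap_norm z v) (ler_norm _).
Qed.

(** A crude bound, uniform in the finite set, which serves as majorant for dominated convergence;
    the sharp bound [kap_psum] concerns the full sum. *)
Lemma kap_dom z (D : seq (int * int)) : uniq D ->
  `|\sum_(v <- D) kap z v| <= (M * phi 0 0) * env (z.1 - z.2).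
Proof.
move=> uD; set x := (z.1 + z.2) / 2.
apply: le_trans (ler_norm_sum _ _ _) _.
apply: le_trans (ler_sum _ (fun v _ => kap_norm z v)) _; rewrite -mulr_sumr mulrC.
rewrite ler_wpM2r ?env_ge0//; apply: le_trans (wt_bump_sum x).2.
apply: finsum_le_psum => //; last exact: (wt_bump_sum x).1.
by move=> v; rewrite mulr_ge0 ?expR_ge0.
Qed.

(** The contribution of the peak near [- l / ga], with [phi l] at the midpoint replaced by its
    maximum. *)
Let Vterm l u : R := Num.sqrt tt * env u * (phi l 0 * expR (- (pi * tt) * (l%:~R + ga * u) ^+ 2)).
Let V u : R := psum (Vterm^~ u).

Lemma Vterm_ge0 l u : 0 <= Vterm l u.
Proof. by rewrite !mulr_ge0 ?sqrtr_ge0 ?expR_ge0 ?phi_ge0. Qed.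

Lemma absum_Vterm u : absum (Vterm^~ u).
Proof.
apply: absumZ; have sA : absum (fun l => phi 0 0 * expR (- (pi * tt) * (l%:~R + ga * u) ^+ 2)).
  by apply: absumZ; apply: absum_gauss; rewrite mulr_gt0 ?pi_gt0.
apply: absum_le sA => l.
by rewrite !ger0_norm ?mulr_ge0 ?phi_ge0 ?expR_ge0// ler_wpM2r ?expR_ge0// phi_max.
Qed.

Lemma V_even u : V (- u) = V u.
Proof.
have be : bijective (fun l : int => - l) by exists (fun l : int => - l); exact: opprK.
rewrite /V (reindex_psum _ be); apply: eq_psum => l.
rewrite /Vterm phiN /env sqrrN; congr (_ * (_ * expR (_ * _))).
by rewrite mulrNz mulrN -opprD sqrrN.
Qed.

Lemma kap_psum z : `|psum (kap z)| <= V (z.1 - z.2).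
Proof.
set u := z.1 - z.2; set x := (z.1 + z.2) / 2.
have [_ _ ->] := psum_fubini (absum_kap z).
pose ex l := expR (- (pi * tt) * (l%:~R + ga * u) ^+ 2).
have sex : absum ex by apply: absum_gauss; rewrite mulr_gt0 ?pi_gt0.
pose F j l := Num.sqrt tt * env u * (cos (pi * (l * j)%:~R) * (bump x j * ex l)).
have sF : absum (fun v : int * int => F v.1 v.2).
  apply: absumZ; apply: absum_le (absum_mul (absum_bump x) sex) => v.
  by rewrite normrM ler_piMl ?cos_max.
have E1 j : psum (fun k => kap z (j, k)) = psum (F j).
  have [s1 e1] := wt_char j u.
  transitivity (psum (fun k => env u * bump x j * (wt (j, k) * cos (2 * pi * freq (j, k) * u)))).
    by apply: eq_psum => k; rewrite /kap gau_bump mulrC.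
  rewrite psumZ// e1 mulrA -psumZ.
    by apply: eq_psum => l; rewrite /F -/(ex l); ring.
  by apply: absum_le sex => l; rewrite normrM ler_piMl ?cos_max.
(* With [l] outside, the sum over time lines becomes [phi l] at the midpoint. *)
rewrite (eq_psum E1) psum_swap//.
have E2 l : psum (F^~ l) = Num.sqrt tt * env u * (phi l x * ex l).
  rewrite psumZ; last first.
    apply: absum_le (absumZ (ex l) (absum_bump x)) => j.
    by rewrite normrM [bump _ _ * _]mulrC ler_piMl ?cos_max.
  congr (_ * _); rewrite mulrC -psumZ; last exact: absum_phi.
  by apply: eq_psum => j; rewrite (mulrC l j); ring.
have b0 : 0 <= Num.sqrt tt * env u by rewrite mulr_ge0 ?sqrtr_ge0 ?env_ge0.
have E3 l : `|psum (F^~ l)| <= Vterm l u.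
  rewrite E2 normrM (ger0_norm b0) ler_wpM2l// normrM [ `|ex l|]ger0_norm ?expR_ge0//.
  by rewrite ler_wpM2r ?expR_ge0// phi_le.
have s3 : absum (fun l => psum (F^~ l)).
  by apply: absum_le (absum_Vterm u) => l; apply: le_trans (E3 l) (ler_norm _).
apply: le_trans (norm_psum s3) _; apply: le_psum => //; first exact: absum_norm.
exact: absum_Vterm.
Qed.

Let A : R := tt * ga ^+ 2.
Let kappa : R := A / (A + 2^-1).

(* Completing the square: the two Gaussians in [u] combine into one Gaussian
   centred at a multiple of [l / ga], with total mass at most [1 / ga]. *)
Lemma Vterm_int l t : rint (fun s => Vterm l (t - s)) /\
  Rintegral mu [set: R] (fun s => Vterm l (t - s)) <=
  Num.sqrt 2 / ga * (phi l 0 * expR (- (pi / 2 * kappa) * (l%:~R / ga) ^+ 2)).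
Proof.
have A0 : 0 < A by rewrite mulr_gt0 ?exprn_gt0.
pose B := A + 2^-1; have B0 : 0 < B by rewrite addr_gt0.
have pB : 0 < pi * B by rewrite mulr_gt0 ?pi_gt0.
pose c := t + A / B * (l%:~R / ga).
pose K := Num.sqrt tt * Num.sqrt 2 * (phi l 0 * expR (- (pi / 2 * kappa) * (l%:~R / ga) ^+ 2)).
have E s : Vterm l (t - s) = K * expR (- (pi * B) * (s - c) ^+ 2).
  rewrite /Vterm /K /env.
  transitivity (Num.sqrt tt * Num.sqrt 2 * phi l 0 * (expR (- (pi / 2) * (t - s) ^+ 2) * expR (- (pi * tt) * (l%:~R + ga * (t - s)) ^+ 2))); first by ring.
  transitivity (Num.sqrt tt * Num.sqrt 2 * phi l 0 * (expR (- (pi / 2 * kappa) * (l%:~R / ga) ^+ 2) * expR (- (pi * B) * (s - c) ^+ 2))); last by ring.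
  rewrite -!expRD; congr (_ * expR _).
  move: A0; rewrite /c /kappa /B /A => A1.
  field; rewrite ?gt_eqF//=; lra.
have [g1 g2] := gauss_integral c pB.
rewrite (_ : (fun s => Vterm l (t - s)) = (fun s => K * expR (- (pi * B) * (s - c) ^+ 2))); last by apply/funext.
split; first exact: rintZ.
rewrite RintZ// g2 /K.
rewrite mulrAC ler_wpM2r//; first by rewrite mulr_ge0 ?phi_ge0 ?expR_ge0.
rewrite mulrAC mulrC ler_wpM2l ?sqrtr_ge0// -sqrtrM; last exact: ltW.
rewrite -[leRHS]ger0_norm; last by rewrite invr_ge0 ltW.
rewrite -sqrtr_sqr ler_wsqrtr//.
have -> : pi / (pi * B) = B^-1 by rewrite invfM mulrA divff ?mul1r// gt_eqF// pi_gt0.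
by rewrite ler_pdivrMr// exprVn ler_pdivlMl ?exprn_gt0// mulrC -/A /B lerDl.
Qed.

(** The damping enters the final bound only through [e], equal to [kappa < 1]; removing it means [e]
    tending to 1. *)
Let kernel_term e l : R := Num.sqrt 2 / ga * (phi l 0 * expR (- (pi / 2 * e) * (l%:~R / ga) ^+ 2)).
Definition kernel_sum e : R := psum (kernel_term e).

Lemma absum_kernel_term (e : R) : 0 < e -> absum (kernel_term e).
Proof.
move=> e0; apply: absumZ.
have c0 : 0 < pi / 2 * e / ga ^+ 2 by rewrite !mulr_gt0 ?pi_gt0 ?invr_gt0 ?exprn_gt0.
apply: absum_le (absumZ (phi 0 0) (absum_gauss0 c0)) => l.
have -> : - (pi / 2 * e) * (l%:~R / ga) ^+ 2 = - (pi / 2 * e / ga ^+ 2) * l%:~R ^+ 2.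
  by field; rewrite gt_eqF.
by rewrite !ger0_norm ?mulr_ge0 ?phi_ge0 ?expR_ge0// ler_wpM2r ?expR_ge0// phi_max.
Qed.

Lemma kappa_gt0 : 0 < kappa.
Proof.
have A0 : 0 < A by rewrite mulr_gt0 ?exprn_gt0.
by rewrite divr_gt0// addr_gt0.
Qed.

Lemma V_int t : rint (fun s => V (t - s)) /\ Rintegral mu [set: R] (fun s => V (t - s)) <= kernel_sum kappa.
Proof.
apply: (@rint_psum (fun l s => Vterm l (t - s))).
- by move=> l s; exact: Vterm_ge0.
- by move=> l; exact: (Vterm_int l t).1.
- by move=> s; exact: absum_Vterm.
move=> s us; apply: le_trans (ler_sum _ (fun l _ => (Vterm_int l t).2)) _.
apply: finsum_le_psum => //; last exact: absum_kernel_term kappa_gt0.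
by move=> l; rewrite !mulr_ge0 ?phi_ge0 ?expR_ge0 ?sqrtr_ge0// invr_ge0 ltW.
Qed.

Lemma measurable_V : measurable_fun [set: R] V.
Proof.
have := rint_meas (V_int 0).1; rewrite (_ : (fun s => V (0 - s)) = V)//.
by apply/funext => s; rewrite sub0r V_even.
Qed.

Lemma kernel_term_ge0 e l : 0 <= kernel_term e l.
Proof. by rewrite !mulr_ge0 ?phi_ge0 ?expR_ge0 ?sqrtr_ge0// invr_ge0 ltW. Qed.

Lemma kernel_sum_cvg (e : nat -> R) : (forall n, 2^-1 <= e n) -> e n @[n --> \oo] --> (1 : R) ->
  kernel_sum (e n) @[n --> \oo] --> kernel_sum 1.
Proof.
move=> eh e1; apply: (tannery (g := kernel_term 2^-1) _ _ _).2.
- exact: absum_kernel_term.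
- apply: nearW => n l; rewrite ger0_norm ?kernel_term_ge0//.
  have c0 : 0 <= Num.sqrt 2 / ga by rewrite mulr_ge0 ?sqrtr_ge0// invr_ge0 ltW.
  rewrite /kernel_term ler_wpM2l// ler_wpM2l ?phi_ge0// ler_expR ler_wpM2r ?sqr_ge0//.
  by rewrite lerN2 ler_wpM2l// divr_ge0// pi_ge0.
move=> l; apply: cvgM; first exact: cvg_cst.
apply: cvgM; first exact: cvg_cst.
have h : - (pi / 2 * e x) * (l%:~R / ga) ^+ 2 @[x --> \oo] --> - (pi / 2 * 1) * (l%:~R / ga) ^+ 2.
  by apply: cvgM; [apply: cvgN; apply: cvgM e1; exact: cvg_cst|exact: cvg_cst].
by apply: continuous_cvg h; exact: continuous_expR.
Qed.

(** Expanding [phi l 0] in its dual series gives a double Gaussian sum; [1 / ga = 2 n al] and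
    [1 / al = 2 n ga] identify its exponent with the form. *)
Lemma kernel_sum1 (n : nat) : (0 < n)%N -> al * ga = (2 * n)%:R^-1 ->
  kernel_sum 1 = (2 * n)%:R * energy (2 * pi * n%:R ^+ 2) (al ^+ 2 + (ga / 2) ^+ 2) (ga / 2 * ga) (ga ^+ 2).
Proof.
move=> n0 alga; have N0 : 0 < (2 * n)%:R :> R by rewrite ltr0n muln_gt0.
have Nn : (2 * n)%:R = 2 * n%:R :> R by rewrite natrM.
have iga : ga^-1 = (2 * n)%:R * al.
  by apply: (mulIf (lt0r_neq0 ga0)); rewrite mulVf ?gt_eqF// -mulrA alga mulfV ?gt_eqF.
have ial : al^-1 = (2 * n)%:R * ga.
  by apply: (mulIf (lt0r_neq0 al0)); rewrite mulVf ?gt_eqF// -mulrA [ga * al]mulrC alga mulfV ?gt_eqF.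
set a := al ^+ 2 + _; set b := _ * ga; set c := ga ^+ 2.
have a0 : 0 < a by rewrite /a ltr_wpDr ?sqr_ge0 ?exprn_gt0.
have D0 : 0 < a * c - b ^+ 2.
  by rewrite (_ : _ - _ = al ^+ 2 * ga ^+ 2) ?mulr_gt0 ?exprn_gt0//; rewrite /a /b /c; ring.
have t0 : 0 < 2 * pi * n%:R ^+ 2 :> R by rewrite !mulr_gt0 ?pi_gt0 ?exprn_gt0 ?ltr0n.
rewrite /energy; have [s1 _ ->] := psum_fubini (absum_energy t0 a0 D0).
rewrite -psumZ; last by have [_ + _] := psum_fubini (absum_energy t0 a0 D0).
apply: eq_psum => l; rewrite /kernel_term phi_dual0 -psumZ; last exact: s1.
have pq : 0 < pi / q by rewrite divr_gt0 ?pi_gt0.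
have sG : absum (fun k : int => expR (- (pi / q) * (k%:~R + l%:~R / 2) ^+ 2)) by exact: absum_gauss.
rewrite -[(_ * psum _) * _]mulrA [psum _ * _]mulrC -psumZ// -psumZ; last exact: absumZ.
rewrite -psumZ; last exact/absumZ/absumZ.
apply: eq_psum => k; rewrite -expRD mulrA; congr (_ * expR _).
  rewrite /q sqrtrM// sqrtr_sqr gtr0_norm// invfM ial.
  have s2 : Num.sqrt 2 != 0 :> R by rewrite gt_eqF// sqrtr_gt0.
  move: (_%:R : R) (Num.sqrt 2 : R) s2 => m r r0; field.
  by rewrite r0 gt_eqF.
rewrite /q invfM -exprVn ial iga /qf /a /b /c /= Nn; by field.
Qed.

Section RealSignal.
Variable f : R -> R.
Hypotheses (mf : measurable_fun [set: R] f) (f2 : rint (fun t => f t ^+ 2)).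

Lemma rint_window x (c : R -> R) : measurable_fun [set: R] c -> (forall t, `|c t| <= 1) ->
  rint (fun t => f t * c t * gau (t - x)).
Proof.
move=> mc c1; have [g2 _] := gau_pair x x 0 0.
have mg : measurable_fun [set: R] (fun t => gau (t - x)).
  by apply: measurableT_comp; [exact: measurable_gau|exact: measurable_funB].
apply: (@rint_le _ _ (fun t => f t ^+ 2 + gau (t - x) * gau (t - x) * cos (2 * pi * 0 * t + 0))).
- by apply: measurable_funM => //; exact: measurable_funM.
- exact: rintD.
move=> t; rewrite mulr0 mul0r addr0 cos0 mulr1; move: (gau (t - x)) => y; rewrite !normrM.
have h := c1 t; have := sqr_ge0 (`|f t| - `|y|); rewrite sqrrB !real_normK ?num_real//.
have : `|f t| * `|c t| * `|y| <= `|f t| * `|y|.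
  by rewrite ler_wpM2r// ler_piMr.
by have := sqr_ge0 (f t); have := sqr_ge0 y; rewrite -!expr2; lra.
Qed.

Definition coef_cos v := Rintegral mu [set: R] (fun t => f t * cos (2 * pi * freq v * t) * gau (t - al * v.1%:~R)).
Definition coef_sin v := Rintegral mu [set: R] (fun t => f t * sin (2 * pi * freq v * t) * gau (t - al * v.1%:~R)).

Lemma measurable_cosM (w : R) : measurable_fun [set: R] (fun t => cos (w * t)).
Proof.
apply: measurableT_comp; first exact: (cont_meas (@continuous_cos R)).
exact: measurable_funM.
Qed.

Lemma measurable_sinM (w : R) : measurable_fun [set: R] (fun t => sin (w * t)).
Proof.
apply: measurableT_comp; first exact: (cont_meas (@continuous_sin R)).
exact: measurable_funM.
Qed.

Lemma rint_cos v : rint (fun t => f t * cos (2 * pi * freq v * t) * gau (t - al * v.1%:~R)).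
Proof. by apply: rint_window; [exact: measurable_cosM|move=> t; exact: cos_max]. Qed.

Lemma rint_sin v : rint (fun t => f t * sin (2 * pi * freq v * t) * gau (t - al * v.1%:~R)).
Proof. by apply: rint_window; [exact: measurable_sinM|move=> t; exact: sin_max]. Qed.

Lemma kap_coef v : rint2 (fun z => f z.1 * f z.2 * kap z v) /\
  (\int[mu \x mu]_z (f z.1 * f z.2 * kap z v)%:E = (wt v * (coef_cos v ^+ 2 + coef_sin v ^+ 2))%:E)%E.
Proof.
have [c1 c2] := prod_integral (rint_cos v); have [s1 s2] := prod_integral (rint_sin v).
have E z : f z.1 * f z.2 * kap z v = wt v * (
    (f z.1 * cos (2 * pi * freq v * z.1) * gau (z.1 - al * v.1%:~R)) *
    (f z.2 * cos (2 * pi * freq v * z.2) * gau (z.2 - al * v.1%:~R)) +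
    (f z.1 * sin (2 * pi * freq v * z.1) * gau (z.1 - al * v.1%:~R)) *
    (f z.2 * sin (2 * pi * freq v * z.2) * gau (z.2 - al * v.1%:~R))).
  by rewrite /kap mulrBr cosB; ring.
have [d1 d2] := rint2D c1 s1; have [e1 e2] := rint2Z (wt v) d1.
split; first by rewrite /rint2; under eq_fun do rewrite E.
by under eq_integral do rewrite E; rewrite e2 d2 c2 s2 -EFinD -EFinM.
Qed.

Lemma kap_coef_sum (D : seq (int * int)) : rint2 (fun z => f z.1 * f z.2 * \sum_(v <- D) kap z v) /\
  (\int[mu \x mu]_z (f z.1 * f z.2 * \sum_(v <- D) kap z v)%:E =
   (\sum_(v <- D) wt v * (coef_cos v ^+ 2 + coef_sin v ^+ 2))%:E)%E.
Proof.
elim: D => [|v D [IH1 IH2]].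
  rewrite /rint2 big_nil; split.
    by under eq_fun do rewrite big_nil mulr0; exact: integrable0.
  by under eq_integral do rewrite big_nil mulr0; rewrite integral0.
have [k1 k2] := kap_coef v.
have E z : f z.1 * f z.2 * \sum_(v <- v :: D) kap z v =
    f z.1 * f z.2 * kap z v + f z.1 * f z.2 * \sum_(v <- D) kap z v by rewrite big_cons mulrDr.
have [d1 d2] := rint2D k1 IH1.
split; first by rewrite /rint2; under eq_fun do rewrite E.
by under eq_integral do rewrite E; rewrite d2 k2 IH2 big_cons EFinD.
Qed.

Lemma weighted_frame_bound (D : seq (int * int)) : uniq D ->
  \sum_(v <- D) wt v * (coef_cos v ^+ 2 + coef_sin v ^+ 2) <=
  kernel_sum kappa * Rintegral mu [set: R] (fun t => f t ^+ 2).
Proof.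
move=> uD; pose S n := \sum_(v <- box n) wt v * (coef_cos v ^+ 2 + coef_sin v ^+ 2).
pose F n (z : R * R) := (f z.1 * f z.2 * \sum_(v <- box n) kap z v)%:E.
pose G (z : R * R) := (f z.1 * f z.2 * psum (kap z))%:E.
have mF n : measurable_fun [set: R * R] (F n) by exact: measurable_int (kap_coef_sum (box n)).1.
have FG z : F n z @[n --> \oo] --> G z.
  apply: cvg_EFin; first by apply: nearW.
  apply: cvgM; first exact: cvg_cst.
  exact: psum_cvg box_uniq box_near (absum_kap z).
have mG : measurable_fun [set: R * R] G.
  by apply: (emeasurable_fun_cvg F) => // z _; exact: FG.
pose V0 u := M * phi 0 0 * env u.
have M0 : 0 <= M * phi 0 0.
  by rewrite !mulr_ge0 ?sqrtr_ge0 ?phi_ge0// psum_ge0// => l; exact: expR_ge0.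
have p2 : 0 < pi / 2 :> R by rewrite divr_gt0 ?pi_gt0.
(* First use of Schur's test, with the crude kernel: it makes the majorant integrable on the
   plane. *)
have [||||i0 _] := @schur _ V0 (M * phi 0 0 * (Num.sqrt 2 * Num.sqrt (pi / (pi / 2)))) f _ _ _ _ mf f2.
- by move=> u; rewrite mulr_ge0// env_ge0.
- apply: measurable_funM => //; apply: measurable_funM => //.
  have := rint_meas (gauss_integral 0 p2).1.
  by under eq_fun do rewrite subr0.
- by move=> u; rewrite /V0 /env sqrrN.
- move=> t; have [g1 g2] := gauss_integral t p2.
  rewrite (_ : (fun s => V0 (t - s)) = fun s => (M * phi 0 0 * Num.sqrt 2) * expR (- (pi / 2) * (s - t) ^+ 2)).
    by rewrite RintZ// g2 mulrA; split => //; exact: rintZ.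
  by apply/funext => s; rewrite /V0 /env -(opprB t s) sqrrN !mulrA.
have dom n z : (`|F n z| <= (`|f z.1 * f z.2| * V0 (z.1 - z.2))%:E)%E.
  rewrite /F /= lee_fin normrM ler_wpM2l//; exact: kap_dom (box_uniq n).
have a1 : {ae (mu \x mu)%E, forall z, [set: R * R] z -> F ^~ z @ \oo --> G z}.
  by apply: aeW => z _; exact: FG.
have a2 : {ae (mu \x mu)%E, forall z n, [set: R * R] z ->
    (`|F n z| <= (`|f z.1 * f z.2| * V0 (z.1 - z.2))%:E)%E}.
  by apply: aeW => z n _; exact: dom.
have [_ _ lim] := @dominated_convergence _ _ R (mu \x mu)%E setT measurableT F G _ mF mG a1 i0 a2.
(* Second use, with the sharp kernel: this one gives the constant. *)
have [_ le] := @schur _ V (kernel_sum kappa) f (fun u => psum_ge0 (fun l => Vterm_ge0 l u)) measurable_V V_even V_int mf f2.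
have [iV _] := @schur _ V (kernel_sum kappa) f (fun u => psum_ge0 (fun l => Vterm_ge0 l u)) measurable_V V_even V_int mf f2.
have le2 : (\int[mu \x mu]_z G z <= (kernel_sum kappa * Rintegral mu [set: R] (fun t => f t ^+ 2))%:E)%E.
  apply: le_trans le; apply: le_trans (lee_abs _) _.
  have h := @le_abse_integral _ _ _ (mu \x mu)%E [set: R * R] G measurableT mG.
  apply: le_trans h _.
  apply: ge0_le_integral => //.
  - exact: measurableT_comp.
  - exact: measurable_int iV.
  - by move=> z _; rewrite /= lee_fin normrM ler_wpM2l// kap_psum.
rewrite -lee_fin; apply: le_trans le2.
have w0 v : 0 <= wt v * (coef_cos v ^+ 2 + coef_sin v ^+ 2).
  by rewrite mulr_ge0 ?expR_ge0// addr_ge0// sqr_ge0.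
rewrite -(cvg_lim _ lim)//; apply: lime_ge; first by apply/cvg_ex; eexists; exact: lim.
have [m hm] := seq_sub_box D.
exists m => // n /= mn; rewrite (kap_coef_sum (box n)).2 lee_fin.
apply: le_sum_subset => //; first exact: box_uniq.
by move=> v /hm; exact: box_sub.
Qed.

End RealSignal.

End Params.
End Kernel.

(** * Removal of the damping, and complex signals *)

Section Upper.
Local Open Scope complex_scope.
Variable R : realType.
Notation mu := (@lebesgue_measure R).
Variables (al ga : R).
Hypotheses (al0 : 0 < al) (ga0 : 0 < ga).
Implicit Types (v : int * int) (f : R -> R).

Let P f v := coef_cos al ga f v ^+ 2 + coef_sin al ga f v ^+ 2.

(** With the finite set [D] fixed, [expR (- x) >= 1 - x] shows that the damping costs a multiple of
    [harmonic m]; then [m] tends to infinity. *)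
Lemma real_frame_bound f (D : seq (int * int)) : measurable_fun [set: R] f ->
  rint (fun t => f t ^+ 2) -> uniq D ->
  \sum_(v <- D) P f v <= kernel_sum al ga 1 * Rintegral mu [set: R] (fun t => f t ^+ 2).
Proof.
move=> mf f2 uD; set I := Rintegral _ _ _.
pose e (m : nat) : R := 1 - harmonic m.+1.
have he : harmonic m.+1 @[m --> \oo] --> (0 : R).
  by have := @cvg_harmonic R; rewrite -cvg_shiftS.
have e1 : e m @[m --> \oo] --> (1 : R).
  by rewrite -[X in _ --> X]subr0; apply: cvgB he; exact: cvg_cst.
have eh m : 2^-1 <= e m.
  rewrite /e /harmonic /= lerBrDl -lerBrDr (_ : 1 - 2^-1 = 2^-1 :> R); last by field.
  by rewrite lef_pV2 ?posrE// ler_nat.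
pose S := \sum_(v <- D) (v.2%:~R + v.1%:~R / 2) ^+ 2 * P f v.
have P0 v : 0 <= P f v by rewrite addr_ge0 ?sqr_ge0.
have c1 : \sum_(v <- D) P f v - 2 * pi * ga ^+ 2 * S * harmonic m @[m --> \oo] --> \sum_(v <- D) P f v.
  rewrite -[X in _ --> X]subr0; apply: cvgB; first exact: cvg_cst.
  rewrite -(mulr0 (2 * pi * ga ^+ 2 * S)); apply: cvgM; first exact: cvg_cst.
  exact: cvg_harmonic.
have c2 : kernel_sum al ga (e m) * I @[m --> \oo] --> kernel_sum al ga 1 * I.
  by apply: cvgM; [exact: kernel_sum_cvg|exact: cvg_cst].
apply: ler_cvg_to c1 c2 _.
(* This [tt] makes [kappa] equal to [(m + 1) / (m + 2)], that is [e m]. *)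
apply: nearW => m; pose tt : R := m.+1%:R / (2 * ga ^+ 2).
have m0 : 0 < m.+1%:R :> R by rewrite ltr0n.
have tt0 : 0 < tt by rewrite divr_gt0 ?mulr_gt0 ?exprn_gt0.
have := weighted_frame_bound al0 ga0 tt0 mf f2 uD.
have -> : tt * ga ^+ 2 / (tt * ga ^+ 2 + 2^-1) = e m.
  rewrite /tt /e /harmonic /= -[m.+2%:R]natr1; move: (m.+1%:R : R) m0 => k k0.
  have -> : k / (2 * ga ^+ 2) * ga ^+ 2 = k / 2 by field; rewrite gt_eqF.
  have k1 : k + 1 != 0 by rewrite gt_eqF// addr_gt0.
  by field.
apply: le_trans; rewrite (_ : 2 * pi * ga ^+ 2 * S * harmonic m =
    \sum_(v <- D) 2 * pi * ga ^+ 2 * harmonic m * (v.2%:~R + v.1%:~R / 2) ^+ 2 * P f v); last first.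
  by rewrite /S mulrAC mulr_sumr; apply: eq_bigr => v _; rewrite mulrA.
rewrite -sumrB; apply: ler_sum => v _.
rewrite -/(P f v) -[X in X - _]mul1r -mulrBl ler_wpM2r//.
apply: le_trans (expR_ge1Dx _); rewrite mulNr lerD2l lerN2.
rewrite (_ : pi / tt = 2 * pi * ga ^+ 2 * harmonic m)//.
by rewrite /tt /harmonic /= invfM invrK; ring.
Qed.

Lemma conj_coef (f1 f2 : R -> R) v : measurable_fun [set: R] f1 -> measurable_fun [set: R] f2 ->
  rint (fun t => f1 t ^+ 2) -> rint (fun t => f2 t ^+ 2) ->
  forall l : 'cV[R]_2, l 0 0 = al * v.1%:~R -> l 1 0 = freq ga v ->
  abs2 (inner (fun t => f1 t +i* f2 t) (tfshift l (@gauss0 R))) =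
  (coef_cos al ga f1 v + coef_sin al ga f2 v) ^+ 2 + (coef_cos al ga f2 v - coef_sin al ga f1 v) ^+ 2.
Proof.
move=> m1 m2 r1 r2 l lx lw.
have c1 := rint_cos al ga m1 r1 v; have c2 := rint_cos al ga m2 r2 v.
have s1 := rint_sin al ga m1 r1 v; have s2 := rint_sin al ga m2 r2 v.
have sN := rintZ (-1) s1.
have E t : (f1 t +i* f2 t) * conjc (tfshift l (@gauss0 R) t) =
   (f1 t * cos (2 * pi * freq ga v * t) * gau (t - al * v.1%:~R) +
    f2 t * sin (2 * pi * freq ga v * t) * gau (t - al * v.1%:~R)) +i*
   (f2 t * cos (2 * pi * freq ga v * t) * gau (t - al * v.1%:~R) +
    - 1 * (f1 t * sin (2 * pi * freq ga v * t) * gau (t - al * v.1%:~R))).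
  rewrite /tfshift lx lw mul_conj_expi -/(gau (t - al * v.1%:~R)).
  by congr (_ +i* _); ring.
rewrite /inner /cintegral.
under eq_Rintegral do rewrite E /=.
under [X in _ +i* X]eq_Rintegral do rewrite E /=.
rewrite !RintD// RintZ// mulN1r.
by rewrite /abs2 /= sqr_sqrtr// addr_ge0 ?sqr_ge0.
Qed.

End Upper.

Section Upper2.
Local Open Scope complex_scope.
Variable R : realType.
Notation mu := (@lebesgue_measure R).
Variables (n : nat) (S : 'M[R]_2).
Hypotheses (n0 : (0 < n)%N) (hdens : density S = (2 * n)%:R).
Hypotheses (S01 : S 0 1 = 0) (S00 : 0 < S 0 0) (S11 : 0 < S 1 1) (S10 : S 1 0 = S 1 1 / 2).

(** Applying the real bound to the real and imaginary parts separately would leave cross terms in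
    the coefficients of [f]; these cancel in pairs of mirror frequencies, so the constant is not
    doubled. *)
Lemma frame_upper_bound : is_upper_frame_bound (@gauss0 R) (lattice S)
  ((2 * n)%:R * energy (2 * pi * n%:R ^+ 2) (S 0 0 ^+ 2 + S 1 0 ^+ 2)
      (S 0 0 * S 0 1 + S 1 0 * S 1 1) (S 0 1 ^+ 2 + S 1 1 ^+ 2)).
Proof.
have alga : S 0 0 * S 1 1 = (2 * n)%:R^-1.
  by rewrite -hdens /density /vol invrK det2 S01 mul0r subr0 gtr0_norm// mulr_gt0.
rewrite S01 S10 mulr0 expr0n /= !add0r -kernel_sum1//.
set C := kernel_sum _ _ _.
move=> f [mRe mIm fin].
pose f1 t := complex.Re (f t); pose f2 t := complex.Im (f t).
have fE : f = fun t => f1 t +i* f2 t by apply/funext => t; rewrite /f1 /f2; case: (f t).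
have a2 t : abs2 (f t) = f1 t ^+ 2 + f2 t ^+ 2.
  by rewrite fE /abs2 /= sqr_sqrtr// addr_ge0 ?sqr_ge0.
have m1 : measurable_fun [set: R] (fun t => f1 t ^+ 2) by exact: measurable_funX.
have m2 : measurable_fun [set: R] (fun t => f2 t ^+ 2) by exact: measurable_funX.
have r : rint (fun t => f1 t ^+ 2 + f2 t ^+ 2).
  apply/integrableP; split; first by apply/measurable_EFinP; exact: measurable_funD.
  rewrite (_ : (\int[mu]_x _)%E = sqnorm f)//.
  by apply: eq_integral => t _ /=; rewrite a2 ger0_norm// addr_ge0 ?sqr_ge0.
have r1 : rint (fun t => f1 t ^+ 2).
  by apply: rint_le m1 r _ => t; rewrite ger0_norm ?sqr_ge0// lerDl sqr_ge0.
have r2 : rint (fun t => f2 t ^+ 2).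
  by apply: rint_le m2 r _ => t; rewrite ger0_norm ?sqr_ge0// lerDr sqr_ge0.
have sq : sqnorm f = (Rintegral mu [set: R] (fun t => f1 t ^+ 2) + Rintegral mu [set: R] (fun t => f2 t ^+ 2))%:E.
  by rewrite /sqnorm; under eq_integral do rewrite a2; rewrite rint_E// RintD.
pose P g v := coef_cos (S 0 0) (S 1 1) g v ^+ 2 + coef_sin (S 0 0) (S 1 1) g v ^+ 2.
have P0 g v : 0 <= P g v by rewrite addr_ge0 ?sqr_ge0.
have [sP1 leP1] : absum (P f1) /\ psum (P f1) <= C * Rintegral mu [set: R] (fun t => f1 t ^+ 2).
  by apply: psum_le => // s us; exact: real_frame_bound.
have [sP2 leP2] : absum (P f2) /\ psum (P f2) <= C * Rintegral mu [set: R] (fun t => f2 t ^+ 2).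
  by apply: psum_le => // s us; exact: real_frame_bound.
pose Q v := (coef_cos (S 0 0) (S 1 1) f1 v + coef_sin (S 0 0) (S 1 1) f2 v) ^+ 2 +
  (coef_cos (S 0 0) (S 1 1) f2 v - coef_sin (S 0 0) (S 1 1) f1 v) ^+ 2.
have Q0 v : 0 <= Q v by rewrite addr_ge0 ?sqr_ge0.
(* Reversal of frequency at fixed time. The half-step shift of the lines keeps the image in the
   lattice. *)
pose rf (v : int * int) : int * int := (v.1, - v.2 - v.1).
have brf : bijective rf by exists rf => -[x y]; rewrite /rf /=; congr (_, _); lia.
have frN v : freq (S 1 1) (rf v) = - freq (S 1 1) v.
  by rewrite /freq /rf /= !(intrD, mulrNz); field.
(* For the mirror frequency the cross terms between real and imaginary parts cancel. *)
have QQ v : Q v + Q (rf v) = 2 * (P f1 v + P f2 v).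
  have ccE g : coef_cos (S 0 0) (S 1 1) g (rf v) = coef_cos (S 0 0) (S 1 1) g v.
    by apply: eq_Rintegral => t _; rewrite frN mulrN mulNr cosN.
  have csE g : rint (fun t => g t ^+ 2) -> measurable_fun [set: R] g ->
      coef_sin (S 0 0) (S 1 1) g (rf v) = - coef_sin (S 0 0) (S 1 1) g v.
    move=> rg mg; rewrite -mulN1r -RintZ; last exact: rint_sin.
    by apply: eq_Rintegral => t _; rewrite frN mulrN mulNr sinN; ring.
  by rewrite /Q !ccE !csE// /P; ring.
have sQ : absum Q.
  apply: absum_le (absumZ 2 (absumD sP1 sP2)) => v.
  have h : Q v <= 2 * (P f1 v + P f2 v) by rewrite -QQ lerDl.
  by rewrite !ger0_norm// (le_trans (Q0 v)).
have eQ : psum Q = psum (P f1) + psum (P f2).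
  have : psum Q + psum Q = 2 * (psum (P f1) + psum (P f2)).
    rewrite -[X in _ = 2 * X]psumD// -psumZ; last exact: absumD.
    rewrite [X in _ + X](reindex_psum _ brf) -psumD//; last exact: reindex_absum brf _.
    by apply: eq_psum => v; rewrite QQ.
  lra.
rewrite (reindex_esum [set: int * int] _ _ _ (lattice_bij n0 hdens)).
rewrite (_ : \esum_(v in _) _ = \esum_(v in [set: int * int]) (Q v)%:E)%E; last first.
  apply: eq_esum => v _; congr EFin; rewrite fE; apply: conj_coef => //; rewrite mxE /=.
    by rewrite S01 mul0r addr0.
  by rewrite S10 /freq; ring.
by rewrite -psum_ge0E// eQ sq -EFinM lee_fin mulrDr lerD.
Qed.

End Upper2.

(** * Comparison of the frame bounds *)

Section Assembly.
Variable R : realType.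

Lemma mul2E (A : pzRingType) (p q : nat) (M : 'M[A]_(p, 2)) (N : 'M[A]_(2, q)) i j :
  (M *m N) i j = M i 0 * N 0 j + M i 1 * N 1 j.
Proof.
rewrite mxE !big_ord_recl big_ord0 addr0; congr (_ + M _ _ * N _ _); exact/val_inj.
Qed.

Lemma eq_mx2 (A : Type) (M N : 'M[A]_2) : M 0 0 = N 0 0 -> M 0 1 = N 0 1 ->
  M 1 0 = N 1 0 -> M 1 1 = N 1 1 -> M = N.
Proof.
have ord2 (i : 'I_2) : i = 0 \/ i = 1.
  by case: i => -[|[|//]] hi; [left|right]; exact/val_inj.
by move=> h00 h01 h10 h11; apply/matrixP => i j; case: (ord2 i) => ->; case: (ord2 j) => ->.
Qed.

Lemma energy_scale (n : nat) (a b c : R) :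
  energy (2 * pi * n%:R ^+ 2) a b c = energy (pi * n%:R) ((2 * n)%:R * a) ((2 * n)%:R * b) ((2 * n)%:R * c).
Proof. by apply: eq_psum => v; congr expR; rewrite /qf natrM; ring. Qed.

Lemma hexmxE n : let s : R := (Num.sqrt (2 * n)%:R)^-1 in
  let r3 : R := 3 `^ 4^-1 in let r2 : R := Num.sqrt 2 in
  [/\ hexmx R n 0 0 = s * (r3 / r2), hexmx R n 0 1 = 0,
      hexmx R n 1 0 = s * (r2 / (2 * r3)) & hexmx R n 1 1 = s * (r2 / r3)].
Proof. by move=> s r3 r2; split; rewrite !mxE //= mulr0. Qed.

Section Hexagonal.
Variable n : nat.
Hypothesis n0 : (0 < n)%N.
Local Notation H := (hexmx R n).

Lemma hexmx_gram : [/\ [/\ H 0 1 = 0, 0 < H 0 0, 0 < H 1 1, H 1 0 = H 1 1 / 2 & density H = (2 * n)%:R],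
   (2 * n)%:R * (H 0 0 ^+ 2 + H 1 0 ^+ 2) = hexa R,
   (2 * n)%:R * (H 0 0 * H 0 1 + H 1 0 * H 1 1) = hexb R &
   (2 * n)%:R * (H 0 1 ^+ 2 + H 1 1 ^+ 2) = hexa R].
Proof.
have [h00 h01 h10 h11] := hexmxE n; rewrite h01 /density /vol det2 h01 h00 h10 h11.
have N0 : 0 < (2 * n)%:R :> R by rewrite ltr0n muln_gt0.
set s := _^-1; have s0 : 0 < s by rewrite invr_gt0 sqrtr_gt0.
have s2 : s ^+ 2 = (2 * n)%:R^-1 by rewrite exprVn sqr_sqrtr// ltW.
set N : R := (2 * n)%:R in N0 s2 *.
set r2 := Num.sqrt 2; have r20 : 0 < r2 by rewrite sqrtr_gt0.
have r22 : r2 ^+ 2 = 2 by rewrite sqr_sqrtr.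
set r3 := 3 `^ 4^-1; have r30 : 0 < r3 by exact: powR_gt0.
have r32 : r3 ^+ 2 = Num.sqrt 3.
  rewrite expr2 -powRD ?pnatr_eq0 ?implybT// (_ : 4^-1 + 4^-1 = 2^-1 :> R); last by field.
  exact: powR12_sqrt.
have [q0 q2] := sqrt3 R; set q := Num.sqrt 3 in r32 q0 q2 *.
have r2n : r2 != 0 by rewrite gt_eqF.
have r3n : r3 != 0 by rewrite gt_eqF.
have qn : q != 0 by rewrite gt_eqF.
have Nn : N != 0 by rewrite gt_eqF.
have sq u : N * (s ^+ 2 * u) = u by rewrite s2 mulVKf.
split.
- split => //; [by rewrite mulr_gt0// divr_gt0|by rewrite mulr_gt0// divr_gt0|by field|].
  rewrite mul0r subr0 (_ : _ * _ * _ = s ^+ 2); last by field; rewrite r2n r3n.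
  by rewrite s2 ger0_norm ?invrK// invr_ge0 ltW.
- rewrite !exprMn -mulrDr sq !exprVn exprMn r32 r22 /hexa -/q.
  by rewrite -{1}(mulfK qn q) -expr2 q2; field.
- rewrite mulr0 add0r (_ : _ * _ * _ = s ^+ 2 * (r2 ^+ 2 / (2 * r3 ^+ 2))); last by field.
  by rewrite sq r22 r32 /hexb -/q; field.
- by rewrite expr0n add0r !exprMn sq !exprVn r22 r32 /hexa -/q.
Qed.

Lemma hex_upper_frame_bound :
  (upper_frame_bound (@gauss0 R) (lattice H) <=
    ((2 * n)%:R * energy (pi * n%:R) (hexa R) (hexb R) (hexa R))%:E)%E.
Proof.
have [[h1 h2 h3 h4 h5] ga gb gc] := hexmx_gram.
apply: ereal_inf_lbound; exists ((2 * n)%:R * energy (pi * n%:R) (hexa R) (hexb R) (hexa R)) => //.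
have := frame_upper_bound n0 h5 h1 h2 h3 h4.
by rewrite energy_scale ga gb gc.
Qed.

End Hexagonal.

Definition intmx2 (u v : int * int) : 'M[int]_2 :=
  \matrix_(i, j) let w := if j == 0 then u else v in if i == 0 then w.1 else w.2.

Lemma lattice_basis (S : 'M[R]_2) (u v : int * int) : basisv u v ->
  lattice (S *m map_mx intr (intmx2 u v)) = lattice S.
Proof.
move=> uv; set U := intmx2 u v.
have Uu : U \in unitmx.
  rewrite unitmxE (expand_det_row _ 0) !big_ord_recl big_ord0 addr0 /cofactor !det_mx11 !mxE /=.
  rewrite /bump /= expr0 expr1 mul1r mulN1r mulrN.
  apply/unitrP; exists (u.1 * v.2 - v.1 * u.2).
  by rewrite -expr2 uv.
apply/seteqP; split => x [k _ <-].
  by exists (U *m k) => //; rewrite map_mxM mulmxA.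
exists (invmx U *m k) => //; rewrite -mulmxA -map_mxM; congr (_ *m map_mx _ _).
by rewrite mulmxA mulmxV// mul1mx.
Qed.

(** Bases with equal Gram matrices differ by the isometry [M *m invmx H]. *)
Lemma orthogonal_factor (M H : 'M[R]_2) : H \in unitmx -> M^T *m M = H^T *m H ->
  exists Q, Q *m Q^T = 1%:M /\ Q *m H = M.
Proof.
move=> Hu E; exists (M *m invmx H); split; last by rewrite mulmxKV.
apply: mulmx1C; rewrite trmx_mul mulmxA -(mulmxA _ M^T) E trmx_inv mulmxA mulmxK//.
by rewrite mulVmx// unitmx_tr.
Qed.

End Assembly.

Theorem theorem1p1 (R : realType) (n : nat) (hn : (1 <= n)%N)
    (S : 'M[R]_2) (hS : S \in unitmx) (hdens : density S = (2 * n)%:R) :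
  (upper_frame_bound (@gauss0 R) (lattice (hexmx R n))
     <= upper_frame_bound (@gauss0 R) (lattice S))%E /\
  (upper_frame_bound (@gauss0 R) (lattice (hexmx R n))
     = upper_frame_bound (@gauss0 R) (lattice S) ->
   exists (Q : 'M[R]_2) (B : 'M[int]_2),
     [/\ Q *m Q^T = 1%:M, \det B = 1 &
         lattice S = lattice (Q *m hexmx R n *m map_mx intr B)]).
Proof.
have N0 : 0 < (2 * n)%:R :> R by rewrite ltr0n muln_gt0.
have [a0 D] := gram_det hn hdens.
set a := S 0 0 ^+ 2 + _ in a0 D; set b := S 0 0 * S 0 1 + _ in D; set c := S 0 1 ^+ 2 + _ in D.
set N : R := (2 * n)%:R in N0 D.
have A0 : 0 < N * a by rewrite mulr_gt0.
have D1 : N * a * (N * c) - (N * b) ^+ 2 = 1.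
  rewrite (_ : _ - _ = N ^+ 2 * (a * c - b ^+ 2)); last by ring.
  by rewrite D mulfV// expf_neq0// gt_eqF.
have D0 : 0 < N * a * (N * c) - (N * b) ^+ 2 by rewrite D1.
have [u [v [uv b0 ba ac]]] := reduced_basis A0 D0.
have D' := disc_basis (N * a) (N * b) (N * c) uv; rewrite D1 in D'.
have E' := energy_basis (pi * n%:R) (N * a) (N * b) (N * c) uv.
set a' := qf _ _ _ u in ba ac D' E'; set b' := bf _ _ _ u v in b0 ba D' E'; set c' := qf _ _ _ v in ac D' E'.
have a'0 : 0 < a'.
  have a'ge : 0 <= a' by lra.
  rewrite lt_def a'ge andbT; apply/eqP => e; move: D'; rewrite e mul0r.
  by have := sqr_ge0 b'; lra.
have b'0 : 0 <= b' by lra.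
have [min eqmin] := energy_hex_min hn a'0 D' b'0 ba ac.
rewrite E' in min eqmin.
have lo : ((N * energy (pi * n%:R) (N * a) (N * b) (N * c))%:E <= upper_frame_bound (@gauss0 R) (lattice S))%E.
  apply: le_ereal_inf_tmp => _ [B HB <-]; rewrite lee_fin -energy_scale.
  exact: frame_lower_bound hn hdens _ HB.
have up := hex_upper_frame_bound R hn.
split.
  by apply: le_trans up (le_trans _ lo); rewrite lee_fin ler_wpM2l// ltW.
move=> eqB; rewrite eqB in up.
have {}eqmin := eqmin _.
(* Equal frame bounds put the energy of [S] below the hexagonal one, so the minimum is attained and
   the reduced form is hexagonal. *)
have := le_trans lo up; rewrite lee_fin ler_pM2l// => le.
have [|ea eb ec] := eqmin; first by apply/eqP; rewrite eq_le min le.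
have [[h1 h2 h3 h4 h5] ga gb gc] := hexmx_gram R hn.
move: (hexmx R n) h1 h2 h3 h4 h5 ga gb gc => H h1 h2 h3 h4 h5 ga gb gc.
have Hu : H \in unitmx.
  by rewrite unitmxE unitfE det2 h1 mul0r subr0 mulf_neq0// gt_eqF.
pose M := S *m map_mx intr (intmx2 u v).
have NI : injective ( *%R N) by exact: mulfI (lt0r_neq0 N0).
have EM : M^T *m M = H^T *m H.
  apply: eq_mx2; apply: NI; rewrite !mul2E ![(_^T) _ _]mxE /M !mul2E !mxE /=.
  - by rewrite -!expr2 ga -ea /a' /qf /a /b /c; ring.
  - by rewrite gb -eb /b' /bf /a /b /c; ring.
  - by rewrite [X in _ = N * (X + _)]mulrC [X in _ = N * (_ + X)]mulrC gb -eb /b' /bf /a /b /c; ring.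
  - by rewrite -!expr2 gc -ec /c' /qf /a /b /c; ring.
have [Q [QQ QH]] := orthogonal_factor Hu EM.
(* The basis change is already contained in [M], which spans the lattice of [S], so the identity
   serves as [B]; a reversed orientation of the basis is absorbed by [Q]. *)
exists Q, 1%:M; split => //; first exact: det1.
by rewrite map_mx1 mulmx1 QH lattice_basis.
Qed.
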